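(* Let $k$ be a field of characteristic $0$ and $V^\bullet$ a graded $k$-vector space of finite total dimension. The infinitesimal quotient of the derived variety of complexes $\mathrm{RCom}(V^\bullet)/\mathfrak l_1$ is a homotopy BV-manifold. That is, its dg-algebra of functions $C^\bullet(\mathfrak l_1,C^\bullet(\mathfrak n,k))\cong C^\bullet(\mathfrak q_1,k)$, with the differential Gerstenhaber structure determined by the restriction to $\mathfrak q_1$ of the standard Lie cobracket of $\operatorname{End}(V)$, is quasi-isomorphic, as a differential Gerstenhaber algebra, to a differential Batalin–Vilkovisky algebra.
   Context: Gradings are by $\mathbb Z$; $(U[m])^i=U^{i+m}$; $U^*$ is the graded dual. $\operatorname{End}(V)$ is the graded Lie algebra (super-commutator) of endomorphisms of all degrees of $V=\bigoplus_iV^i$, where $\operatorname{Hom}(V^i,V^j)$ sits in degree $j-i$. Put $$\mathfrak q=\bigoplus_{i\le j}\operatorname{Hom}(V^i,V^j)[i-j],\quad \mathfrak l=\bigoplus_i\mathfrak{gl}(V^i),\quad \mathfrak n=\bigoplus_{i<j}\operatorname{Hom}(V^i,V^j)[i-j].$$ Let $\mathfrak{sl}(V)\subset\operatorname{End}(V)$ be the elements of supertrace $0$, $\mathfrak l_1=\mathfrak l\cap\mathfrak{sl}(V)$, $\mathfrak q_1=\mathfrak q\cap\mathfrak{sl}(V)=\mathfrak l_1\oplus\mathfrak n$. $C^\bullet(\mathfrak g,M)$ is the Chevalley–Eilenberg complex; $C^\bullet(\mathfrak g,k)=S^\bullet(\mathfrak g^*[-1])$. $\mathrm{RCom}(V^\bullet)=\operatorname{Spec}C^\bullet(\mathfrak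 n,k)$, and the infinitesimal quotient of $\operatorname{Spec}A$ by a Lie algebra $\mathfrak g$ is $\operatorname{Spec}C^\bullet(\mathfrak g,A)$. Standard Lie bialgebra structure on $\mathfrak g=\operatorname{End}(V)$: choose a homogeneous basis of $V$ ordered so that the Borel subalgebra $\mathfrak b_+$ of upper triangular matrices lies in $\mathfrak q$; let $\mathfrak b_-$ be the lower triangular matrices, $\mathfrak h$ the diagonal ones, $p\colon\mathfrak b_\pm\to\mathfrak h$ the projections. Let $(a,b)=\operatorname{str}(ab)$ on $\mathfrak g$ and $((x_1,y_1),(x_2,y_2))=(x_1,x_2)-(y_1,y_2)$ on $\mathfrak g\oplus\mathfrak g$. Pairing with the diagonal copy of $\mathfrak g$ identifies $\mathfrak p_-=\{(x,y)\in\mathfrak b_+\oplus\mathfrak b_-:p(x)+p(y)=0\}$ with $\mathfrak g^*$, and the Lie bracket of $\mathfrak p_-$ is $\phi^*$ for the standard cobracket $\phi\colon\mathfrak g\to\mathfrak g\otimes\mathfrak g$; $\phi$ restricts to $\mathfrak q_1$. A differential Gerstenhaber algebra is a graded-commutative dg algebra $(A,d)$, $\deg d=+1$, with a bracket of degree $-1$ making $A[1]$ a graded Lie algebra, with $\langle x,yz\rangle=\langle x,y\rangle z+(-1)^{(|x|-1)|y|}y\langle x,z\rangle$ and $d\langle x,y\rangle=\langle dx,y\rangle+(-1)^{|x|+1}\langle x,dy\rangle$. On $C^\bullet(\mathfrak q_1,k)$ the bracket is $\langle x[-1],y[-1]\rangle=\phi^*(x,y)[-1]$ on generators, extended by the derivation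 rule. A differential Batalin–Vilkovisky algebra is a graded-commutative dg algebra $(A,d)$, $\deg d=+1$, with a differential operator $B$ of order $\le2$ and degree $-1$ such that $B^2=0$, $B(1)=0$, $dB+Bd=0$; it is a differential Gerstenhaber algebra via $\langle x,y\rangle=(-1)^{|x|}(B(xy)-(Bx)y-(-1)^{|x|}xBy)$. *)

(* Defs.v *)
From HB Require Import structures.
From Stdlib Require Import Relation_Operators.
From mathcomp Require Import all_boot all_order all_algebra.

Set Implicit Arguments.
Unset Strict Implicit.
Unset Printing Implicit Defensive.

Import Order.TTheory GRing.Theory Num.Theory.
Local Open Scope ring_scope.

(* Gradings are internal: a graded object is an ungraded one together with its
   homogeneous parts. *)

Definition sgn (k : fieldType) (m : int) : k := (-1) ^ m.

Definition is_grading (k : fieldType) (U : lmodType k)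
    (G : int -> U -> Prop) : Prop :=
  [/\ forall m, G m 0,
      forall m (c : k) x y, G m x -> G m y -> G m (c *: x + y),
      forall x, exists (s : seq int) (f : int -> U),
        (forall m, G m (f m)) /\ x = \sum_(m <- s) f m
    & forall (s : seq int) (f : int -> U), uniq s -> (forall m, G m (f m)) ->
        \sum_(m <- s) f m = 0 -> forall m, m \in s -> f m = 0].

Record gcAlg (k : fieldType) := GcAlg {
  gc_sort :> algType k;
  hdeg : int -> gc_sort -> Prop;
  hdeg_grading : is_grading hdeg;
  hdeg1 : hdeg 0 1;
  hdegM : forall m n x y, hdeg m x -> hdeg n y -> hdeg (m + n) (x * y);
  gc_mulC : forall m n x y, hdeg m x -> hdeg n y ->
    x * y = sgn k (m * n) *: (y * x)
}.

Arguments hdeg {k g} m x : rename.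

Record dgcAlg (k : fieldType) := DgcAlg {
  dgc_gc :> gcAlg k;
  dif : {linear dgc_gc -> dgc_gc};
  dif_deg : forall m x, hdeg m x -> hdeg (m + 1) (dif x);
  dif_dif : forall x, dif (dif x) = 0;
  dif_mul : forall m x y, hdeg m x ->
    dif (x * y) = dif x * y + sgn k m *: (x * dif y)
}.

Arguments dif {k d} : rename.

Definition gpres (k : fieldType) (A B : gcAlg k) (f : A -> B) : Prop :=
  forall m x, hdeg m x -> hdeg m (f x).

Definition is_dg_iso (k : fieldType) (A B : dgcAlg k)
    (f : {lrmorphism A -> B}) : Prop :=
  [/\ bijective f, gpres f & forall x, f (dif x) = dif (f x)].

Record is_gerstenhaber (k : fieldType) (A : dgcAlg k) (br : A -> A -> A) :
    Prop := IsGerstenhaber {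
  ger_linl : forall (c : k) x x' y, br (c *: x + x') y = c *: br x y + br x' y;
  ger_linr : forall (c : k) x y y', br x (c *: y + y') = c *: br x y + br x y';
  ger_deg : forall m n x y, hdeg m x -> hdeg n y -> hdeg (m + n - 1) (br x y);
  ger_anti : forall m n x y, hdeg m x -> hdeg n y ->
    br x y = - sgn k ((m - 1) * (n - 1)) *: br y x;
  ger_jacobi : forall m n p x y z, hdeg m x -> hdeg n y -> hdeg p z ->
    br x (br y z)
    = br (br x y) z + sgn k ((m - 1) * (n - 1)) *: br y (br x z);
  ger_poisson : forall m n x y z, hdeg m x -> hdeg n y ->
    br x (y * z) = br x y * z + sgn k ((m - 1) * n) *: (y * br x z);
  ger_dif : forall m x y, hdeg m x ->
    dif (br x y) = br (dif x) y + sgn k (m + 1) *: br x (dif y)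
}.

Record dGAlg (k : fieldType) := DGAlg {
  dG_dgc :> dgcAlg k;
  gbr : dG_dgc -> dG_dgc -> dG_dgc;
  gbrP : is_gerstenhaber gbr
}.

Arguments gbr {k d} x y : rename.

Record is_dG_quasi_iso (k : fieldType) (A B : dGAlg k)
    (f : {lrmorphism A -> B}) : Prop := IsDGQuasiIso {
  qi_deg : gpres f;
  qi_dif : forall x, f (dif x) = dif (f x);
  qi_br : forall x y, f (gbr x y) = gbr (f x) (f y);
  qi_inj : forall x, dif x = 0 -> (exists y, f x = dif y) ->
    exists z, x = dif z;
  qi_surj : forall y, dif y = 0 ->
    exists x z, dif x = 0 /\ y = f x + dif z
}.

(* A finite zigzag of quasi-isomorphisms of differential Gerstenhaber
   algebras. *)
Definition quasi_isomorphic (k : fieldType) : dGAlg k -> dGAlg k -> Prop :=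
  @clos_refl_sym_trans (dGAlg k)
    (fun A B => exists f : {lrmorphism A -> B}, is_dG_quasi_iso f).

(* Grothendieck's definition, with graded commutators: P, homogeneous of
   degree p, has order <= r if [P, a] has order <= r - 1 for every homogeneous
   a, the only operator of order <= -1 being 0. *)
Fixpoint diffop (k : fieldType) (A : gcAlg k) (r : nat) (p : int)
    (P : A -> A) : Prop :=
  forall m (a : A), hdeg m a ->
    let Q x := P (a * x) - sgn k (p * m) *: (a * P x) in
    if r is r'.+1 then diffop r' (p + m) Q else forall x, Q x = 0.

Record dBVAlg (k : fieldType) := DBVAlg {
  bv_dgc :> dgcAlg k;
  bvop : {linear bv_dgc -> bv_dgc};
  bv_deg : forall m x, hdeg m x -> hdeg (m - 1) (bvop x);
  bv_order : diffop 2 (- 1) bvop;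
  bv_sqr : forall x, bvop (bvop x) = 0;
  bv_one : bvop 1 = 0;
  bv_dif : forall x, dif (bvop x) + bvop (dif x) = 0
}.

Arguments bvop {k d} : rename.

(* A bilinear bracket is determined by its values on homogeneous elements, so
   at most one br satisfies both this and is_gerstenhaber. *)
Definition is_bv_bracket (k : fieldType) (M : dBVAlg k) (br : M -> M -> M) :
    Prop :=
  forall m x y, hdeg m x ->
    br x y = sgn k m *: (bvop (x * y) - bvop x * y - sgn k m *: (x * bvop y)).

(* The data of a finite-dimensional graded Lie algebra; the axioms are not
   recorded, and hold in the instances used, which are subalgebras of End(V). *)
Record gLie (k : fieldType) := GLie {
  gl_sort :> vectType k;
  gl_gr : int -> {vspace gl_sort};
  gl_br : gl_sort -> gl_sort -> gl_sort
}.

Notation dual k L := 'Hom(L, GRing.regular k).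

(* The degree m part of the graded dual is the dual of the degree -m part. *)
Definition dual_deg (k : fieldType) (L : gLie k) (m : int) (xi : dual k L) :
    Prop :=
  forall j x, x \in gl_gr L j -> j != - m -> xi x = 0.

Section Ground.
Variable k : fieldType.

Definition ground_deg (m : int) (x : k^o) : Prop := m = 0 \/ x = 0.

Fact ground_grading : is_grading ground_deg.
Proof.
split=> [m|m c x y [->|->] [|->]|x|s f us Gf].
- by right.
- by left.
- by left.
- by left.
- by right; rewrite scaler0 addr0.
- exists [:: 0], (fun m => if m == 0 then x else 0); split=> [m|].
    by case: eqP; [left | right].
  by rewrite big_seq1.
move=> s0 m ms; case: (Gf m) => // m0.
rewrite -s0 (bigD1_seq m) //= big1 ?addr0 // => i im.
by case: (Gf i) => // i0; rewrite i0 m0 eqxx in im.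
Qed.

Fact ground_degM m n (x y : k^o) :
  ground_deg m x -> ground_deg n y -> ground_deg (m + n) (x * y).
Proof.
move=> [->|->] [->|->]; rewrite ?addr0; first by left.
- by right; rewrite mulr0.
- by right; rewrite mul0r.
- by right; rewrite mul0r.
Qed.

Fact ground_mulC m n (x y : k^o) : ground_deg m x -> ground_deg n y ->
  x * y = sgn k (m * n) *: (y * x).
Proof.
move=> [->|->] [->|->];
  by rewrite ?(mulr0, mul0r, scaler0) // /sgn expr0z scale1r mulrC.
Qed.

Definition ground_gc : gcAlg k :=
  @GcAlg k k^o ground_deg ground_grading (or_introl (erefl 0))
    ground_degM ground_mulC.

Fact ground_dif_deg m (x : ground_gc) :
  hdeg m x -> hdeg (m + 1) ((\0 : {linear ground_gc -> ground_gc}) x).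
Proof. by move=> _; right. Qed.

Fact ground_dif_mul m (x y : ground_gc) : hdeg m x ->
  (\0 : {linear ground_gc -> ground_gc}) (x * y)
  = (\0 : {linear ground_gc -> ground_gc}) x * y
    + sgn k m *: (x * (\0 : {linear ground_gc -> ground_gc}) y).
Proof. by move=> _ /=; rewrite mul0r mulr0 scaler0 addr0. Qed.

Definition ground : dgcAlg k :=
  @DgcAlg k ground_gc (\0 : {linear ground_gc -> ground_gc})
    ground_dif_deg (fun=> erefl) ground_dif_mul.
End Ground.

(* C^*(g, A) for a graded Lie algebra g acting on A: the graded-commutative
   algebra S(g^*[-1]) (x) A, given as the free graded-commutative algebra over
   A on the graded vector space g^*[-1], with the Chevalley-Eilenberg
   differential. Any two objects of type CE act are related by a unique
   isomorphism compatible with ce_coef and ce_gen.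

   For a homogeneous basis e_i of g with dual basis e^i, put c^i = e^i[-1] and
   c = \sum_i c^i (x) e_i. The differential is the derivation with
       d c + [c, c] / 2 = 0   and   d a = d_A a + \sum_i c^i (e_i . a),
   that is, f_ij^k being the structure constants,
       d c^k = - 1/2 \sum_ij (-1)^(|i|(1 + |j|)) f_ij^k c^i c^j.
   Below, e^i and e_i are replaced by arbitrary decompositions of the bilinear
   form xi([x, y]) and of the map x |-> x . a. *)
Record CE (k : fieldType) (L : gLie k) (A : dgcAlg k) (act : L -> A -> A) :=
    MkCE {
  ce_alg :> dgcAlg k;
  ce_coef : {lrmorphism A -> ce_alg};
  ce_gen : {linear dual k L -> ce_alg};
  ce_coef_deg : gpres ce_coef;
  ce_gen_deg : forall m xi, dual_deg m xi -> hdeg (m + 1) (ce_gen xi);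
  ce_free : forall (B : gcAlg k) (a : {lrmorphism A -> B})
      (f : {linear dual k L -> B}),
    gpres a -> (forall m xi, dual_deg m xi -> hdeg (m + 1) (f xi)) ->
    exists F : {lrmorphism ce_alg -> B},
      [/\ gpres F, forall x, F (ce_coef x) = a x,
          forall xi, F (ce_gen xi) = f xi
        & forall F' : {lrmorphism ce_alg -> B}, gpres F' ->
            (forall x, F' (ce_coef x) = a x) ->
            (forall xi, F' (ce_gen xi) = f xi) -> F' =1 F];
  ce_dif_gen : forall (xi : dual k L) (r : nat) (p q : 'I_r -> int)
      (eta zeta : 'I_r -> dual k L),
    (forall s, dual_deg (p s) (eta s)) -> (forall s, dual_deg (q s) (zeta s)) ->
    (forall x y, xi (gl_br x y) = \sum_s eta s x * zeta s y) ->
    dif (ce_gen xi)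
    = - 2%:R^-1 *: \sum_s sgn k (p s * (1 + q s)) *:
                            (ce_gen (eta s) * ce_gen (zeta s));
  ce_dif_coef : forall (a : A) (r : nat) (eta : 'I_r -> dual k L)
      (b : 'I_r -> A),
    (forall x, act x a = \sum_s (eta s x : k) *: b s) ->
    dif (ce_coef a)
    = ce_coef (dif a) + \sum_s ce_gen (eta s) * ce_coef (b s)
}.

Definition CE_trivial (k : fieldType) (L : gLie k) :=
  @CE k L (ground k) (fun _ _ => 0).

Record gvect (k : fieldType) := GVect {
  gv_sort :> vectType k;
  gv_gr : int -> {vspace gv_sort};
  gv_supp : seq int;
  gv_supp_uniq : uniq gv_supp;
  gv_out : forall i, i \notin gv_supp -> gv_gr i = 0%VS;
  gv_full : (\sum_(i <- gv_supp) gv_gr i)%VS = fullv;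
  gv_direct : directv (\sum_(i <- gv_supp) gv_gr i)
}.

Section EndV.
Variables (k : fieldType) (V : gvect k).
Local Notation supp := (gv_supp V).

Definition gproj (i : int) : 'End(V) :=
  daddv_pi (gv_gr V i) (\sum_(j <- supp | j != i) gv_gr V j)%VS.

Definition homV (i j : int) : {vspace 'End(V)} :=
  limg (linfun (fun f : 'End(V) => (gproj j \o f \o gproj i)%VF)).

Definition end_gr (m : int) : {vspace 'End(V)} :=
  (\sum_(i <- supp) homV i (i + m)%R)%VS.

Definition end_comp (m : int) (f : 'End(V)) : 'End(V) :=
  \sum_(i <- supp) (gproj (i + m) \o f \o gproj i)%VF.

Definition end_degs : seq int := undup [seq j - i | i <- supp, j <- supp].

(* The super-commutator, f g - (-1)^(|f||g|) g f on homogeneous elements. *)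
Definition scomm (f g : 'End(V)) : 'End(V) :=
  \sum_(p <- end_degs) \sum_(q <- end_degs)
    ((end_comp p f \o end_comp q g)%VF
     - sgn k (p * q) *: (end_comp q g \o end_comp p f)%VF).

Definition lftrace (f : 'End(V)) : k :=
  \sum_(a < \dim {:V}) coord (vbasis {:V}) a (f (vbasis {:V})`_a).

Definition str (f : 'End(V)) : k :=
  \sum_(i <- supp) sgn k i * lftrace (gproj i \o f)%VF.

Definition q_sub : {vspace 'End(V)} :=
  (\sum_(i <- supp) \sum_(j <- supp | (i <= j)%R) homV i j)%VS.
Definition l_sub : {vspace 'End(V)} := (\sum_(i <- supp) homV i i)%VS.
Definition n_sub : {vspace 'End(V)} :=
  (\sum_(i <- supp) \sum_(j <- supp | (i < j)%R) homV i j)%VS.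
Definition sl_sub : {vspace 'End(V)} := lker (linfun (str : 'End(V) -> k^o)).
Definition l1_sub : {vspace 'End(V)} := (l_sub :&: sl_sub)%VS.
Definition q1_sub : {vspace 'End(V)} := (q_sub :&: sl_sub)%VS.

(* The subspace U of End(V), with the induced grading and bracket. It is used
   for subspaces closed under scomm, on which vsproj U inverts vsval. *)
Definition sub_gLie (U : {vspace 'End(V)}) : gLie k :=
  @GLie k (subvs_of U)
    (fun m => (linfun (vsval : subvs_of U -> 'End(V)) @^-1: end_gr m)%VS)
    (fun x y => vsproj U (scomm (vsval x) (vsval y))).

(* For xi on W and a subspace U of W, the restriction of xi to U. *)
Definition dual_res (U W : {vspace 'End(V)}) (xi : dual k (sub_gLie W)) :
    dual k (sub_gLie U) :=
  linfun (fun x : subvs_of U => xi (vsproj W (vsval x)) : k^o).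

Definition dual_res_end (U : {vspace 'End(V)}) (xi : dual k 'End(V)) :
    dual k (sub_gLie U) :=
  linfun (fun x : subvs_of U => xi (vsval x) : k^o).

(* The coadjoint action of l_1, which has degree 0, on n^*. *)
Definition coad (x : sub_gLie l1_sub) (xi : dual k (sub_gLie n_sub)) :
    dual k (sub_gLie n_sub) :=
  linfun (fun y : subvs_of n_sub =>
    - xi (vsproj n_sub (scomm (vsval x) (vsval y))) : k^o).

Section Cobracket.
Variables (n : nat) (e : n.-tuple V).

Definition munit (a b : 'I_n) : 'End(V) :=
  linfun (fun v => coord e b v *: e`_a).

Definition b_plus : {vspace 'End(V)} :=
  (\sum_(a < n) \sum_(b < n | (a <= b)%N) <[munit a b]>)%VS.
Definition b_minus : {vspace 'End(V)} :=
  (\sum_(a < n) \sum_(b < n | (b <= a)%N) <[munit a b]>)%VS.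

Definition diag_part : 'End('End(V)) :=
  linfun (fun f : 'End(V) => \sum_(a < n) coord e a (f e`_a) *: munit a a).

Definition p_minus : {vspace ('End(V) * 'End(V))%type} :=
  ((linfun (fun P : 'End(V) * 'End(V) => P.1) @^-1: b_plus)
   :&: (linfun (fun P : 'End(V) * 'End(V) => P.2) @^-1: b_minus)
   :&: lker (linfun (fun P : 'End(V) * 'End(V) =>
                       (diag_part P.1 + diag_part P.2)%R)))%VS.

(* z |-> ((x, y), (z, z)) = str (x z) - str (y z). *)
Definition diag_pairing (P : 'End(V) * 'End(V)) : dual k 'End(V) :=
  linfun (fun z : 'End(V) => str (P.1 \o z)%VF - str (P.2 \o z)%VF : k^o).

Definition p_minus_dual : 'Hom(subvs_of p_minus, dual k 'End(V)) :=
  linfun (fun P : subvs_of p_minus => diag_pairing (vsval P)).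

(* phi^*, the bracket of p_- carried to End(V)^* along the isomorphism
   p_minus_dual. *)
Definition cobracket_dual (xi eta : dual k 'End(V)) : dual k 'End(V) :=
  let P := vsval ((p_minus_dual^-1)%VF xi) in
  let Q := vsval ((p_minus_dual^-1)%VF eta) in
  diag_pairing (scomm P.1 Q.1, scomm P.2 Q.2).

(* C^*(n, k) with the action of l_1, C^*(l_1, C^*(n, k)), and C^*(q_1, k) with
   its differential Gerstenhaber structure; all of it is determined up to unique
   isomorphism, the action and the bracket being derivations with prescribed
   values on generators. That phi restricts to q_1 means that the bracket phi^*
   on End(V)^* descends to the quotient q_1^*, whence rc_br_gen. *)
Record RCom_quotient := MkRComQuotient {
  rc_n : CE_trivial (sub_gLie n_sub);
  rc_act : sub_gLie l1_sub -> {linear rc_n -> rc_n};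
  rc_act_mul : forall x a b, rc_act x (a * b) = rc_act x a * b + a * rc_act x b;
  rc_act_gen : forall x xi, rc_act x (ce_gen rc_n xi) = ce_gen rc_n (coad x xi);
  rc_ln : CE (fun x a => rc_act x a);
  rc_q : CE_trivial (sub_gLie q1_sub);
  rc_br : rc_q -> rc_q -> rc_q;
  rc_brP : is_gerstenhaber rc_br;
  rc_br_gen : forall xi eta : dual k 'End(V),
    rc_br (ce_gen rc_q (dual_res_end q1_sub xi))
          (ce_gen rc_q (dual_res_end q1_sub eta))
    = ce_gen rc_q (dual_res_end q1_sub (cobracket_dual xi eta))
}.

(* The comparison map which on generators is q_1^* = l_1^* (+) n^*. *)
Definition is_canonical (Q : RCom_quotient)
    (F : {lrmorphism rc_q Q -> rc_ln Q}) : Prop :=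
  forall xi : dual k (sub_gLie q1_sub),
    F (ce_gen (rc_q Q) xi)
    = ce_gen (rc_ln Q) (dual_res l1_sub xi)
      + ce_coef (rc_ln Q) (ce_gen (rc_n Q) (dual_res n_sub xi)).

End Cobracket.
End EndV.

(* Main.v *)
(* C(q_1, k) is the free graded-commutative algebra on the shifted dual of q_1.
   On a free graded-commutative algebra with generators x_i and a bracket that is
   linear on generators, B = 1/2 sum_i (-1)^|x_i| ad(x_i) d/dx_i generates the
   bracket and has square 0 by the Jacobi identity. As d derives the bracket,
   D = d B + B d is a derivation; it is null-homotopic, so when it is
   diagonalizable its kernel is a quasi-isomorphic differential Gerstenhaber
   subalgebra, and on ker D the operator B is a BV operator. For the standard
   cobracket, D is determined by the brackets of the factors in
   d x_ab = +- sum_c x_ac x_cb, where x_ab is dual to a matrix unit, and these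
   make every x_ab an eigenvector of D.

   The comparison C(q_1, k) -> C(l_1, C(n, k)) and its inverse come from the
   universal properties; compatibility with d is checked on the x_ab by splitting
   x_ab into its l_1 and n parts in the formula for d x_ab. *)
Require Import Defs.
From HB Require Import structures.
From Stdlib Require Import ClassicalEpsilon Relation_Operators.
From mathcomp Require Import all_boot all_order all_algebra.
From mathcomp Require Import ring zify.
Set Implicit Arguments.
Unset Strict Implicit.
Unset Printing Implicit Defensive.
Import Order.TTheory GRing.Theory Num.Theory.
Local Open Scope ring_scope.

(** * Linear combinations and signs *)

(** On all of C(q_1, k) the operator [B] need not anticommute with d: the eigenvalue of [D] on x_ab
    is -1/2 times the sum over c of (-1)^|c| (tau_ac + tau_cb), where |c| is the degree of the c-th
    basis vector and tau compares the positions of two indices. This obstruction forces the passage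
    to ker D. The x_ab span the dual of q_1 but are linearly dependent. Freeness is therefore used
    on the dual of an abstract homogeneous basis, while computations are done on the x_ab and
    carried over by linearity. That the bracket exists at all on the dual of q_1 means that the
    annihilator of q_1 is an ideal for the dual bracket. This rests on the ordering of the basis,
    along which degrees decrease, and on the supertrace being central modulo that annihilator. Free
    algebras are known only through their universal property, which produces algebra morphisms.
    Derivations are obtained as morphisms into a square-zero extension, and brackets and [B] are
    assembled from derivations. *)

Inductive lexpr (k : Type) :=
| LAtom of nat | LZero | LAdd of lexpr k & lexpr k | LOpp of lexpr k
| LScale of k & lexpr k.
Arguments LAtom {k}.
Arguments LZero {k}.

Section LinearReflection.
Variables (k : pzRingType) (V : lmodType k).

Fixpoint leval (env : seq V) (e : lexpr k) : V :=
  match e with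
  | LAtom i => nth 0 env i
  | LZero => 0
  | LAdd a b => leval env a + leval env b
  | LOpp a => - leval env a
  | LScale c a => c *: leval env a
  end.

Fixpoint lcoef (i : nat) (e : lexpr k) : k :=
  match e with
  | LAtom j => if Nat.eqb i j then 1 else 0
  | LZero => 0
  | LAdd a b => lcoef i a + lcoef i b
  | LOpp a => - lcoef i a
  | LScale c a => c * lcoef i a
  end.

(** A computed conjunction instead of a quantifier, so that reduction leaves one scalar equation per
    atom for [ring]. *)
Fixpoint lcoefs_eq (n : nat) (a b : lexpr k) : Prop :=
  match n with
  | 0 => True
  | n'.+1 => lcoefs_eq n' a b /\ lcoef n' a = lcoef n' b
  end.

Lemma leval_lcoef env e : leval env e = \sum_(i < size env) lcoef i e *: env`_i.
Proof.
elim: e => /= [j||a -> b ->|a ->|c a ->].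
- have [lt_j|le_j] := ltnP j (size env).
    rewrite (bigD1 (Ordinal lt_j)) //= PeanoNat.Nat.eqb_refl scale1r.
    rewrite big1 ?addr0 // => i /eqP ij.
    case: PeanoNat.Nat.eqb_spec => [e|]; last by rewrite scale0r.
    by case: ij; apply: val_inj.
  rewrite nth_default // big1 // => i _.
  case: PeanoNat.Nat.eqb_spec => [e|]; last by rewrite scale0r.
  by rewrite -e leqNgt ltn_ord in le_j.
- by rewrite big1 // => i _; rewrite scale0r.
- by rewrite -big_split; apply: eq_bigr => i _; rewrite scalerDl.
- by rewrite -sumrN; apply: eq_bigr => i _; rewrite scaleNr.
by rewrite scaler_sumr; apply: eq_bigr => i _; rewrite scalerA.
Qed.

Lemma lexprP env a b : lcoefs_eq (size env) a b -> leval env a = leval env b.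
Proof.
rewrite !leval_lcoef; elim: (size env) => [|n IH] /=; first by rewrite !big_ord0.
by move=> [/IH eqn eqc]; rewrite !big_ord_recr /= eqn eqc.
Qed.
End LinearReflection.

(** The inner [match] runs [unify] for its success or failure while the tactic still returns a term.
    Unification lets convertible forms of an atom share an index. *)
Ltac lmod_index x env :=
  match env with
  | cons ?y ?env' =>
      match constr:(Set) with
      | _ => let _ := match constr:(Set) with _ => unify x y end in constr:(O)
      | _ => let i := lmod_index x env' in constr:(S i)
      end
  end.

Ltac lmod_add x env :=
  match constr:(Set) with
  | _ => let _ := lmod_index x env in env
  | _ => match env with
         | nil => constr:(cons x nil)
         | cons ?y ?env' => let e := lmod_add x env' in constr:(cons y e)
         end
  end.

Ltac lmod_env t env :=
  lazymatch t with
  | GRing.zero => env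
  | GRing.add ?a ?b => let env := lmod_env a env in lmod_env b env
  | GRing.opp ?a => lmod_env a env
  | GRing.scale ?c ?a => lmod_env a env
  | _ => lmod_add t env
  end.

Ltac lmod_reify k t env :=
  lazymatch t with
  | GRing.zero => constr:(@LZero k)
  | GRing.add ?a ?b =>
      let a := lmod_reify k a env in
      let b := lmod_reify k b env in constr:(@LAdd k a b)
  | GRing.opp ?a => let a := lmod_reify k a env in constr:(@LOpp k a)
  | GRing.scale ?c ?a =>
      let a := lmod_reify k a env in constr:(@LScale k c a)
  | _ => let i := lmod_index t env in constr:(@LAtom k i)
  end.

(* Reduces an equation between linear combinations to equations between the
   coefficients of its atoms. *)
Ltac lmod_coefs k :=
  match goal with |- @eq ?V ?a ?b =>
    let env := lmod_env a (@nil V) in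
    let env := lmod_env b env in
    let ea := lmod_reify k a env in
    let eb := lmod_reify k b env in
    refine (@lexprP k _ env ea eb _);
    cbn [lcoefs_eq lcoef Nat.eqb size]; repeat split
  end.

Ltac lmod k := lmod_coefs k; ring.

Section Signs.
Variable k : fieldType.

Definition par (m : int) : bool := odd `|m|.

Lemma sgn_par m : sgn k m = if par m then -1 else 1.
Proof.
have sgn_nat n : (-1 : k) ^+ n = if odd n then -1 else 1.
  by rewrite -signr_odd; case: odd.
rewrite /sgn /par; case: m => n; first by rewrite -exprnP sgn_nat.
by rewrite NegzE -exprz_inv invrN invr1 -exprnP sgn_nat abszN.
Qed.

Lemma parN m : par (- m) = par m. Proof. by rewrite /par abszN. Qed.
Lemma parM m n : par (m * n) = par m && par n.
Proof. by rewrite /par abszM oddM. Qed.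
Lemma parD m n : par (m + n) = par m (+) par n. Proof. rewrite /par; lia. Qed.
Lemma par1 : par 1 = true. Proof. by []. Qed.
Lemma par0 : par 0 = false. Proof. by []. Qed.

Lemma sgn_sgn m : sgn k m * sgn k m = 1.
Proof. by rewrite sgn_par; case: par; rewrite ?mulrNN mulr1. Qed.
End Signs.

Definition parE := (parD, parN, parM, par1, par0).

(** All signs depend only on parities of degrees, so a sign identity is settled by cases on the
    parities that occur. *)
Ltac signs :=
  rewrite ?sgn_par ?parE; repeat match goal with |- context [par ?x] =>
    case: (par x) end; rewrite /=.

(** * Graded-commutative algebras *)

Section Grading.
Variables (k : fieldType) (U : lmodType k) (G : int -> U -> Prop).

(** Decompositions are lists of tagged homogeneous elements, degrees possibly repeated, so that they
    can be concatenated. [hpart] collects equal degrees and gives the repetition-free form of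
    [is_grading]. *)
Definition hsum (l : seq (int * U)) : U := \sum_(p <- l) p.2.

Definition hlist (l : seq (int * U)) : Prop := forall p, p \in l -> G p.1 p.2.

Definition hpart (l : seq (int * U)) (m : int) : U :=
  \sum_(p <- l | p.1 == m) p.2.

Lemma hlist_cons p l : hlist (p :: l) <-> G p.1 p.2 /\ hlist l.
Proof.
split=> [Gl|[Gp Gl] q]; last by rewrite inE => /predU1P[->|/Gl].
split; first by apply: Gl; rewrite mem_head.
by move=> q ql; apply: Gl; rewrite inE ql orbT.
Qed.

Lemma hlist_cat l1 l2 : hlist (l1 ++ l2) <-> hlist l1 /\ hlist l2.
Proof.
split=> [Gl|[G1 G2] q]; last by rewrite mem_cat => /orP[/G1|/G2].
by split=> q ql; apply: Gl; rewrite mem_cat ql ?orbT.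
Qed.

Lemma sum_hpart (c : int -> k) l :
  \sum_(m <- undup (map fst l)) c m *: hpart l m = \sum_(p <- l) c p.1 *: p.2.
Proof.
under eq_bigr do rewrite /hpart scaler_sumr big_mkcond.
rewrite exchange_big /=; apply: eq_big_seq => p pl.
have p1 : p.1 \in undup (map fst l) by rewrite mem_undup map_f.
rewrite (bigD1_seq p.1) ?undup_uniq //= eqxx big1 ?addr0 // => m mp.
by rewrite eq_sym (negbTE mp).
Qed.

Hypothesis GG : is_grading G.

Lemma gr0 m : G m 0. Proof. by case: GG. Qed.
Lemma grP m c x y : G m x -> G m y -> G m (c *: x + y).
Proof. by case: GG => _ + _ _; apply. Qed.
Lemma grZ m c x : G m x -> G m (c *: x).
Proof. by move=> Gx; rewrite -[_ *: _]addr0; apply/grP/gr0. Qed.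
Lemma grD m x y : G m x -> G m y -> G m (x + y).
Proof. by move=> Gx Gy; rewrite -[x]scale1r; apply: grP. Qed.
Lemma grN m x : G m x -> G m (- x).
Proof. by rewrite -scaleN1r; apply: grZ. Qed.
Lemma grB m x y : G m x -> G m y -> G m (x - y).
Proof. by move=> Gx /grN; apply: grD. Qed.
Lemma gr_sum (I : Type) (r : seq I) (P : pred I) F m :
  (forall i, P i -> G m (F i)) -> G m (\sum_(i <- r | P i) F i).
Proof. by move=> GF; elim/big_rec: _ => [|i x Pi]; [apply: gr0|apply/grD/GF]. Qed.

Lemma hpart_gr l m : hlist l -> G m (hpart l m).
Proof.
move=> Gl; rewrite /hpart big_seq_cond; apply: gr_sum => p /andP[/Gl + /eqP<-].
by [].
Qed.

Lemma gr_list x : exists2 l, hlist l & x = hsum l.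
Proof.
case: GG => _ _ /(_ x)[s [f [Gf ->]]] _.
exists [seq (m, f m) | m <- s]; last by rewrite /hsum big_map.
by move=> p /mapP[m _ ->] /=.
Qed.

Lemma gr_ind (P : U -> Prop) : (forall x y, P x -> P y -> P (x + y)) ->
  (forall m x, G m x -> P x) -> forall x, P x.
Proof.
move=> PD PG x; have [l + ->] := gr_list x; elim: l => [_|p l IH] /=.
  by rewrite /hsum big_nil; apply/PG/(gr0 0).
rewrite hlist_cons /hsum big_cons => -[/PG Pp /IH]; exact: PD.
Qed.

Lemma hsum_eq0 l m : hlist l -> hsum l = 0 -> hpart l m = 0.
Proof.
move=> Gl l0; have [ml|ml] := boolP (m \in undup (map fst l)); last first.
  rewrite /hpart big_seq_cond big1 // => p /andP[pl /eqP pm].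
  by rewrite mem_undup -pm map_f in ml.
case: GG => _ _ _ /(_ _ (hpart l) (undup_uniq _)) gr; apply: gr ml => [i|].
  exact: hpart_gr.
have := sum_hpart (fun=> 1) l; under eq_bigr do rewrite scale1r.
by move=> ->; under eq_bigr do rewrite scale1r.
Qed.

(** A decomposition is only known to exist, so the map is defined by its graph [R]. The graph is a
    linear relation, and directness of the grading makes it single-valued. *)
Lemma gr_scale_exists (c : int -> k) :
  exists f : {linear U -> U}, forall m x, G m x -> f x = c m *: x.
Proof.
pose R x y := exists2 l, hlist l & x = hsum l /\ y = \sum_(p <- l) c p.1 *: p.2.
have Rf x : exists y, R x y.
  by have [l Gl ->] := gr_list x; exists (\sum_(p <- l) c p.1 *: p.2), l.
have RP a x x' y y' : R x y -> R x' y' -> R (a *: x + x') (a *: y + y').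
  move=> [l Gl [-> ->]] [l' Gl' [-> ->]].
  exists ([seq (p.1, a *: p.2) | p <- l] ++ l').
    by apply/hlist_cat; split=> // q /mapP[p /Gl Gp ->]; apply: grZ.
  rewrite /hsum !big_cat !big_map /= !scaler_sumr; split=> //.
  by congr (_ + _); apply: eq_bigr => p _; rewrite !scalerA mulrC.
have R0 y : R 0 y -> y = 0.
  move=> [l Gl [/esym l0 ->]]; rewrite -sum_hpart big1 // => m _.
  by rewrite hsum_eq0 // scaler0.
have RR x y y' : R x y -> R x y' -> y = y'.
  move=> Rx /RP - /(_ (-1) _ _ Rx); rewrite !scaleN1r addNr => /R0.
  by rewrite addrC => /eqP; rewrite subr_eq0 => /eqP.
pose f x := proj1_sig (constructive_indefinite_description _ (Rf x)).
have fP x : R x (f x) by rewrite /f; case: constructive_indefinite_description.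
have flin : linear f by move=> a x y; apply: RR (fP _) _; apply: RP.
pose L := GRing.isLinear.Build _ _ _ _ f flin.
pose F : {linear U -> U} := HB.pack f L.
exists F => m x Gx; apply: RR (fP x) _; exists [:: (m, x)].
  by move=> p; rewrite inE => /eqP->.
by rewrite /hsum !big_seq1.
Qed.
End Grading.

Lemma mk_grading (k : fieldType) (U : lmodType k) (G : int -> U -> Prop) :
  (forall m, G m 0) ->
  (forall m (c : k) x y, G m x -> G m y -> G m (c *: x + y)) ->
  (forall x, exists2 l, hlist G l & x = hsum l) ->
  (forall (s : seq int) (f : int -> U), uniq s -> (forall m, G m (f m)) ->
     \sum_(m <- s) f m = 0 -> forall m, m \in s -> f m = 0) ->
  is_grading G.
Proof.
move=> G0 GP Gl Gdir; split=> // x; have [l lG ->] := Gl x.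
exists (undup (map fst l)), (hpart l); split=> [m|].
  rewrite /hpart big_seq_cond; elim/big_rec: _ => // p y /andP[/lG Gp /eqP pm] Gy.
  by rewrite -pm -[p.2]scale1r; apply: GP; rewrite ?pm // -pm.
have := sum_hpart (fun=> 1) l; under eq_bigr do rewrite scale1r.
by move=> ->; apply: eq_bigr => p _; rewrite scale1r.
Qed.

Section Twist.
Variables (k : fieldType) (C : gcAlg k).
Implicit Types (m n r : int) (x y : C).

Let CG := hdeg_grading C.

(** The sign as a linear automorphism: unlike [sgn k (r * m)] it makes sense on inhomogeneous
    elements, so twisted products are bilinear without mention of degrees. *)
Definition twist r : {linear C -> C} :=
  proj1_sig (constructive_indefinite_description _
    (gr_scale_exists CG (fun m => sgn k (r * m)))).

Lemma twistE r m x : hdeg m x -> twist r x = sgn k (r * m) *: x.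
Proof. by rewrite /twist; case: constructive_indefinite_description => f; apply. Qed.

Lemma gc_ind (P : C -> Prop) : (forall x y, P x -> P y -> P (x + y)) ->
  (forall m x, hdeg m x -> P x) -> forall x, P x.
Proof. exact: gr_ind. Qed.

Lemma twist_deg r m x : hdeg m x -> hdeg m (twist r x).
Proof. by move=> mx; rewrite (twistE _ mx); apply: (grZ CG). Qed.

Lemma twistM r x y : twist r (x * y) = twist r x * twist r y.
Proof.
elim/gc_ind: x => [x x' IH IH'|m x mx]; first by rewrite mulrDl !raddfD /= IH IH' mulrDl.
elim/gc_ind: y => [y y' IH IH'|n y ny]; first by rewrite mulrDr !raddfD /= IH IH' mulrDr.
rewrite (twistE _ mx) (twistE _ ny) (twistE _ (hdegM mx ny)) -scalerAr -scalerAl.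
by rewrite scalerA; congr (_ *: _); signs; rewrite ?mulrNN ?mulr1 ?mul1r.
Qed.

Lemma twist1 r : twist r 1 = 1.
Proof. by rewrite (twistE _ (hdeg1 _)) mulr0 /sgn expr0z scale1r. Qed.

Lemma hdeg0 m : hdeg m (0 : C). Proof. exact: (gr0 CG). Qed.
Lemma hdegD m x y : hdeg m x -> hdeg m y -> hdeg m (x + y).
Proof. exact: (grD CG). Qed.
Lemma hdegZ m c x : hdeg m x -> hdeg m (c *: x). Proof. exact: (grZ CG). Qed.
Lemma hdegB m x y : hdeg m x -> hdeg m y -> hdeg m (x - y).
Proof. exact: (grB CG). Qed.
Lemma hdeg_sum (I : Type) (s : seq I) (P : pred I) F m :
  (forall i, P i -> hdeg m (F i : C)) -> hdeg m (\sum_(i <- s | P i) F i).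
Proof. exact: (gr_sum CG). Qed.
Lemma hdeg_cast m n x : hdeg m x -> m = n -> hdeg n x.
Proof. by move=> + <-. Qed.

Lemma hdegM_cast m n p x y : hdeg m x -> hdeg n y -> m + n = p -> hdeg p (x * y).
Proof. by move=> mx ny <-; apply: hdegM. Qed.
End Twist.

(* The square-zero extension C (+) C eps with eps of degree -r; multiplicative
   sections x |-> x + f(x) eps are derivations f of degree r. *)
Definition eps_sort (k : fieldType) (C : gcAlg k) (r : int) : Type := (C * C)%type.

Section Eps.
Variables (k : fieldType) (C : gcAlg k) (r : int).
Local Notation E := (eps_sort C r).

HB.instance Definition _ := GRing.Lmodule.copy E (C * C)%type.

(** A pair (u, v) is multiplied as u + eps v with eps on the left; the twist is the sign of moving a
    first component past eps. *)
Definition eps_mul (x y : E) : E := (x.1 * y.1, x.2 * y.1 + twist C r x.1 * y.2).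

Fact eps_mulA : associative eps_mul.
Proof.
move=> [x0 x1] [y0 y1] [z0 z1]; rewrite /eps_mul /=; congr (_, _); rewrite ?mulrA //.
by rewrite twistM mulrDl mulrDr !mulrA addrA.
Qed.
Fact eps_mul1x : left_id ((1, 0) : E) eps_mul.
Proof. by move=> [x0 x1]; rewrite /eps_mul /= twist1 !mul1r mul0r add0r. Qed.
Fact eps_mulx1 : right_id ((1, 0) : E) eps_mul.
Proof. by move=> [x0 x1]; rewrite /eps_mul /= mulr0 !mulr1 addr0. Qed.
Fact eps_mulDl : left_distributive eps_mul +%R.
Proof.
move=> [x0 x1] [y0 y1] [z0 z1]; rewrite /eps_mul /=; congr (_, _).
  by rewrite mulrDl.
by rewrite raddfD /= !mulrDl addrACA.
Qed.
Fact eps_mulDr : right_distributive eps_mul +%R.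
Proof.
move=> [x0 x1] [y0 y1] [z0 z1]; rewrite /eps_mul /=; congr (_, _).
  by rewrite mulrDr.
by rewrite !mulrDr addrACA.
Qed.
Fact eps_1neq0 : ((1, 0) : E) != 0.
Proof. by apply/eqP => -[] /eqP; rewrite oner_eq0. Qed.

HB.instance Definition _ := GRing.Zmodule_isNzRing.Build E eps_mulA eps_mul1x
  eps_mulx1 eps_mulDl eps_mulDr eps_1neq0.

Fact eps_scaleAl (c : k) (x y : E) : c *: (x * y) = (c *: x : E) * y.
Proof.
case: x y => [x0 x1] [y0 y1]; congr (_, _); rewrite /= ?scalerAl //.
by rewrite scalerDr linearZ /= !scalerAl.
Qed.
HB.instance Definition _ := GRing.Lmodule_isLalgebra.Build k E eps_scaleAl.
Fact eps_scaleAr (c : k) (x y : E) : c *: (x * y) = x * (c *: y : E).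
Proof.
case: x y => [x0 x1] [y0 y1]; congr (_, _); rewrite /= ?scalerAr //.
by rewrite scalerDr !scalerAr.
Qed.
HB.instance Definition _ := GRing.Lalgebra_isAlgebra.Build k E eps_scaleAr.

Definition eps_deg (m : int) (x : E) : Prop := hdeg m x.1 /\ hdeg (m + r) x.2.

Fact eps_grading : is_grading eps_deg.
Proof.
apply: mk_grading => [m|m c [x0 x1] [y0 y1] [? ?] [? ?]|[x0 x1]|s f us Gf f0 m ms].
- by split; apply: hdeg0.
- by split; apply: (grP (hdeg_grading C)).
- have [l0 G0 ->] := gr_list (hdeg_grading C) x0.
  have [l1 G1 ->] := gr_list (hdeg_grading C) x1.
  exists ([seq (p.1, ((p.2, 0) : E)) | p <- l0]
          ++ [seq (p.1 - r, ((0, p.2) : E)) | p <- l1]).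
    apply/hlist_cat; split=> _ /mapP[p pl ->]; split=> /=; rewrite ?subrK;
      try exact: hdeg0; [exact: G0|exact: G1].
  rewrite /hsum big_cat !big_map /=.
  have -> : \sum_(j <- l0) ((j.2, 0) : E) = (\sum_(j <- l0) j.2, 0).
    elim: l0 {G0} => [|p l IH]; first by rewrite !big_nil.
    by rewrite !big_cons IH; congr (_, _); rewrite /= addr0.
  have -> : \sum_(j <- l1) ((0, j.2) : E) = (0, \sum_(j <- l1) j.2).
    elim: l1 {G1} => [|p l IH]; first by rewrite !big_nil.
    by rewrite !big_cons IH; congr (_, _); rewrite /= addr0.
  by congr (_, _); rewrite /= ?addr0 ?add0r.
have [_ _ _ dir] := hdeg_grading C.
have sum1 (t : seq int) (h : int -> E) :
    (\sum_(m <- t) h m).1 = \sum_(m <- t) (h m).1.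
  by elim: t => [|i l IH]; rewrite ?big_nil // !big_cons /= IH.
have sum2 (t : seq int) (h : int -> E) :
    (\sum_(m <- t) h m).2 = \sum_(m <- t) (h m).2.
  by elim: t => [|i l IH]; rewrite ?big_nil // !big_cons /= IH.
apply: injective_projections => /=.
  apply: (dir s (fun i => (f i).1)) ms => // [i|]; first by case: (Gf i).
  by rewrite -sum1 f0.
pose s' := [seq i + r | i <- s]; pose f' i := (f (i - r)).2.
rewrite -[m](addrK r); apply: (dir s' f') => [|i||].
- by rewrite map_inj_uniq //; apply: addIr.
- by rewrite /f'; case: (Gf (i - r)); rewrite subrK.
- rewrite big_map -[RHS]/((0 : E).2) -f0 sum2.
  by apply: eq_bigr => i _; rewrite /f' addrK.
by apply: map_f.
Qed.

Fact eps_deg1 : eps_deg 0 1.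
Proof. by split; [apply: hdeg1 | apply: hdeg0]. Qed.

Fact eps_degM m n x y : eps_deg m x -> eps_deg n y -> eps_deg (m + n) (x * y).
Proof.
case: x y => [x0 x1] [y0 y1] [X0 X1] [Y0 Y1]; split=> /=; first exact: hdegM.
by apply: hdegD; [move: (hdegM X1 Y0)|move: (hdegM (twist_deg r X0) Y1)];
  congr hdeg; ring.
Qed.

Fact eps_mulC m n (x y : E) : eps_deg m x -> eps_deg n y ->
  x * y = sgn k (m * n) *: (y * x).
Proof.
case: x y => [x0 x1] [y0 y1] [X0 X1] [Y0 Y1]; congr (_, _); rewrite /= in X0 X1 Y0 Y1 *.
  exact: gc_mulC.
rewrite (twistE _ X0) (twistE _ Y0) -!scalerAl (gc_mulC X1 Y0) (gc_mulC X0 Y1).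
by signs; lmod k.
Qed.

Definition eps : gcAlg k := GcAlg eps_grading eps_deg1 eps_degM eps_mulC.
End Eps.

Definition lrmorph_of (k : fieldType) (A B : algType k) (f : A -> B)
    (f_lin : linear f) (f_mul : monoid_morphism f) : {lrmorphism A -> B} :=
  HB.pack f (GRing.isLinear.Build _ _ _ _ f f_lin)
    (GRing.isMonoidMorphism.Build _ _ f f_mul).

(** A copy of [{poly C}] whose scalars are those of k rather than C, tagged with the degree r of the
    variable. *)
Definition polyx (k : fieldType) (C : gcAlg k) (r : int) : Type := {poly C}.

Section PolyExt.
Variables (k : fieldType) (C : gcAlg k) (r : int).
Local Notation E := (polyx C r).

HB.instance Definition _ := GRing.NzRing.copy E {poly C}.

Definition polyx_scale (c : k) (p : E) : E := ((c%:A : C)%:P : {poly C}) * p.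

Lemma coef_polyx_scale c p i : (polyx_scale c p : {poly C})`_i = c *: (p : {poly C})`_i.
Proof. by rewrite coefCM -scalerAl mul1r. Qed.

Fact polyx_scaleA a b p : polyx_scale a (polyx_scale b p) = polyx_scale (a * b) p.
Proof. by apply/polyP => i; rewrite !coef_polyx_scale scalerA. Qed.
Fact polyx_scale1 : left_id 1 polyx_scale.
Proof. by move=> p; apply/polyP => i; rewrite coef_polyx_scale scale1r. Qed.
Fact polyx_scaleDr : right_distributive polyx_scale +%R.
Proof. by move=> c p q; rewrite /polyx_scale mulrDr. Qed.
Fact polyx_scaleDl p : {morph polyx_scale^~ p : a b / a + b}.
Proof. by move=> a b; rewrite /polyx_scale scalerDl polyCD mulrDl. Qed.
HB.instance Definition _ := GRing.Zmodule_isLmodule.Build k E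
  polyx_scaleA polyx_scale1 polyx_scaleDr polyx_scaleDl.

Fact polyx_scaleAl (c : k) (p q : E) : c *: (p * q) = (c *: p : E) * q.
Proof. exact: mulrA. Qed.
HB.instance Definition _ := GRing.Lmodule_isLalgebra.Build k E polyx_scaleAl.
Fact polyx_scaleAr (c : k) (p q : E) : c *: (p * q) = p * (c *: q : E).
Proof.
rewrite /GRing.scale /= /polyx_scale mulrA [RHS]mulrA; congr (_ * _).
apply/polyP => i; rewrite [LHS]coefCM [RHS]coefMC.
by rewrite -scalerAl -scalerAr mul1r mulr1.
Qed.
HB.instance Definition _ := GRing.Lalgebra_isAlgebra.Build k E polyx_scaleAr.

Definition polyx_deg (m : int) (p : E) : Prop :=
  forall i, hdeg (m - i%:Z * r) (p : {poly C})`_i.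

Lemma polyx_degCX m (x : C) i : hdeg m x -> polyx_deg (m + i%:Z * r) (x%:P * 'X^i).
Proof.
move=> mx j; rewrite coefCM coefXn; case: eqP => [->|_]; last first.
  by rewrite mulr0; apply: hdeg0.
by rewrite mulr1 addrK.
Qed.

Fact polyx_grading : is_grading polyx_deg.
Proof.
apply: mk_grading => [m i|m c p q mp mq i|p|s f us Gf f0 m ms].
- by rewrite coef0; apply: hdeg0.
- rewrite coefD coef_polyx_scale.
  exact: (grP (hdeg_grading C)).
- have QD (p1 p2 : E) : (exists2 l, hlist polyx_deg l & p1 = hsum l) ->
      (exists2 l, hlist polyx_deg l & p2 = hsum l) ->
      exists2 l, hlist polyx_deg l & p1 + p2 = hsum l.
    move=> [l1 G1 ->] [l2 G2 ->]; exists (l1 ++ l2); first exact/hlist_cat.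
    by rewrite /hsum big_cat.
  rewrite -[p]coefK poly_def; elim/big_rec: _ => [|i q _].
    by exists [::]; rewrite // /hsum big_nil.
  apply: (QD); rewrite -mul_polyC.
  elim/gc_ind: (p`_i) => [x y IHx IHy|m x mx]; first by rewrite polyCD mulrDl; apply: (QD).
  exists [:: (m + i%:Z * r, x%:P * 'X^i)]; last by rewrite /hsum big_seq1.
  by move=> q0; rewrite inE => /eqP->; apply: polyx_degCX.
have [_ _ _ dir] := hdeg_grading C.
apply/polyP => i; rewrite coef0.
pose s' := [seq n - i%:Z * r | n <- s].
pose f' n := (f (n + i%:Z * r) : {poly C})`_i.
rewrite -[m](subrK (i%:Z * r)); apply: (dir s' f') => [|n||].
- by rewrite map_inj_uniq //; apply: addIr.
- by rewrite /f'; have := Gf (n + i%:Z * r) i; rewrite addrK.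
- rewrite big_map -[RHS](coef0 _ i) -f0 coef_sum.
  by apply: eq_bigr => n _; rewrite /f' subrK.
by apply: map_f.
Qed.

Fact polyx_deg1 : polyx_deg 0 1.
Proof.
move=> i; rewrite coef1; case: eqP => [->|_]; last exact: hdeg0.
by rewrite mul0r subr0; apply: hdeg1.
Qed.

Fact polyx_degM m n p q : polyx_deg m p -> polyx_deg n q -> polyx_deg (m + n) (p * q).
Proof.
move=> mp nq i; rewrite coefM; apply: hdeg_sum => j _.
apply: hdegM_cast (mp j) (nq (i - j)%N) _.
by rewrite -subzn ?leq_ord //; ring.
Qed.

Hypothesis r_even : par r = false.

Fact polyx_mulC m n (p q : E) : polyx_deg m p -> polyx_deg n q ->
  p * q = sgn k (m * n) *: (q * p).
Proof.
move=> mp nq; apply/polyP => i; rewrite [RHS]coef_polyx_scale coefM coefMr scaler_sumr.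
apply: eq_bigr => j _; rewrite (gc_mulC (mp j) (nq (i - j)%N)).
by congr (_ *: _); rewrite !sgn_par !parE r_even !andbF !addbF.
Qed.

Definition polyx_gc : gcAlg k := GcAlg polyx_grading polyx_deg1 polyx_degM polyx_mulC.
End PolyExt.

(** The universal property of C[x] for one variable x of degree r, polynomial for even r and
    exterior for odd r. *)
Definition free_ext_one (k : fieldType) (C C' : gcAlg k) (r : int)
    (i : {lrmorphism C -> C'}) (x : C') : Prop :=
  [/\ gpres i, hdeg r x &
    forall (B : gcAlg k) (a : {lrmorphism C -> B}) (b : B), gpres a -> hdeg r b ->
      exists F : {lrmorphism C' -> B}, [/\ gpres F, F \o i =1 a, F x = b &
        forall F' : {lrmorphism C' -> B}, F' \o i =1 a -> F' x = b -> F' =1 F]].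

(** An even variable commutes with everything and satisfies no relation, so polynomials serve.
    Evaluation at [b] needs only that [b], being even, commutes with the image of [a]. *)
Lemma even_var (k : fieldType) (C : gcAlg k) (r : int) : par r = false ->
  exists C' i x, @free_ext_one k C C' r i x.
Proof.
move=> r_even; exists (polyx_gc C r_even).
have Pl : linear (fun x : C => x%:P : polyx_gc C r_even).
  move=> c x y; apply/polyP => i; rewrite coefC coefD coef_polyx_scale !coefC.
  by case: eqP; rewrite // scaler0 addr0.
have Pm : monoid_morphism (fun x : C => x%:P : polyx_gc C r_even).
  by split=> [|x y]; rewrite ?polyCM.
exists (lrmorph_of Pl Pm), ('X : {poly C}); split.
- by move=> m x mx; move: (polyx_degCX r 0 mx); rewrite mul0r addr0 expr0 mulr1.
- move=> i; rewrite coefX; case: eqP => [->|_]; last exact: hdeg0.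
  by rewrite mul1r subrr; apply: hdeg1.
move=> B a b a_gr rb.
have ab : commr_rmorph a b.
  move=> x; elim/gc_ind: x => [x y cx cy|m x mx]; first by rewrite rmorphD; apply: commrD.
  rewrite /GRing.comm (gc_mulC rb (a_gr _ _ mx)).
  by rewrite sgn_par parE r_even scale1r.
have Fl : linear (horner_morph ab : polyx_gc C r_even -> B).
  move=> c p q; rewrite rmorphD /GRing.scale /= /polyx_scale rmorphM /=.
  have -> : horner_morph ab (c%:A : C)%:P = c%:A.
    by rewrite horner_morphC; rewrite -[RHS](rmorph_alg a).
  by rewrite -scalerAl mul1r.
have Fm : monoid_morphism (horner_morph ab : polyx_gc C r_even -> B).
  by split=> [|p q]; rewrite ?rmorph1 ?rmorphM.
exists (lrmorph_of Fl Fm); split=> /=.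
- move=> m p mp; rewrite /= /horner_morph horner_coef.
  apply: hdeg_sum => i _; rewrite coef_map.
  apply: hdegM_cast (a_gr _ _ (mp i)) (_ : hdeg (i%:Z * r) _) _; last by ring.
  elim: (i : nat) => [|j IH]; first by rewrite mul0r; apply: hdeg1.
  by rewrite exprS; apply: hdegM_cast rb IH _; rewrite -add1n PoszD; ring.
- by move=> x /=; rewrite horner_morphC.
- by rewrite horner_morphX.
move=> F' F'a F'b p /=; elim/poly_ind: p => [|p c IH]; first by rewrite !rmorph0.
rewrite [RHS]rmorphD rmorphM /= horner_morphX horner_morphC -IH -F'b.
by rewrite -[X in _ = _ + X](F'a c) -rmorphM -rmorphD.
Qed.

(** An odd variable squares to 0 because 2 is invertible, so C[x] = C + x C is the square-zero
    extension in which eps has degree r. *)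
Lemma odd_var (k : fieldType) (C : gcAlg k) (r : int) :
  2%:R != 0 :> k -> par r = true ->
  exists C' i x, @free_ext_one k C C' r i x.
Proof.
move=> k2 r_odd; exists (eps C (- r)).
have Pl : linear (fun x : C => (x, 0) : eps C (- r)).
  by move=> c x y; congr (_, _); rewrite /= scaler0 addr0.
have Pm : monoid_morphism (fun x : C => (x, 0) : eps C (- r)).
  by split=> // x y; congr (_, _); rewrite /= mulr0 mul0r addr0.
exists (lrmorph_of Pl Pm), (0, 1); split.
- by move=> m x mx; split=> //=; apply: hdeg0.
- by split=> /=; [apply: hdeg0|rewrite subrr; apply: hdeg1].
move=> B a b a_gr rb.
have bb : b * b = 0.
  have := gc_mulC rb rb; rewrite sgn_par parE r_odd /= scaleN1r => /eqP.
  rewrite -subr_eq0 opprK -mulr2n -scaler_nat scaler_eq0 (negbTE k2) /=.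
  by move/eqP.
have ab x : a x * b = b * a (twist C (- r) x).
  elim/gc_ind: x => [x y IHx IHy|m x mx]; first by rewrite !raddfD /= mulrDl mulrDr IHx IHy.
  rewrite (twistE _ mx) (gc_mulC (a_gr _ _ mx) rb) linearZ /= -scalerAr.
  by congr (_ *: _); signs.
pose F (x : eps C (- r)) : B := a x.1 + b * a x.2.
have Fl : linear F.
  by move=> c x y; rewrite /F /= !linearP mulrDr -scalerAr; lmod k.
have Fm : monoid_morphism F.
  split=> [|x y]; first by rewrite /F rmorph1 rmorph0 mulr0 addr0.
  rewrite /F /= rmorphM rmorphD !rmorphM mulrDl !mulrDr !mulrA ab.
  rewrite -[_ * a x.2 * b]mulrA ab !mulrA bb !mul0r addr0.
  by rewrite -!addrA; congr (_ + _); apply: addrC.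
exists (lrmorph_of Fl Fm); split=> /=.
- move=> m x [x0 x1] /=; apply: hdegD; first exact: a_gr.
  by apply: hdegM_cast rb (a_gr _ _ x1) _; ring.
- by move=> x; rewrite /= /F rmorph0 mulr0 addr0.
- by rewrite /F /= rmorph0 add0r rmorph1 mulr1.
move=> F' F'a F'b [x0 x1]; rewrite /= /F /= -!F'a -F'b -rmorphM -rmorphD /=.
congr (F' _); congr (_, _); rewrite /= ?mul0r ?mulr0 ?addr0 ?mul1r //.
by rewrite add0r.
Qed.

Section Subalgebra.
Variables (k : fieldType) (C : gcAlg k) (S : {pred C}).

(** Carries the closure proof in the predicate, so that the subalgebra structures can be inferred
    from it. *)
Definition subgc_pred (Sc : GRing.subalg_closed S) : {pred C} := S.

Variable Sc : GRing.subalg_closed S.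
Local Notation T := (subgc_pred Sc).

HB.instance Definition _ := GRing.isSubalgClosed.Build k C T Sc.

Definition subgc_sort : Type := {x | x \in T}.
HB.instance Definition _ := SubChoice.on subgc_sort.
HB.instance Definition _ := [SubChoice_isSubAlgebra of subgc_sort by <:].

Definition subgc_val (x : subgc_sort) : C := val x.

Fact subgc_val_linear : linear subgc_val.
Proof. by move=> c x y; rewrite /subgc_val linearP. Qed.
Fact subgc_val_mul : monoid_morphism subgc_val.
Proof. by split=> [|x y]; rewrite /subgc_val ?rmorph1 ?rmorphM. Qed.
Definition subgc_incl : {lrmorphism subgc_sort -> C} :=
  lrmorph_of subgc_val_linear subgc_val_mul.

Definition subgc_deg m (x : subgc_sort) : Prop := hdeg m (val x).

Hypothesis Sg : forall x, x \in S ->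
  exists2 l, hlist (fun m y => hdeg m y /\ y \in S) l & x = hsum l.

Fact subgc_grading : is_grading subgc_deg.
Proof.
apply: mk_grading => [m|m c x y mx my|x|s f us Gf f0 m ms].
- by rewrite /subgc_deg rmorph0; apply: hdeg0.
- by rewrite /subgc_deg linearP; apply: (grP (hdeg_grading C)).
- have [l lG xl] := Sg (valP x).
  suff [l' l'G l'E] : exists2 l', hlist subgc_deg l' & \val (hsum l' : subgc_sort) = hsum l.
    by exists l' => //; apply: val_inj; rewrite l'E.
  elim: l lG {xl} => [_|p l IH]; first by exists [::]; rewrite /hsum ?big_nil ?rmorph0.
  move=> /hlist_cons[[pG pS] /IH[l' l'G l'E]].
  exists ((p.1, exist _ p.2 pS : subgc_sort) :: l'); first exact/hlist_cons.
  by rewrite /hsum !big_cons rmorphD; congr (_ + _); apply: l'E.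
have [_ _ _ dir] := hdeg_grading C.
apply: val_inj; rewrite rmorph0; apply: (dir s (\val \o f)) => //=.
have -> : \sum_(m <- s) val (f m) = val (\sum_(m <- s) f m) by rewrite raddf_sum.
by rewrite f0 rmorph0.
Qed.

Fact subgc_deg1 : subgc_deg 0 1. Proof. by rewrite /subgc_deg rmorph1; apply: hdeg1. Qed.
Fact subgc_degM m n x y : subgc_deg m x -> subgc_deg n y -> subgc_deg (m + n) (x * y).
Proof. by rewrite /subgc_deg rmorphM; apply: hdegM. Qed.
Fact subgc_mulC m n (x y : subgc_sort) : subgc_deg m x -> subgc_deg n y ->
  x * y = sgn k (m * n) *: (y * x).
Proof. by move=> mx ny; apply: val_inj; rewrite linearZ !rmorphM; apply: gc_mulC. Qed.

Definition subgc : gcAlg k := GcAlg subgc_grading subgc_deg1 subgc_degM subgc_mulC.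
End Subalgebra.

(** * Free graded-commutative algebras *)

Section Free.
Variable k : fieldType.

Definition free_on (N : nat) (g : 'I_N -> int) (C : gcAlg k) (x : 'I_N -> C) : Prop :=
  (forall i, hdeg (g i) (x i)) /\
  forall (B : gcAlg k) (b : 'I_N -> B), (forall i, hdeg (g i) (b i)) ->
    exists F : {lrmorphism C -> B}, [/\ gpres F, forall i, F (x i) = b i &
      forall F' : {lrmorphism C -> B}, gpres F' -> (forall i, F' (x i) = b i) ->
        F' =1 F].

Fact ground_alg_linear (B : gcAlg k) : linear (fun c : ground_gc k => c%:A : B).
Proof. by move=> c x y; rewrite scalerDl scalerA. Qed.
Fact ground_alg_mul (B : gcAlg k) : monoid_morphism (fun c : ground_gc k => c%:A : B).
Proof. by split=> [|x y]; rewrite ?scale1r // -scalerAl mul1r scalerA. Qed.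
Definition ground_alg (B : gcAlg k) : {lrmorphism ground_gc k -> B} :=
  lrmorph_of (@ground_alg_linear B) (@ground_alg_mul B).

Lemma ground_alg_gpres (B : gcAlg k) : gpres (ground_alg B).
Proof.
move=> m c [->|->]; first by apply/hdegZ/hdeg1.
by rewrite rmorph0; apply: hdeg0.
Qed.

Lemma lrmorph_ground (B : gcAlg k) (F : {lrmorphism ground_gc k -> B}) c :
  F c = c%:A.
Proof. by rewrite -(rmorph_alg F c); congr (F _); apply/esym/(mulr1 (c : k)). Qed.

Lemma lrmorph_comp (A B C : algType k) (g : {lrmorphism B -> C})
    (f : {lrmorphism A -> B}) : {h : {lrmorphism A -> C} | h =1 g \o f}.
Proof. by exists (g \o f : {lrmorphism A -> C}). Qed.

(** The variables are adjoined one at a time, each by the construction that fits its parity. *)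
Lemma free_exists N (g : 'I_N -> int) : 2%:R != 0 :> k ->
  exists (C : gcAlg k) (x : 'I_N -> C), free_on g x.
Proof.
move=> k2; elim: N g => [|N IH] g.
  exists (ground_gc k), (fun=> 0); split=> [[]|B b _] //.
  exists (ground_alg B); split=> [|[]|F _ _ c] //; first exact: ground_alg_gpres.
  exact: lrmorph_ground.
have [C [x [x_deg x_univ]]] := IH (g \o lift ord0).
have [C' [i [y [i_gr y_deg y_univ]]]] : exists C' i y, @free_ext_one k C C' (g ord0) i y.
  by case: (boolP (par (g ord0))) => [|/negbTE] e; [apply: odd_var|apply: even_var].
pose z j := if unlift ord0 j is Some j' then i (x j') else y.
have z0 : z ord0 = y by rewrite /z unlift_none.
have zl j : z (lift ord0 j) = i (x j) by rewrite /z liftK.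
exists C', z; split=> [j|B b b_deg].
  by case: (unliftP ord0 j) => [j'|] ->; rewrite ?zl ?z0 //; apply/i_gr/x_deg.
have [F [F_gr Fx F_uniq]] := x_univ B (b \o lift ord0) (fun j => b_deg _).
have [G [G_gr Gi Gy G_uniq]] := y_univ B F (b ord0) F_gr (b_deg _).
exists G; split=> // [j|G' G'_gr G'z].
  case: (unliftP ord0 j) => [j'|] ->; rewrite ?zl ?z0 //.
  by have /= -> := Gi (x j'); rewrite Fx.
apply: G_uniq; last by rewrite -z0.
have [h hE] := lrmorph_comp G' i.
move=> c; rewrite -hE; apply: F_uniq => [m c' mc'|j]; rewrite hE /=.
  exact/G'_gr/i_gr.
by rewrite -zl G'z.
Qed.

Section FreeTheory.
Variables (N : nat) (g : 'I_N -> int) (C : gcAlg k) (x : 'I_N -> C).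
Hypothesis Cx : free_on g x.

(* The subalgebra generated by the x_i is graded, so freeness retracts C onto
   it. *)
Lemma free_ind_alg (P : C -> Prop) :
  P 1 -> (forall c y z, P y -> P z -> P (c *: y + z)) ->
  (forall i, P (x i)) -> (forall y z, P y -> P z -> P (y * z)) ->
  forall y, P y.
Proof.
have [x_deg x_univ] := Cx => P1 Pl Px PM.
(* The generated subalgebra as the intersection of all predicates closed under the operations;
   excluded middle turns it into the Boolean predicate [S]. *)
pose R (y : C) := forall Q : C -> Prop, Q 1 ->
  (forall c y z, Q y -> Q z -> Q (c *: y + z)) ->
  (forall i, Q (x i)) -> (forall y z, Q y -> Q z -> Q (y * z)) -> Q y.
pose S : {pred C} := fun y => if excluded_middle_informative (R y) then true else false.
have SP y : reflect (R y) (y \in S).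
  by rewrite unfold_in /S; case: excluded_middle_informative => r; constructor.
have R1 : R 1 by [].
have Rl c y z : R y -> R z -> R (c *: y + z).
  by move=> Ry Rz Q Q1 Ql Qx QM; apply: (Ql); [apply: Ry|apply: Rz].
have RM y z : R y -> R z -> R (y * z).
  by move=> Ry Rz Q Q1 Ql Qx QM; apply: (QM); [apply: Ry|apply: Rz].
have R0 : R 0 by have := Rl (-1) 1 1 R1 R1; rewrite scaleN1r addNr.
have Sc : GRing.subalg_closed S.
  by split=> [|c y z /SP Ry /SP Rz|y z /SP Ry /SP Rz]; apply/SP=> //; auto.
have Sg y : y \in S ->
    exists2 l, hlist (fun m y => hdeg m y /\ y \in S) l & y = hsum l.
  pose D y := exists2 l, hlist (fun m y => hdeg m y /\ y \in S) l & y = hsum l.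
  have Dh m z : hdeg m z -> z \in S -> D z.
    move=> mz zS; exists [:: (m, z)]; last by rewrite /hsum big_seq1.
    by move=> p; rewrite inE => /eqP->.
  have DD u v : D u -> D v -> D (u + v).
    move=> [l1 G1 ->] [l2 G2 ->]; exists (l1 ++ l2); first exact/hlist_cat.
    by rewrite /hsum big_cat.
  have D0 : D 0 by apply: (Dh 0); [apply: hdeg0|apply/SP].
  move/SP/(_ D); apply=> [|c u v [l1 G1 ->] Dv|i|u v [l1 G1 ->] [l2 G2 ->]].
  - by apply: (Dh 0); [apply: hdeg1|apply/SP].
  - apply: (DD) => //; exists [seq (p.1, c *: p.2) | p <- l1].
      move=> _ /mapP[p /G1 [pG /SP pS] ->]; split; first exact: hdegZ.
      by apply/SP; rewrite /= -[_ *: _]addr0; apply: (Rl).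
    by rewrite /hsum scaler_sumr big_map.
  - by apply: (Dh (g i)) => //; apply/SP => Q _ _ + _; apply.
  rewrite /hsum; elim: l1 G1 => [_|p l1 IH /hlist_cons[[pG pS] G1]].
    by rewrite big_nil mul0r.
  rewrite big_cons mulrDl; apply: (DD); last exact: IH.
  elim: l2 G2 {IH} => [_|q l2 IH /hlist_cons[[qG qS] G2]].
    by rewrite big_nil mulr0.
  rewrite big_cons mulrDr; apply: (DD); last exact: IH.
  apply: (Dh (p.1 + q.1)); first exact: hdegM.
  by apply/SP; apply: (RM _ _ (elimT (SP _) pS) (elimT (SP _) qS)).
have xS i : x i \in S by apply/SP => Q _ _ + _; apply.
pose B := subgc Sc Sg.
have [F [F_gr Fx _]] := x_univ B (fun i => exist _ (x i) (xS i)) x_deg.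
have [F0 [_ _ G_uniq]] := x_univ C x x_deg.
have [h hE] := lrmorph_comp (subgc_incl Sc) F.
move=> y; have : R y.
  have -> : y = val (F y : subgc_sort Sc).
    rewrite -[RHS](hE y) (G_uniq h).
    - by rewrite -[LHS]/((idfun : {lrmorphism C -> C}) y) (G_uniq idfun).
    - by move=> m z mz; rewrite hE; apply: F_gr.
    by move=> i; rewrite hE /= Fx.
  by apply/SP/(valP (F y : subgc_sort Sc)).
by apply.
Qed.

Lemma free_ind (P : C -> Prop) :
  P 1 -> (forall c y z, P y -> P z -> P (c *: y + z)) ->
  (forall i y, P y -> P (x i * y)) -> forall y, P y.
Proof.
(* Strengthened to: left multiplication by y preserves [P]. For products this is composition. *)
move=> P1 Pl Px y; rewrite -[y]mulr1; move: 1 P1.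
elim/free_ind_alg: y => [z|c y z IHy IHz t Pt|i z|y z IHy IHz t Pt].
- by rewrite mul1r.
- by rewrite mulrDl -scalerAl; apply: (Pl); auto.
- exact: Px.
by rewrite -mulrA; auto.
Qed.

End FreeTheory.
End Free.

(** * Graded derivations *)

Section Derivations.
Variable k : fieldType.
Implicit Types A B C : gcAlg k.

Definition raises A B (r : int) (f : A -> B) : Prop :=
  forall m x, hdeg m x -> hdeg (m + r) (f x).

(** Derivations along a map [c], so that one uniqueness statement covers derivations of C and the
    composites of a differential with an algebra morphism. *)
Definition leibniz A B (c : A -> B) (r : int) (f : A -> B) : Prop :=
  forall m x y, hdeg m x -> f (x * y) = f x * c y + sgn k (r * m) *: (c x * f y).

Definition is_der C (r : int) (f : C -> C) : Prop := raises r f /\ leibniz id r f.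

Lemma leibniz1 A B (c : A -> B) r (f : A -> B) : c 1 = 1 -> leibniz c r f -> f 1 = 0.
Proof.
move=> c1 /(_ 0 1 1 (hdeg1 _)); rewrite mulr0 c1 !mulr1 mul1r /sgn expr0z scale1r.
by rewrite -[X in X = _]addr0 => /addrI.
Qed.

Lemma der_comm C r s (f h : {linear C -> C}) : is_der r f -> is_der s h ->
  is_der (r + s) (fun x => f (h x) - sgn k (r * s) *: h (f x)).
Proof.
move=> [f_r f_l] [h_s h_l]; split=> [m x mx|m x y mx].
  apply: hdegB; first by apply: hdeg_cast (f_r _ _ (h_s _ _ mx)) _; ring.
  by apply/hdegZ; apply: hdeg_cast (h_s _ _ (f_r _ _ mx)) _; ring.
rewrite /= (f_l _ _ _ mx) (h_l _ _ _ mx) !raddfD /= !linearZ /=.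
rewrite (f_l _ _ _ mx) (f_l _ _ _ (h_s _ _ mx)) (h_l _ _ _ mx) (h_l _ _ _ (f_r _ _ mx)) /=.
rewrite (mulrDl _ _ y) (mulrDr x) -scalerAl -scalerAr mulNr mulrN.
by signs; lmod k.
Qed.

Lemma twistK C r : involutive (twist C r).
Proof.
apply: gc_ind => [x y IHx IHy|m x mx]; first by rewrite !raddfD /= IHx IHy.
by rewrite (twistE _ mx) linearZ /= (twistE _ mx) scalerA sgn_sgn scale1r.
Qed.
End Derivations.

Section FreeDerivations.
Variables (k : fieldType) (N : nat) (g : 'I_N -> int) (C : gcAlg k) (x : 'I_N -> C).
Hypothesis Cx : free_on g x.

Lemma leibniz_eq (B : gcAlg k) (c : {lrmorphism C -> B}) r (f h : {linear C -> B}) :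
  leibniz c r f -> leibniz c r h -> (forall i, f (x i) = h (x i)) -> f =1 h.
Proof.
move=> f_l h_l fh y; elim/(free_ind Cx): y => [|a y z IHy IHz|i y IHy].
- by rewrite (leibniz1 (rmorph1 c) f_l) (leibniz1 (rmorph1 c) h_l).
- by rewrite !linearP IHy IHz.
have [x_deg _] := Cx.
by rewrite (f_l _ _ _ (x_deg i)) (h_l _ _ _ (x_deg i)) IHy fh.
Qed.

Lemma der_eq r (f h : {linear C -> C}) :
  is_der r f -> is_der r h -> (forall i, f (x i) = h (x i)) -> f =1 h.
Proof.
move=> [_ f_l] [_ h_l]; exact: (@leibniz_eq _ (idfun : {lrmorphism C -> C}) _ _ _ f_l h_l).
Qed.

Lemma der_exists r (b : 'I_N -> C) : (forall i, hdeg (g i + r) (b i)) ->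
  exists f : {linear C -> C}, is_der r f /\ forall i, f (x i) = b i.
Proof.
have [x_deg x_univ] := Cx; move=> b_deg.
(* The first component of this morphism fixes the generators, so uniqueness makes it the identity;
   the second component is then the derivation. *)
have [|F [F_gr Fx _]] := x_univ (eps C r) (fun i => (x i, b i)); first by split.
pose F1 := (fun y => (F y : C * C).1); pose F2 := (fun y => (F y : C * C).2).
have F1l : linear F1 by move=> c y z; rewrite /F1 linearP.
have F2l : linear F2 by move=> c y z; rewrite /F2 linearP.
have F1m : monoid_morphism F1 by split=> [|y z]; rewrite /F1 ?rmorph1 ?rmorphM.
have F1_id : F1 =1 id.
  have [F0 [_ _ F0_uniq]] := x_univ C x x_deg.
  have G1 : lrmorph_of F1l F1m =1 F0.
    by apply: F0_uniq => [m y my|i]; [case: (F_gr _ _ my)|rewrite /= /F1 Fx].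
  by move=> y; rewrite [LHS]G1 -[RHS]/((idfun : {lrmorphism C -> C}) y) (F0_uniq idfun).
exists (HB.pack F2 (GRing.isLinear.Build _ _ _ _ F2 F2l) : {linear C -> C}).
split=> [|i]; last by rewrite /= /F2 Fx.
split=> [m y my|m y z my] /=; first by case: (F_gr _ _ my).
rewrite {1}/F2 rmorphM /=.
rewrite -[LHS]/(F2 y * F1 z + twist C r (F1 y) * F2 z) !F1_id.
by rewrite (twistE _ my) -scalerAl.
Qed.
End FreeDerivations.

(** The axioms that a bracket extended from generators satisfies by construction. Jacobi and
    compatibility with the differential are left out, to be checked on generators afterwards. *)
Record is_antibracket (k : fieldType) (C : gcAlg k) (br : C -> C -> C) : Prop := {
  ab_linl : forall (c : k) x x' y, br (c *: x + x') y = c *: br x y + br x' y;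
  ab_linr : forall (c : k) x y y', br x (c *: y + y') = c *: br x y + br x y';
  ab_deg : forall m n x y, hdeg m x -> hdeg n y -> hdeg (m + n - 1) (br x y);
  ab_anti : forall m n x y, hdeg m x -> hdeg n y ->
    br x y = - sgn k ((m - 1) * (n - 1)) *: br y x;
  ab_poisson : forall m n x y z, hdeg m x -> hdeg n y ->
    br x (y * z) = br x y * z + sgn k ((m - 1) * n) *: (y * br x z)
}.

Lemma linear_of (k : fieldType) (U W : lmodType k) (f : U -> W) :
  linear f -> {h : {linear U -> W} | h =1 f}.
Proof.
by move=> fl; exists (HB.pack f (GRing.isLinear.Build _ _ _ _ f fl) : {linear U -> W}).
Qed.

(** * Brackets and BV operators *)

Section Antibracket.
Variables (k : fieldType) (C : gcAlg k) (br : C -> C -> C).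
Hypothesis brP : is_antibracket br.

Definition ad (x : C) : {linear C -> C} := sval (linear_of (fun c => ab_linr brP c x)).
Lemma adE x y : ad x y = br x y.
Proof. exact: (svalP (linear_of (fun c => ab_linr brP c x))). Qed.

Definition adr (y : C) : {linear C -> C} :=
  sval (linear_of (fun c x x' => ab_linl brP c x x' y)).
Lemma adrE x y : adr y x = br x y.
Proof. exact: (svalP (linear_of (fun c x x' => ab_linl brP c x x' y))). Qed.

Lemma ad_der m x : hdeg m x -> is_der (m - 1) (ad x).
Proof.
move=> mx; split=> [n y ny|n y z ny]; rewrite !adE.
  by apply: hdeg_cast (ab_deg brP mx ny) _; ring.
by rewrite (ab_poisson brP _ mx ny).
Qed.

Lemma brZl c x y : br (c *: x) y = c *: br x y.
Proof. by rewrite -!adrE linearZ. Qed.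
Lemma brDr x y y' : br x (y + y') = br x y + br x y'.
Proof. by rewrite -!adE raddfD. Qed.
Lemma brZr c x y : br x (c *: y) = c *: br x y.
Proof. by rewrite -!adE linearZ. Qed.
Lemma br0l y : br 0 y = 0. Proof. by rewrite -!adrE raddf0. Qed.
Lemma br0r x : br x 0 = 0. Proof. by rewrite -!adE raddf0. Qed.
Lemma br_sumr (I : Type) (r : seq I) (P : pred I) F x :
  br x (\sum_(i <- r | P i) F i) = \sum_(i <- r | P i) br x (F i).
Proof. by rewrite -adE raddf_sum; apply: eq_bigr => i _; apply: adE. Qed.
Lemma br_suml (I : Type) (r : seq I) (P : pred I) F y :
  br (\sum_(i <- r | P i) F i) y = \sum_(i <- r | P i) br (F i) y.
Proof. by rewrite -adrE raddf_sum; apply: eq_bigr => i _; apply: adrE. Qed.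

Lemma ab_poissonl m n p x y z : hdeg m x -> hdeg n y -> hdeg p z ->
  br (x * y) z = x * br y z + sgn k (n * (p - 1)) *: (br x z * y).
Proof.
move=> mx ny pz; rewrite (ab_anti brP (hdegM mx ny) pz) (ab_poisson brP _ pz mx).
rewrite (ab_anti brP mx pz) (ab_anti brP ny pz) -!scalerAl -!scalerAr.
by signs; lmod k.
Qed.

Definition jacobi_at m n (x y z : C) : Prop :=
  br x (br y z) = br (br x y) z + sgn k ((m - 1) * (n - 1)) *: br y (br x z).

(** With antisymmetry the Jacobi identity is cyclically invariant. An argument that extends only the
    last entry from generators can then reach the other two. *)
Lemma jacobi_rot m n p x y z : hdeg m x -> hdeg n y -> hdeg p z ->
  jacobi_at m n x y z -> jacobi_at p m z x y.
Proof.
move=> mx ny pz; rewrite /jacobi_at.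
rewrite (ab_anti brP ny pz) (ab_anti brP mx pz) brZr brZr.
rewrite (ab_anti brP (ab_deg brP mx ny) pz).
rewrite (ab_anti brP ny (ab_deg brP pz mx)).
move=> /eqP; rewrite -subr_eq0 => /eqP H; apply/eqP; rewrite -subr_eq0; apply/eqP.
(* The defect of the rotated identity is this sign times the original defect. *)
rewrite -[RHS](scaler0 _ (sgn k ((m + n) * (p - 1)))) -H.
by signs; lmod k.
Qed.

Definition dif_at (P : C -> C) m (x y : C) : Prop :=
  P (br x y) = br (P x) y + sgn k (m + 1) *: br x (P y).

Lemma dif_at_sym (P : {linear C -> C}) r m n x y : par r -> raises r P ->
  hdeg m x -> hdeg n y -> dif_at P m x y -> dif_at P n y x.
Proof.
move=> r_odd P1 mx ny; rewrite /dif_at.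
rewrite (ab_anti brP mx ny) linearZ /= (ab_anti brP (P1 _ _ mx) ny).
rewrite (ab_anti brP mx (P1 _ _ ny)).
move=> /eqP; rewrite -subr_eq0 => /eqP H; apply/eqP; rewrite -subr_eq0; apply/eqP.
rewrite -[RHS](scaler0 _ (- sgn k ((m - 1) * (n - 1)))) -H.
by rewrite ?sgn_par ?parE r_odd; signs; lmod k.
Qed.

Variables (N : nat) (g : 'I_N -> int) (x : 'I_N -> C).
Hypothesis Cx : free_on g x.

(** For fixed u and v both sides are derivations in w: the graded commutator of [ad u] and [ad v]
    against [ad (br u v)]. Agreement on generators therefore suffices, and rotation carries this
    over to u and v. *)
Lemma jacobi_gens :
  (forall i j l, jacobi_at (g i) (g j) (x i) (x j) (x l)) ->
  forall m n u v w, hdeg m u -> hdeg n v -> jacobi_at m n u v w.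
Proof.
have [x_deg _] := Cx; move=> Jx.
have Jgens m n u v : hdeg m u -> hdeg n v ->
    (forall l, jacobi_at m n u v (x l)) -> forall w, jacobi_at m n u v w.
  move=> mu nv J w.
  pose s := sgn k ((m - 1) * (n - 1)).
  have fl : linear (fun w => ad u (ad v w) - s *: ad v (ad u w)).
    by move=> c y z; rewrite !linearP /=; lmod k.
  have [f fE] := linear_of fl.
  have f_der : is_der (m - 1 + (n - 1)) f.
    have [h1 h2] := der_comm (ad_der mu) (ad_der nv).
    by split=> [q y|q y z] qy; rewrite !fE; [apply: h1|apply: h2].
  have uv_deg : hdeg (m + n - 1) (br u v) by apply: ab_deg.
  have := @der_eq _ _ _ _ _ Cx (m - 1 + (n - 1)) f (ad (br u v)) f_der.
  move=> /(_ _ _ w); rewrite fE !adE => H.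
  rewrite /jacobi_at -H ?subrK //; last first.
    by move=> l; rewrite fE !adE [br u _]J /s; lmod k.
  by have := ad_der uv_deg; congr is_der; ring.
have J1 i j w : jacobi_at (g i) (g j) (x i) (x j) w by apply: Jgens.
have J2 i p w z : hdeg p w -> jacobi_at p (g i) w (x i) z.
  by move=> pw; apply: Jgens => // l; apply: (jacobi_rot (x_deg i) (x_deg l) pw).
move=> m n u v w mu nv; apply: Jgens => // l.
by apply: (jacobi_rot nv (x_deg l) mu); apply: J2.
Qed.

(* Order <= 2 with second-order part e.br: a derivation for e = 0, and a BV
   operator generating br for e = 1. *)
Definition bv_leibniz (e : k) (P : C -> C) : Prop :=
  forall m y z, hdeg m y ->
    P (y * z) = P y * z + sgn k m *: (y * P z) + (e * sgn k m) *: br y z.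

Lemma bv_leibniz1 e P : bv_leibniz e P -> P 1 = 0.
Proof.
move=> /(_ 0 1 1 (hdeg1 _)).
have [_ /(leibniz1 (erefl (1 : C)))] := ad_der (hdeg1 C).
rewrite adE => ->; rewrite scaler0 addr0 !mulr1 mul1r /sgn expr0z scale1r.
by rewrite -[X in X = _]addr0 => /addrI.
Qed.

(** For fixed u the defect is a derivation in v, because the bracket terms with factor e cancel by
    the Jacobi identity; antisymmetry then exchanges the arguments. This serves for d with e = 0 and
    for [B] with e = 1. *)
Lemma dif_gens e r (P : {linear C -> C}) :
  (forall m n u v w, hdeg m u -> hdeg n v -> jacobi_at m n u v w) ->
  par r -> raises r P -> bv_leibniz e P ->
  (forall i j, dif_at P (g i) (x i) (x j)) ->
  forall m u v, hdeg m u -> dif_at P m u v.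
Proof.
have [x_deg _] := Cx; move=> J r_odd P_r P_l Kx.
have Kgens m u : hdeg m u -> (forall j, dif_at P m u (x j)) -> forall v, dif_at P m u v.
  move=> mu K v; pose s := sgn k (m + 1).
  have fl : linear (fun w => P (br u w) - br (P u) w - s *: br u (P w)).
    by move=> c y z; rewrite -!adE !linearP /= !adE; lmod k.
  have [f fE] := linear_of fl.
  (* The defect has degree m - 1 + r with r odd, so it has the parity of m, which is all that the
     Leibniz sign sees. *)
  have f_l : leibniz (idfun : {lrmorphism C -> C}) m f.
    move=> n y z ny; rewrite /= !fE (ab_poisson brP _ mu ny).
    rewrite (ab_poisson brP _ (P_r _ _ mu) ny) (P_l _ _ _ ny) !brDr !brZr.
    rewrite (ab_poisson brP _ mu (P_r _ _ ny)) (ab_poisson brP _ mu ny).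
    rewrite (J _ _ _ _ z mu ny) linearD linearZ /=.
    rewrite (P_l _ _ _ (ab_deg brP mu ny)) (P_l _ _ _ ny).
    rewrite !(mulrBl, mulrBr z) !(mulrBr y) -!scalerAl -!scalerAr /s.
    by rewrite ?sgn_par ?parE r_odd; signs; lmod k.
  have f0 j : f (x j) = (\0 : {linear C -> C}) (x j).
    by rewrite fE [P (br _ _)]K /s /=; lmod k.
  have z_l : leibniz (idfun : {lrmorphism C -> C}) m (\0 : {linear C -> C}).
    by move=> n y z _; rewrite /= mul0r mulr0 scaler0 addr0.
  have := leibniz_eq Cx f_l z_l f0 v; rewrite fE /= => H.
  by apply/eqP; rewrite -subr_eq0 opprD addrA H.
move=> m u v mu; apply: (Kgens) => // j.
apply: (@dif_at_sym _ r _ _ _ _ r_odd P_r (x_deg j) mu).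
by apply: (Kgens) => // i; apply: Kx.
Qed.

(** The bracket terms of P (Q (y z)) and Q (P (y z)) cancel because each operator derives the
    bracket, and what remains is a derivation. Applied to d and [B] it concerns [D], and applied to
    [B] twice it concerns 2 B^2. *)
Lemma bv_anticomm e e' r r' (P Q : {linear C -> C}) :
  par r -> raises r P -> bv_leibniz e P ->
  par r' -> raises r' Q -> bv_leibniz e' Q ->
  (forall m u v, hdeg m u -> dif_at P m u v) ->
  (forall m u v, hdeg m u -> dif_at Q m u v) ->
  leibniz id 0 (fun y => P (Q y) + Q (P y)).
Proof.
move=> r_odd P_r P_l r'_odd Q_r Q_l P_d Q_d m y z my /=.
rewrite (P_l _ _ _ my) (Q_l _ _ _ my) !linearD /= !linearZ /=.
rewrite (P_l _ _ _ my) (Q_l _ _ _ my) (P_l _ _ _ (Q_r _ _ my)) (Q_l _ _ _ (P_r _ _ my)).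
rewrite (P_d _ _ _ my) (Q_d _ _ _ my) (mulrDl _ _ z) (mulrDr y).
by rewrite ?sgn_par ?parE r_odd r'_odd; signs; lmod k.
Qed.
End Antibracket.

Section FreeBV.
Variables (k : fieldType) (N : nat) (g : 'I_N -> int) (C : gcAlg k) (x : 'I_N -> C).
Hypothesis Cx : free_on g x.

Lemma partials_exist : exists p : 'I_N -> {linear C -> C},
  forall i, is_der (- g i) (p i) /\ forall j, p i (x j) = (i == j)%:R.
Proof.
have p_ex i : exists f : {linear C -> C},
    is_der (- g i) f /\ forall j, f (x j) = (i == j)%:R.
  apply: (der_exists Cx) => // j; case: eqP => [->|_]; last exact: hdeg0.
  by rewrite subrr; apply: hdeg1.
exists (fun i => sval (constructive_indefinite_description _ (p_ex i))) => i.
exact: svalP (constructive_indefinite_description _ (p_ex i)).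
Qed.

(** The bracket is the signed sum over i of (d/dx_i y) {x_i, z}, where {x_i, -} is the derivation
    with the prescribed values. The Leibniz rules hold term by term; antisymmetry is not visible and
    is propagated from the generators. *)
Lemma antibracket_exists (b : 'I_N -> 'I_N -> C) :
  (forall i j, hdeg (g i + g j - 1) (b i j)) ->
  (forall i j, b i j = - sgn k ((g i - 1) * (g j - 1)) *: b j i) ->
  exists br, is_antibracket br /\ forall i j, br (x i) (x j) = b i j.
Proof.
have [x_deg _] := Cx; move=> b_deg b_anti; have [p pP] := partials_exist.
have a_ex i : exists f : {linear C -> C},
    is_der (g i - 1) f /\ forall j, f (x j) = b i j.
  by apply: (der_exists Cx) => // j; apply: hdeg_cast (b_deg i j) _; ring.
pose a i := sval (constructive_indefinite_description _ (a_ex i)).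
have aP i : is_der (g i - 1) (a i) /\ forall j, a i (x j) = b i j.
  exact: svalP (constructive_indefinite_description _ (a_ex i)).
(* [twist] supplies the sign in the degree of y, so that the formula is bilinear on all of C. *)
pose br y z := \sum_i sgn k (g i) *: (p i (twist C (g i) y) * a i z).
have brE m y z : hdeg m y -> br y z = \sum_i sgn k (g i * (m + 1)) *: (p i y * a i z).
  move=> my; apply: eq_bigr => i _; rewrite (twistE _ my) linearZ /= -scalerAl scalerA.
  by congr (_ *: _); signs; rewrite ?mulrNN ?mulr1 ?mul1r.
have linl c y y' z : br (c *: y + y') z = c *: br y z + br y' z.
  rewrite /br scaler_sumr -big_split; apply: eq_bigr => i _ /=.
  by rewrite !linearP /= mulrDl -scalerAl; lmod k.
have linlD y y' z : br (y + y') z = br y z + br y' z.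
  by rewrite -[y in LHS]scale1r linl scale1r.
have linr c y z z' : br y (c *: z + z') = c *: br y z + br y z'.
  rewrite /br scaler_sumr -big_split; apply: eq_bigr => i _ /=.
  by rewrite linearP /= mulrDr -scalerAr; lmod k.
have deg m n y z : hdeg m y -> hdeg n z -> hdeg (m + n - 1) (br y z).
  move=> my nz; rewrite (brE _ _ _ my); apply: hdeg_sum => i _; apply: hdegZ.
  have [[[p_r _] _] [[a_r _] _]] := (pP i, aP i).
  by apply: hdegM_cast (p_r _ _ my) (a_r _ _ nz) _; ring.
have poisson m n y z w : hdeg m y -> hdeg n z ->
    br y (z * w) = br y z * w + sgn k ((m - 1) * n) *: (z * br y w).
  move=> my nz; rewrite !(brE _ _ _ my) mulr_suml mulr_sumr scaler_sumr -big_split.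
  apply: eq_bigr => i _ /=; have [[[p_r _] _] [[_ a_l] _]] := (pP i, aP i).
  rewrite (a_l _ _ _ nz) (mulrDr (p i y)) -!scalerAl -!scalerAr !mulrA.
  rewrite (gc_mulC (p_r _ _ my) nz) -scalerAl.
  by signs; lmod k.
have poissonl m n y y' z : hdeg m y -> hdeg n z ->
    br (y * y') z = y * br y' z + br y z * twist C (n - 1) y'.
  move=> my nz; elim/gc_ind: y' => [u v IHu IHv|m' y' my'].
    by rewrite mulrDr !linlD IHu IHv linearD /= !mulrDr; lmod k.
  rewrite (brE _ _ _ (hdegM my my')) (brE _ _ _ my) (brE _ _ _ my').
  rewrite (twistE _ my') mulr_sumr mulr_suml -big_split; apply: eq_bigr => i _ /=.
  have [[[p_r p_l] _] [[a_r _] _]] := (pP i, aP i).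
  rewrite (p_l _ _ _ my) (mulrDl _ _ (a i z)) -!scalerAl -!scalerAr -?scalerAl -!mulrA.
  rewrite (gc_mulC my' (a_r _ _ nz)) -scalerAr !mulrA.
  by signs; lmod k.
have gens i j : br (x i) (x j) = b i j.
  rewrite (brE _ _ _ (x_deg i)) (bigD1 i) //= big1 => [|l li].
    rewrite addr0; have [[_ ->] [_ ->]] := (pP i, aP i).
    by rewrite eqxx mul1r; signs; rewrite scale1r.
  by have [_ ->] := pP l; rewrite (negbTE li) mul0r scaler0.
have br1 z : br 1 z = 0.
  rewrite /br big1 // => i _; have [[_ p_l] _] := pP i.
  by rewrite twist1 (leibniz1 _ p_l) // mul0r scaler0.
have brZl c y z : br (c *: y) z = c *: br y z.
  have := linl c y 0 z; have := linl (-1) 0 0 z.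
  by rewrite scaler0 !addr0 scaleN1r addNr => -> ->; rewrite addr0.
have brZr c y z : br y (c *: z) = c *: br y z.
  have := linr c y z 0; have := linr (-1) y 0 0.
  by rewrite scaler0 !addr0 scaleN1r addNr => -> ->; rewrite addr0.
have br_1 m y : hdeg m y -> br y 1 = 0.
  by move=> my; apply: (@leibniz1 _ C C id (m - 1)) => // n z w; apply: poisson.
(* Antisymmetry is extended first in y against generators, then in z against any homogeneous y. *)
have anti1 y j : br y (x j) = - sgn k (g j - 1) *: br (x j) (twist C (g j - 1) y).
  elim/(free_ind Cx): y => [|c y z IHy IHz|i y IHy].
  - by rewrite br1 twist1 (br_1 _ _ (x_deg j)) scaler0.
  - by rewrite linl linearP /= linr IHy IHz; lmod k.
  rewrite (poissonl _ _ _ _ _ (x_deg i) (x_deg j)) IHy twistM.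
  rewrite (twistE _ (x_deg i)) -scalerAl brZr (poisson _ _ _ _ _ (x_deg j) (x_deg i)).
  rewrite !gens (b_anti i j) -!scalerAl -!scalerAr.
  by signs; lmod k.
have anti2 m y z : hdeg m y -> br y z = - sgn k (m - 1) *: br (twist C (m - 1) z) y.
  move=> my; elim/(free_ind Cx): z => [|c z w IHz IHw|i z IHz].
  - by rewrite twist1 br1 (br_1 _ _ my) scaler0.
  - by rewrite linr linearP /= linl IHz IHw; lmod k.
  rewrite (poisson _ _ _ _ _ my (x_deg i)) IHz twistM (twistE _ (x_deg i)) -scalerAl brZl.
  rewrite (poissonl _ _ _ _ _ (x_deg i) my) twistK anti1 (twistE _ my) brZr.
  rewrite -!scalerAl -!scalerAr.
  by signs; lmod k.
exists br; split=> //; split=> // m n y z my nz.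
rewrite (anti2 _ _ _ my) (twistE _ nz) brZl scalerA; congr (_ *: _).
by signs; ring.
Qed.

Variable br : C -> C -> C.
Hypothesis brP : is_antibracket br.
Hypothesis brJ : forall m n u v w, hdeg m u -> hdeg n v -> jacobi_at br m n u v w.
Hypothesis k2 : 2%:R != 0 :> k.

(* B = 1/2 sum_i (-1)^(g_i) ad(x_i) d/dx_i. Its square and its anticommutator
   with ad are derivations vanishing on generators, by the Jacobi identity. *)
Lemma bv_exists :
  (forall (f : {linear C -> C}) i j, (forall l, f (x l) = 0) -> f (br (x i) (x j)) = 0) ->
  exists B : {linear C -> C}, [/\ raises (- 1) B, forall i, B (x i) = 0,
    bv_leibniz br 1 B, forall m u v, hdeg m u -> dif_at br B m u v
    & forall y, B (B y) = 0].
Proof.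
have [x_deg _] := Cx; move=> br_lin; have [p pP] := partials_exist.
(* {y, -} is a derivation, hence the combination of the partial derivatives whose coefficients are
   its values on the generators. *)
have S m y z : hdeg m y ->
    br y z = \sum_i sgn k ((g i + 1) * m + g i) *: (br (x i) y * p i z).
  move=> my.
  have fl : linear (fun z => \sum_i sgn k ((g i + 1) * m + g i) *: (br (x i) y * p i z)).
    move=> c u v; rewrite scaler_sumr -big_split; apply: eq_bigr => i _ /=.
    by rewrite linearP (mulrDr (br (x i) y)) -scalerAr /=; lmod k.
  have [f fE] := linear_of fl; rewrite -(adE brP) -fE.
  apply: (leibniz_eq (c := (idfun : {lrmorphism C -> C})) Cx (r := m - 1)).
  - by move=> n u v nu; have [_ /(_ n u v nu)] := ad_der brP my.
  - move=> n u v nu; rewrite !fE mulr_suml mulr_sumr scaler_sumr -big_split.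
    apply: eq_bigr => i _ /=; have [[_ p_l] _] := pP i.
    rewrite (p_l _ _ _ nu) (mulrDr (br (x i) y)) -scalerAl -!scalerAr !mulrA.
    rewrite (gc_mulC nu (ab_deg brP (x_deg i) my)) -scalerAl.
    by signs; lmod k.
  move=> j; rewrite fE adE (ab_anti brP my (x_deg j)) (bigD1 j) //= big1 => [|i ij].
    have [_ ->] := pP j; rewrite eqxx mulr1 addr0; congr (_ *: _).
    by signs; ring.
  by have [_ ->] := pP i; rewrite (negbTE ij) mulr0 scaler0.
(* The same expansion in the first argument, by antisymmetry. *)
have R m y z : hdeg m y ->
    br y z = \sum_i sgn k (g i * (m + 1)) *: (p i y * br (x i) z).
  move=> my; elim/gc_ind: z => [z w IHz IHw|n z nz].
    rewrite (brDr brP) IHz IHw -big_split; apply: eq_bigr => i _ /=.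
    by rewrite (brDr brP) (mulrDr (p i y)) scalerDr.
  rewrite (ab_anti brP my nz) (S _ _ _ nz) scaler_sumr; apply: eq_bigr => i _.
  have [[p_r _] _] := pP i.
  rewrite (gc_mulC (ab_deg brP (x_deg i) nz) (p_r _ _ my)).
  by signs; lmod k.
pose h : k := 2%:R^-1.
have Bl : linear (fun y => h *: \sum_i sgn k (g i) *: br (x i) (p i y)).
  move=> c y z; rewrite scalerA mulrC -scalerA -scalerDr; congr (_ *: _).
  rewrite scaler_sumr -big_split; apply: eq_bigr => i _ /=.
  by rewrite linearP (ab_linr brP); lmod k.
have [B BE] := linear_of Bl.
have B_r : raises (- 1) B.
  move=> m y my; rewrite BE; apply/hdegZ/hdeg_sum => i _; apply: hdegZ.
  have [[p_r _] _] := pP i.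
  by apply: hdeg_cast (ab_deg brP (x_deg i) (p_r _ _ my)) _; ring.
have Bx j : B (x j) = 0.
  rewrite BE big1 ?scaler0 // => i _; have [_ ->] := pP i.
  have /leibniz1 b1 := (ad_der brP (x_deg i)).2.
  case: eqP => _; last by rewrite (br0r brP) scaler0.
  by rewrite -(adE brP) b1 ?scaler0.
have B_l : bv_leibniz br 1 B.
  move=> m y z my.
  (* The cross terms of B (y z) are the expansions [R] and [S] of {y, z}, each with weight 1/2; this
     explains the factor in [B]. *)
  have -> : br y z = h *: br y z + h *: br y z.
    by rewrite -scalerDl -[LHS]scale1r; congr (_ *: _); rewrite /h; field.
  rewrite {1}(R _ _ z my) (S _ _ z my) !BE.
  rewrite -scalerAl -scalerAr mulr_suml mulr_sumr !scaler_sumr -!big_split.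
  rewrite scaler_sumr -big_split.
  apply: eq_bigr => i _ /=; have [[p_r p_l] _] := pP i.
  rewrite (p_l _ _ _ my) (brDr brP) (brZr brP) (ab_poisson brP _ (x_deg i) (p_r _ _ my)).
  rewrite (ab_poisson brP _ (x_deg i) my) -!scalerAl -!scalerAr.
  by signs; lmod k.
(* On generators every term vanishes: [B] kills each x_i, and by [br_lin] it also kills the brackets
   of generators. *)
have B_d m u v : hdeg m u -> dif_at br B m u v.
  apply: (dif_gens brP Cx brJ _ B_r B_l) => // i j.
  by rewrite /dif_at br_lin // !Bx (br0l brP) (br0r brP) scaler0 addr0.
exists B; split=> // y.
have /(_ (B \o B : {linear C -> C}) (\0 : {linear C -> C})) :=
  leibniz_eq (c := (idfun : {lrmorphism C -> C})) Cx (r := 0).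
apply=> [m u v mu|m u v mu|i] /=; last by rewrite Bx linear0.
  have := bv_anticomm (isT : par (- 1)) B_r B_l (isT : par (- 1)) B_r B_l B_d B_d v mu.
  rewrite mul0r /sgn expr0z !scale1r /= -!mulr2n mulrnAl mulrnAr -mulrnDl => /eqP.
  rewrite -subr_eq0 -mulrnBl -scaler_nat scaler_eq0 (negbTE k2) /= subr_eq0.
  by move/eqP.
by rewrite mul0r mulr0 scaler0 addr0.
Qed.
End FreeBV.

Section Restriction.
Variables (k : fieldType) (C : gcAlg k) (S : {pred C}) (Sc : GRing.subalg_closed S).
Local Notation T := (subgc_sort Sc).

Lemma sub_linear (f : {linear C -> C}) : (forall y, y \in S -> f y \in S) ->
  {h : {linear T -> T} | forall y, val (h y) = f (val y)}.
Proof.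
move=> fS; pose h (y : T) : T := exist _ (f (val y)) (fS _ (valP y)).
have hl : linear h by move=> c y z; apply: val_inj; rewrite /= !linearP.
by exists (HB.pack h (GRing.isLinear.Build _ _ _ _ h hl) : {linear T -> T}).
Qed.
End Restriction.

(** * The differential BV algebra on the kernel of D *)

Section KernelModel.
Variables (k : fieldType) (A : dgcAlg k) (br : A -> A -> A).
Hypothesis brP : is_gerstenhaber br.
Variable B : {linear A -> A}.
Hypotheses (B_r : raises (- 1) B) (B_l : bv_leibniz br 1 B) (BB : forall y, B (B y) = 0).
Variables (N : nat) (g : 'I_N -> int) (x : 'I_N -> A).
Hypothesis Ax : free_on g x.
Let brA : is_antibracket br.
Proof. by case: brP. Qed.
Let D (y : A) : A := dif (B y) + B (dif y).
Hypothesis D_l : leibniz id 0 D.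
Hypothesis D_diag : forall i, exists2 l : seq (k * A),
  (forall p, p \in l -> D p.2 = p.1 *: p.2) & x i = \sum_(p <- l) p.2.

Let D_linear : linear D.
Proof. by move=> c y z; rewrite /D !linearP /=; lmod k. Qed.
Let DL : {linear A -> A} := sval (linear_of D_linear).
Let DLE y : DL y = D y. Proof. exact: (svalP (linear_of D_linear)). Qed.

Let D_mul y z : D (y * z) = D y * z + y * D z.
Proof.
elim/gc_ind: y => [u v IHu IHv|m y my].
  by rewrite mulrDl -!DLE !linearD /= !DLE IHu IHv !mulrDl addrACA.
by rewrite (D_l _ my) mul0r /sgn expr0z scale1r.
Qed.

Let D1 : D 1 = 0. Proof. exact: (@leibniz1 _ A A id 0 D). Qed.

Let D_r : raises 0 D.
Proof.
move=> m y my; apply: hdegD; first by apply: hdeg_cast (dif_deg (B_r my)) _; ring.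
by apply: hdeg_cast (B_r (dif_deg my)) _; ring.
Qed.

Let D_dif y : D (dif y) = dif (D y).
Proof. by rewrite /D dif_dif linear0 addr0 linearD /= dif_dif add0r. Qed.

Let D_B y : D (B y) = B (D y).
Proof. by rewrite /D BB linear0 add0r linearD /= BB addr0. Qed.

(** [D] is a derivation, so a product of eigenvectors is an eigenvector for the sum of the
    eigenvalues; the decomposition thus spreads from generators to all of A. *)
Let eigen_decomp (y : A) : exists2 l : seq (k * A),
  (forall p, p \in l -> D p.2 = p.1 *: p.2) & y = \sum_(p <- l) p.2.
Proof.
elim/(free_ind_alg Ax): y => [|c y z [l1 E1 ->] [l2 E2 ->]|i|y z [l1 E1 ->] [l2 E2 ->]].
- by exists [:: (0, 1)]; rewrite ?big_seq1 // => p; rewrite inE => /eqP->; rewrite D1 scale0r.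
- exists ([seq (p.1, c *: p.2) | p <- l1] ++ l2); last first.
    by rewrite big_cat big_map scaler_sumr.
  move=> p; rewrite mem_cat => /orP[/mapP[q /E1 Eq ->] /=|/E2//].
  by rewrite -DLE linearZ /= DLE Eq !scalerA mulrC.
- exact: D_diag.
exists [seq (p.1 + q.1, p.2 * q.2) | p <- l1, q <- l2]; last first.
  by rewrite big_allpairs_dep mulr_suml; apply: eq_bigr => p _; rewrite mulr_sumr.
move=> _ /allpairsP[[p q] /= [/E1 Ep /E2 Eq ->]] /=.
by rewrite D_mul Ep Eq -scalerAl -scalerAr scalerDl.
Qed.

(** An eigenvector with eigenvalue c != 0 is [D] of its multiple by 1/c. *)
Let ker_im (y : A) : exists y0 y1, D y0 = 0 /\ y = y0 + D y1.
Proof.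
have [l + ->] := eigen_decomp y; elim: l => [_|p l IH E].
  by exists 0, 0; rewrite big_nil -DLE linear0 addr0.
rewrite big_cons; have [|y0 [y1 [D0 ->]]] := IH _; first by move=> q ql; apply: E; rewrite inE ql orbT.
have Ep := E p (mem_head _ _).
have [p0|p0] := eqVneq p.1 0.
  exists (p.2 + y0), y1; rewrite addrA; split=> //.
  by rewrite -DLE linearD /= !DLE D0 Ep p0 scale0r addr0.
exists y0, (p.1^-1 *: p.2 + y1); split=> //.
by rewrite -!DLE linearD linearZ /= !DLE Ep scalerA mulVf // scale1r addrCA.
Qed.

(* The polynomial prod_(c != 0) (T - c) in D kills all eigenvectors of nonzero
   eigenvalue and acts invertibly on ker D. *)
Let ker_cap_im (y : A) : D (D y) = 0 -> D y = 0.
Proof.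
have [l E ->] := eigen_decomp y; set u := \sum_(p <- l) p.2.
pose q (s : seq k) (z : A) := foldr (fun c z => D z - c *: z) z s.
have qlin s : linear (q s).
  move=> a v w; elim: s => //= c s ->.
  by rewrite -!DLE linearP /=; lmod k.
have qD s z : q s (D z) = D (q s z).
  elim: s => //= c s ->; by rewrite -[RHS]DLE linearB !linearZ /= !DLE.
have q_ker s z : D z = 0 -> q s z = \prod_(c <- s) (- c) *: z.
  move=> Dz; elim: s => [|c s IH]; first by rewrite big_nil scale1r.
  rewrite /= IH big_cons -DLE linearZ /= DLE Dz scaler0 add0r scalerA.
  by rewrite mulNr scaleNr.
have q_eigen s c z : D z = c *: z -> c \in s -> q s z = 0.
  move=> Dz; elim: s => //= a s IH; rewrite inE => /predU1P[<-|/IH ->]; last first.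
    by rewrite -DLE linear0 scaler0 subr0.
  rewrite -qD Dz; have [h hE] := linear_of (qlin s).
  by rewrite -!hE linearZ subrr.
pose sp := [seq p.1 | p <- l & p.1 != 0].
have qDu : q sp (D u) = 0.
  have [h hE] := linear_of (qlin sp).
  rewrite qD -hE /u raddf_sum -DLE raddf_sum big_seq big1 // => p pl /=.
  rewrite DLE hE; have [p0|p0] := eqVneq p.1 0.
    by rewrite -qD E // p0 scale0r -hE linear0.
  rewrite (q_eigen _ p.1) ?E //; first by rewrite -DLE linear0.
  by apply/mapP; exists p; rewrite // mem_filter p0.
move=> DDu; move: qDu; rewrite (q_ker _ _ DDu) => /eqP; rewrite scaler_eq0 => /orP[|/eqP//].
rewrite prodf_seq_eq0 => /hasP[c /mapP[p + ->]]; rewrite mem_filter => /andP[p0 _] /=.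
by rewrite oppr_eq0 (negbTE p0).
Qed.

Let S : {pred A} := fun y => D y == 0.
Let SP y : reflect (D y = 0) (y \in S). Proof. exact: eqP. Qed.

Let Sc : GRing.subalg_closed S.
Proof.
split=> [|c y z /SP Dy /SP Dz|y z /SP Dy /SP Dz]; apply/SP => //.
  by rewrite -DLE linearP /= !DLE Dy Dz scaler0 addr0.
by rewrite D_mul Dy Dz mul0r mulr0 addr0.
Qed.

(** [D] preserves degrees, so it can be tested on each homogeneous part separately. *)
Let Sg y : y \in S -> exists2 l, hlist (fun m y => hdeg m y /\ y \in S) l & y = hsum l.
Proof.
have [l lG ->] := gr_list (hdeg_grading A) y; move=> /SP Dl.
exists [seq (m, hpart l m) | m <- undup (map fst l)]; last first.
  have := sum_hpart (fun=> 1 : k) l; rewrite /hsum big_map /=.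
  under eq_bigr do rewrite scale1r.
  by move=> ->; apply: eq_bigr => p _; rewrite scale1r.
move=> _ /mapP[m _ ->] /=; split; first exact: (hpart_gr (hdeg_grading A)).
apply/SP; have -> : D (hpart l m) = hpart [seq (p.1, D p.2) | p <- l] m.
  by rewrite /hpart big_map -DLE raddf_sum; apply: eq_bigr => p _; apply: DLE.
apply: (hsum_eq0 (hdeg_grading A)) => [_ /mapP[p /lG pG ->]|].
  by apply: hdeg_cast (D_r pG) _; rewrite addr0.
by rewrite -Dl -DLE /hsum big_map raddf_sum; apply: eq_bigr => p _; rewrite /= DLE.
Qed.

Let S_dif y : y \in S -> dif y \in S.
Proof. by move=> /SP Dy; apply/SP; rewrite D_dif Dy linear0. Qed.
Let S_B y : y \in S -> B y \in S.
Proof. by move=> /SP Dy; apply/SP; rewrite D_B Dy linear0. Qed.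

Let br_B m y z : hdeg m y ->
  br y z = sgn k m *: (B (y * z) - B y * z - sgn k m *: (y * B z)).
Proof. by move=> my; rewrite (B_l _ my); signs; lmod k. Qed.

Let SZ c y : y \in S -> c *: y \in S.
Proof. by move=> /SP Dy; apply/SP; rewrite -DLE linearZ /= DLE Dy scaler0. Qed.
Let SB y z : y \in S -> z \in S -> y - z \in S.
Proof. by move=> /SP Dy /SP Dz; apply/SP; rewrite -DLE linearB /= !DLE Dy Dz subr0. Qed.
Let SD y z : y \in S -> z \in S -> y + z \in S.
Proof. by move=> /SP Dy /SP Dz; apply/SP; rewrite -DLE linearD /= !DLE Dy Dz addr0. Qed.
Let SM y z : y \in S -> z \in S -> y * z \in S.
Proof. by case: Sc => _ _; apply. Qed.

(** For a homogeneous left argument the bracket is expressed by [B] and the product, and both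
    preserve ker D. *)
Let S_br y z : y \in S -> z \in S -> br y z \in S.
Proof.
move=> yS zS; have [l + ->] := Sg yS; elim: l => [_|p l IH /hlist_cons[[pG pS] lG]].
  rewrite /hsum big_nil -[0](subrr 0) -scaleN1r addrC (ger_linl brP) scaleN1r addNr.
  by apply/SP; rewrite -DLE linear0.
rewrite /hsum big_cons -[p.2]scale1r (ger_linl brP) scale1r.
apply: (SD) (IH lG); rewrite (br_B _ pG).
by apply: (SZ); do !apply: (SB); rewrite ?(SZ) ?(SM) ?(S_B) // (SM).
Qed.

Let T := subgc Sc Sg.
Let difT : {linear T -> T} := sval (sub_linear Sc S_dif).
Let difTE y : val (difT y) = dif (val y). Proof. exact: (svalP (sub_linear Sc S_dif)). Qed.
Let BT : {linear T -> T} := sval (sub_linear Sc S_B).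
Let BTE y : val (BT y) = B (val y). Proof. exact: (svalP (sub_linear Sc S_B)). Qed.
Let brT (y z : T) : T := exist _ (br (val y) (val z)) (S_br (valP y) (valP z)).

Let valD (y z : T) : val (y + z : T) = val y + val z.
Proof. by rewrite rmorphD. Qed.
Let valZ c (y : T) : val (c *: y : T) = c *: val y.
Proof. by rewrite linearZ. Qed.
Let valN (y : T) : val (- y : T) = - val y.
Proof. by rewrite rmorphN. Qed.
Let val0 : val (0 : T) = 0. Proof. by rewrite rmorph0. Qed.
Let val1 : val (1 : T) = 1. Proof. by rewrite rmorph1. Qed.
Let valM (y z : T) : val (y * z : T) = val y * val z.
Proof. by rewrite rmorphM. Qed.

Fact kernel_dif_deg m (y : T) : hdeg m y -> hdeg (m + 1) (difT y).
Proof. by move=> my; rewrite /hdeg /= /subgc_deg difTE; apply: dif_deg. Qed.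
Fact kernel_dif_dif y : difT (difT y) = 0.
Proof. by apply: val_inj; rewrite !difTE dif_dif val0. Qed.
Fact kernel_dif_mul m (y z : T) : hdeg m y ->
  difT (y * z) = difT y * z + sgn k m *: (y * difT z).
Proof.
by move=> my; apply: val_inj; rewrite valD valZ !valM !difTE valM (dif_mul _ my).
Qed.
Definition kernel_dgc : dgcAlg k := DgcAlg kernel_dif_deg kernel_dif_dif kernel_dif_mul.

Let BM : {linear kernel_dgc -> kernel_dgc} := BT.
Let brM : kernel_dgc -> kernel_dgc -> kernel_dgc := brT.

Fact kernel_bv_deg m (y : kernel_dgc) : hdeg m y -> hdeg (m - 1) (BM y).
Proof. by move=> my; rewrite /hdeg /= /subgc_deg BTE; apply: B_r. Qed.
Fact kernel_bv_sqr y : BM (BM y) = 0.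
Proof. by apply: val_inj; rewrite !BTE BB val0. Qed.
Fact kernel_bv_one : BM 1 = 0.
Proof. by apply: val_inj; rewrite BTE val1 (bv_leibniz1 brA B_l) val0. Qed.
Fact kernel_bv_dif (y : kernel_dgc) : dif (BM y) + BM (dif y) = 0.
Proof.
apply: val_inj; rewrite -[LHS]/(val (difT (BT y) + BT (difT y) : T)) valD.
by rewrite difTE !BTE difTE val0; apply/SP/valP.
Qed.

Fact kernel_gerstenhaber : is_gerstenhaber brM.
Proof.
split=> [c y y' z|c y z z'|m n y z my nz|m n y z my nz|m n p y z w my nz pw
  |m n y z w my nz|m y z my]; try apply: val_inj.
- exact: (ger_linl brP).
- exact: (ger_linr brP).
- exact: (ger_deg brP my nz).
- exact: (ger_anti brP).
- exact: (ger_jacobi brP my nz pw).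
- exact: (ger_poisson brP).
by rewrite -[LHS]/(val (difT (brT y z))) difTE /= (ger_dif brP _ my) -!difTE.
Qed.

Fact kernel_bv_leibniz (y z : T) m : hdeg m y ->
  BT (y * z) = BT y * z + sgn k m *: (y * BT z) + sgn k m *: (brT y z : T).
Proof.
move=> my; apply: val_inj; rewrite !valD !valZ !valM !BTE valM (B_l _ my) mul1r //.
Qed.

Let brT_poisson m n (y z w : T) : hdeg m y -> hdeg n z ->
  brT y (z * w) = (brT y z : T) * w + sgn k ((m - 1) * n) *: (z * (brT y w : T)).
Proof. exact: (ger_poisson kernel_gerstenhaber). Qed.

(** Up to signs, the first commutator with a is multiplication by B a plus {a, -}, and the second,
    with a', is multiplication by {a, a'}. Multiplications commute in the graded sense, so the third
    vanishes. *)
Fact kernel_bv_order : diffop (A := kernel_dgc) 2 (- 1) BM.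
Proof.
move=> m a ma Q m' a' ma' Q' m'' a'' ma'' Q'' u.
have QE v : Q v = BT a * v + sgn k m *: (brT a v : T).
  rewrite /Q [BM _](kernel_bv_leibniz _ ma) -[BM v]/(BT v).
  by signs; lmod k.
have am1 : hdeg (m - 1) (BT a : T) by apply: kernel_bv_deg.
have ab : hdeg (m + m' - 1) (brT a a' : T) by apply: (ger_deg kernel_gerstenhaber ma ma').
have Q'E v : Q' v = sgn k m *: ((brT a a' : T) * v).
  rewrite /Q' !QE (brT_poisson _ ma ma') (mulrDr (a' : T)) -(scalerAr _ (a' : T)) !mulrA.
  rewrite (gc_mulC ma' am1) -!scalerAl.
  by signs; lmod k.
rewrite /Q'' !Q'E -(scalerAr _ (a'' : T)) !mulrA (gc_mulC ma'' ab) -!scalerAl.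
by signs; lmod k.
Qed.

Definition kernel_bv : dBVAlg k :=
  DBVAlg kernel_bv_deg kernel_bv_order kernel_bv_sqr kernel_bv_one kernel_bv_dif.

Lemma kernel_model : exists (M : dBVAlg k) (brM : M -> M -> M) (hbr : is_gerstenhaber brM),
  is_bv_bracket brM /\ quasi_isomorphic (DGAlg brP) (DGAlg hbr).
Proof.
exists kernel_bv, brM, kernel_gerstenhaber; split.
  move=> m y z my; apply: val_inj.
  have H : val (sgn k m *: (BT ((y : T) * z) - BT y * (z : T) - sgn k m *: ((y : T) * BT z)))
      = br (val y) (val z).
    by rewrite (br_B _ my) valZ !valD !valN valZ !valM !BTE valM.
  exact: esym H.
(* The zigzag is the single inclusion of ker D into A, read backwards. *)
apply/rst_sym/rst_step; exists (subgc_incl Sc); split.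
- by [].
- by move=> y; apply: difTE.
- by [].
(* If y = d z with z = z0 + D z1, then d (D z1) = D (d z1) lies in ker D and in im D, hence is 0,
   and y = d z0. *)
- move=> y dy [z yz].
  have [z0 [z1 [Dz0 zE]]] := ker_im z.
  have dz0 : dif z0 \in S by apply/S_dif/SP.
  exists (exist _ z0 (introT (SP z0) Dz0)); apply: val_inj; rewrite [RHS]difTE /=.
  have Dz : D (dif z1) = 0.
    apply: ker_cap_im; rewrite D_dif.
    have -> : dif (D z1) = val y - dif z0.
      by apply/eqP; rewrite eq_sym subr_eq addrC -linearD -zE; apply/eqP.
    by apply/SP; apply: (SB) => //; apply: valP.
  by rewrite [LHS]yz zE linearD /= -D_dif Dz addr0.
(* Decomposing twice writes y - y0 as D (D y3). Then D y3 is closed, since ker D meets im D in 0,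
   and so D (D y3) = d (B (D y3)) is exact. *)
move=> y dy; have [y0 [y1 [Dy0 yE]]] := ker_im y; have [y2 [y3 [Dy2 y1E]]] := ker_im y1.
have yE' : y = y0 + D (D y3).
  by rewrite yE y1E -!DLE linearD /= !DLE Dy2 add0r.
have dD3 : dif (D y3) = 0.
  rewrite -D_dif; do 2!apply: (ker_cap_im).
  rewrite D_dif D_dif; have -> : dif (D (D y3)) = - dif y0.
    by apply/eqP; rewrite -addr_eq0 addrC -linearD /= -yE' dy.
  by rewrite -DLE linearN /= DLE D_dif Dy0 linear0 oppr0.
have yE2 : y = y0 + dif (B (D y3)) by rewrite [LHS]yE' {1}/D dD3 linear0 addr0.
exists (exist _ y0 (introT (SP y0) Dy0)), (B (D y3)); split=> //.
apply: val_inj; rewrite [LHS]difTE; apply: etrans (esym val0) => /=.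
by move: dy; rewrite yE2 linearD /= dif_dif addr0.
Qed.
End KernelModel.

(** [linfun] accepts any function but agrees with it only if the function is linear; maps defined by
    [linfun] on a bare function are evaluated through this. *)
Lemma linfunE (k : fieldType) (U W : vectType k) (f : U -> W) :
  linear f -> forall v, linfun f v = f v.
Proof.
move=> fl v; pose F : {linear U -> W} := HB.pack f (GRing.isLinear.Build _ _ _ _ f fl).
exact: (lfunE F).
Qed.

(** * Matrix units *)

Section Entries.
Variables (k : fieldType) (V : gvect k) (n : nat) (e : n.-tuple V) (dg : 'I_n -> int).
Hypothesis e_basis : basis_of fullv e.
Hypothesis e_deg : forall a : 'I_n, e`_a \in gv_gr V (dg a).
Local Notation supp := (gv_supp V).

Let e_free : free e. Proof. exact: basis_free e_basis. Qed.

Lemma e_expand (v : V) : v = \sum_a coord e a v *: e`_a.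
Proof. exact: coord_basis e_basis (memvf v). Qed.

Definition ent (f : 'End(V)) (a b : 'I_n) : k := coord e a (f e`_b).

Lemma ent_e (f : 'End(V)) (b : 'I_n) : f e`_b = \sum_a ent f a b *: e`_a.
Proof. exact: e_expand. Qed.

Lemma entP (f h : 'End(V)) : (forall a b, ent f a b = ent h a b) -> f = h.
Proof.
move=> fh; apply/lfunP => v; rewrite (e_expand v) !linear_sum; apply: eq_bigr => b _.
by rewrite !linearZ /= !ent_e; congr (_ *: _); apply: eq_bigr => a _; rewrite fh.
Qed.

Lemma ent_comp (f h : 'End(V)) a b : ent (f \o h)%VF a b = \sum_c ent f a c * ent h c b.
Proof.
rewrite {1}/ent comp_lfunE (ent_e h) !linear_sum; apply: eq_bigr => c _.
by rewrite !linearZ /= mulrC.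
Qed.

Fact ent_linear a b : linear (fun f : 'End(V) => ent f a b : k^o).
Proof. by move=> c f h; rewrite /ent add_lfunE scale_lfunE linearP. Qed.
Lemma entD f h a b : ent (f + h) a b = ent f a b + ent h a b.
Proof. by have := ent_linear a b 1 f h; rewrite !scale1r. Qed.
Lemma entZ c f a b : ent (c *: f) a b = c * ent f a b.
Proof. by rewrite /ent scale_lfunE linearZ. Qed.
Lemma entN f a b : ent (- f) a b = - ent f a b.
Proof. by rewrite -scaleN1r entZ mulN1r. Qed.
Lemma ent_sum (I : Type) (r : seq I) (P : pred I) F a b :
  ent (\sum_(i <- r | P i) F i) a b = \sum_(i <- r | P i) ent (F i) a b.
Proof. by rewrite /ent sum_lfunE linear_sum. Qed.

Lemma munitE a b v : munit e a b v = coord e b v *: e`_a.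
Proof.
by apply: (linfunE (f := fun v => _)) => c u w; rewrite linearP scalerDl scalerA.
Qed.

Lemma ent_munit a b c d : ent (munit e a b) c d = ((c == a) && (d == b))%:R.
Proof.
rewrite /ent munitE linearZ /= !coord_free // mulrC [a == c]eq_sym.
by rewrite -natrM mulnb.
Qed.

Lemma munit_expand f : f = \sum_a \sum_b ent f a b *: munit e a b.
Proof.
apply: entP => c d; rewrite ent_sum.
under eq_bigr => a _ do rewrite ent_sum.
rewrite (bigD1 c) //= [X in _ + X]big1 => [|a ac].
  rewrite addr0 (bigD1 d) //= big1 => [|b bd].
    by rewrite addr0 entZ ent_munit !eqxx mulr1.
  by rewrite entZ ent_munit [d == b]eq_sym (negbTE bd) andbF mulr0.
rewrite big1 // => b _.
by rewrite entZ ent_munit [c == a]eq_sym (negbTE ac) mulr0.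
Qed.

Lemma dg_supp a : dg a \in supp.
Proof.
apply: contraT => /(gv_out (g := V)) gr0; have := e_deg a; rewrite gr0 memv0 => /eqP ea.
by have := coord_free a a e_free; rewrite ea linear0 eqxx => /eqP; rewrite eq_sym oner_eq0.
Qed.

(** Directness is available as an equality of dimensions; splitting off the summand i leaves no room
    for an intersection. *)
Lemma gr_cap i : i \in supp ->
  (gv_gr V i :&: \sum_(j <- supp | j != i) gv_gr V j = 0)%VS.
Proof.
move=> i_supp; apply/eqP; rewrite -dimv_eq0; set W := (\sum_(j <- _ | _) _)%VS.
have := directvP (gv_direct V); rewrite /= (bigD1_seq i) ?gv_supp_uniq //=.
rewrite [RHS](bigD1_seq i) ?gv_supp_uniq //= -/W => dimE.
have := dimv_sum_cap (gv_gr V i) W; rewrite dimE.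
have : (\dim W <= \sum_(j <- supp | j != i) \dim (gv_gr V j))%N.
  rewrite /W; elim: (supp) => [|j s IH]; first by rewrite !big_nil dimv0.
  by rewrite !big_cons; case: ifP => // _; rewrite (leq_trans (dimv_add_leqif _ _)) // leq_add2l.
lia.
Qed.

Lemma gproj_e i (a : 'I_n) : gproj V i e`_a = if dg a == i then e`_a else 0.
Proof.
rewrite /gproj; case: (boolP (i \in supp)) => [i_supp|i_supp]; last first.
  have := memv_pi (gv_gr V i) (\sum_(j <- supp | j != i) gv_gr V j) e`_a.
  rewrite (gv_out i_supp) memv0 => /eqP ->; case: eqP => // ai.
  by rewrite -ai dg_supp in i_supp.
case: eqP => [ai|/eqP ai]; first by rewrite daddv_pi_id ?gr_cap // -ai.
have eW : e`_a \in (\sum_(j <- supp | j != i) gv_gr V j)%VS.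
  rewrite -big_filter (bigD1_seq (dg a)) ?filter_uniq ?gv_supp_uniq //=.
    by rewrite (subvP (addvSl _ _)).
  by rewrite mem_filter ai dg_supp.
have := daddv_pi_add (gr_cap i_supp) (subvP (addvSr _ _) _ eW).
rewrite [X in _ + X = _]daddv_pi_id //; last by rewrite capvC gr_cap.
by rewrite -[X in _ = X]add0r => /addIr.
Qed.

Lemma ent_gproj i j (f : 'End(V)) a b :
  ent (gproj V j \o f \o gproj V i)%VF a b
  = if (dg a == j) && (dg b == i) then ent f a b else 0.
Proof.
rewrite [LHS]/ent !comp_lfunE gproj_e; case: (dg b == i); last by rewrite !linear0 andbF.
rewrite andbT ent_e linear_sum /= linear_sum (bigD1 a) //= big1 => [|c ca].
  rewrite addr0 !linearZ /= gproj_e; case: (dg a == j); last by rewrite linear0 mulr0.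
  by rewrite coord_free // eqxx mulr1.
rewrite !linearZ /= gproj_e; case: ifP; rewrite ?linear0 ?mulr0 // coord_free //.
by rewrite (negbTE ca) mulr0.
Qed.

Lemma homVP i j (f : 'End(V)) :
  reflect (forall a b, ~~ ((dg a == j) && (dg b == i)) -> ent f a b = 0) (f \in homV V i j).
Proof.
have pE h : linfun (fun f : 'End(V) => (gproj V j \o f \o gproj V i)%VF) h
    = (gproj V j \o h \o gproj V i)%VF.
  apply: (linfunE (f := fun f => _)) => c u w.
  by rewrite comp_lfunDr comp_lfunDl -comp_lfunZr -comp_lfunZl.
apply: (iffP memv_imgP) => [[h _ ->] a b ab|f0].
  by rewrite pE ent_gproj (negbTE ab).
exists f; rewrite ?memvf // pE; apply: entP => a b; rewrite ent_gproj.
by case: ifPn => // /f0.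
Qed.

(** The graded pieces, q, l, n and both Borel subalgebras are spans of matrix units, so membership
    in each is the vanishing of the complementary entries. *)
Lemma memv_entP (W : {vspace 'End(V)}) (P : rel 'I_n) :
  (forall f a b, f \in W -> ~~ P a b -> ent f a b = 0) ->
  (forall a b, P a b -> munit e a b \in W) ->
  forall f, reflect (forall a b, ~~ P a b -> ent f a b = 0) (f \in W).
Proof.
move=> W0 WP f; apply: (iffP idP) => [fW a b|f0]; first exact: W0.
rewrite (munit_expand f); apply: memv_suml => a _; apply: memv_suml => b _.
case: (boolP (P a b)) => [/WP abW|/f0 ->]; first exact: memvZ.
by rewrite scale0r mem0v.
Qed.

Lemma ent_sum_eq0 (I : eqType) (r : seq I) (P : pred I) (Us : I -> {vspace 'End(V)}) a b :
  (forall i f, i \in r -> P i -> f \in Us i -> ent f a b = 0) ->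
  forall f, f \in (\sum_(i <- r | P i) Us i)%VS -> ent f a b = 0.
Proof.
elim: r => [|i r IH] U0 f; first by rewrite big_nil memv0 => /eqP ->; rewrite /ent lfunE linear0.
have IHr f' : f' \in (\sum_(i <- r | P i) Us i)%VS -> ent f' a b = 0.
  by apply: IH => j h jr; apply: U0; rewrite inE jr orbT.
rewrite big_cons; case: ifP => Pi; last exact: IHr.
move=> /memv_addP[u uU [w wW ->]]; rewrite entD (U0 i) ?mem_head // IHr // addr0 //.
Qed.

Lemma munit_homV a b : munit e a b \in homV V (dg b) (dg a).
Proof.
apply/homVP => c d cd; rewrite ent_munit; case: eqP => [ca|//]; case: eqP => [db|//].
by rewrite ca db !eqxx in cd.
Qed.

Lemma sum_homV_P (P : int -> int -> bool) (f : 'End(V)) :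
  reflect (forall a b, ~~ P (dg b) (dg a) -> ent f a b = 0)
    (f \in (\sum_(i <- supp) \sum_(j <- supp | P i j) homV V i j)%VS).
Proof.
apply: (memv_entP (P := fun a b => P (dg b) (dg a))) => [h a b hW nP|a b Pab].
  apply: ent_sum_eq0 hW => i u _ _; apply: ent_sum_eq0 => j w _ Pij /homVP; apply.
  by apply: contra nP => /andP[/eqP-> /eqP->].
rewrite (bigD1_seq (dg b)) ?dg_supp ?gv_supp_uniq //= (subvP (addvSl _ _)) //.
rewrite -big_filter (bigD1_seq (dg a)) ?filter_uniq ?gv_supp_uniq //=.
  by rewrite (subvP (addvSl _ _)) // munit_homV.
by rewrite mem_filter Pab dg_supp.
Qed.

Lemma q_subP (f : 'End(V)) :
  reflect (forall a b, ~~ (dg b <= dg a) -> ent f a b = 0) (f \in q_sub V).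
Proof. exact: sum_homV_P. Qed.

Lemma n_subP (f : 'End(V)) :
  reflect (forall a b, ~~ (dg b < dg a) -> ent f a b = 0) (f \in n_sub V).
Proof. exact: sum_homV_P. Qed.

Lemma end_grP m (f : 'End(V)) :
  reflect (forall a b, dg a - dg b != m -> ent f a b = 0) (f \in end_gr V m).
Proof.
apply: (memv_entP (P := fun a b => dg a - dg b == m)) => [h a b hW nP|a b /eqP Pab].
  apply: ent_sum_eq0 hW => i u _ _ /homVP; apply.
  by apply: contra nP => /andP[/eqP-> /eqP->]; rewrite addrC addKr.
rewrite /end_gr (bigD1_seq (dg b)) ?dg_supp ?gv_supp_uniq //= (subvP (addvSl _ _)) //.
by rewrite -Pab addrC subrK munit_homV.
Qed.

Lemma l_subP (f : 'End(V)) :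
  reflect (forall a b, dg a != dg b -> ent f a b = 0) (f \in l_sub V).
Proof.
have -> : l_sub V = end_gr V 0 by apply: eq_bigr => i _; rewrite addr0.
by apply: (iffP (end_grP _ _)) => f0 a b ab; apply: f0; rewrite ?subr_eq0 // -subr_eq0.
Qed.

Lemma b_plusP (f : 'End(V)) :
  reflect (forall a b : 'I_n, ~~ (a <= b)%N -> ent f a b = 0) (f \in b_plus e).
Proof.
apply: (memv_entP (P := fun a b : 'I_n => (a <= b)%N)) => [h a b hW nP|a b Pab].
  apply: ent_sum_eq0 hW => i u _ _; apply: ent_sum_eq0 => j w _ Pij /vlineP[c ->].
  rewrite entZ ent_munit; case: eqP => [ai|]; rewrite ?mulr0 //.
  by case: eqP => [bj|]; rewrite ?mulr0 //; rewrite ai bj Pij in nP.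
rewrite /b_plus (bigD1 a) //= (subvP (addvSl _ _)) // (bigD1 b) //= (subvP (addvSl _ _)) //.
exact: memv_line.
Qed.

Lemma b_minusP (f : 'End(V)) :
  reflect (forall a b : 'I_n, ~~ (b <= a)%N -> ent f a b = 0) (f \in b_minus e).
Proof.
apply: (memv_entP (P := fun a b : 'I_n => (b <= a)%N)) => [h a b hW nP|a b Pab].
  apply: ent_sum_eq0 hW => i u _ _; apply: ent_sum_eq0 => j w _ Pij /vlineP[c ->].
  rewrite entZ ent_munit; case: eqP => [ai|]; rewrite ?mulr0 //.
  by case: eqP => [bj|]; rewrite ?mulr0 //; rewrite ai bj Pij in nP.
rewrite /b_minus (bigD1 a) //= (subvP (addvSl _ _)) // (bigD1 b) //= (subvP (addvSl _ _)) //.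
exact: memv_line.
Qed.

Lemma sum_pick (I : eqType) (r : seq I) (i0 : I) (F : I -> k) :
  uniq r -> i0 \in r -> \sum_(i <- r) (if i0 == i then F i else 0) = F i0.
Proof.
move=> ur ir; rewrite (bigD1_seq i0) //= eqxx big1 ?addr0 // => i.
by rewrite eq_sym => /negbTE ->.
Qed.

Lemma ent_end_comp m (f : 'End(V)) a b :
  ent (end_comp m f) a b = if dg a - dg b == m then ent f a b else 0.
Proof.
rewrite /end_comp ent_sum; under eq_bigr do rewrite ent_gproj.
transitivity (\sum_(i <- supp) (if dg b == i then if dg a - i == m then ent f a b else 0 else 0)).
  apply: eq_bigr => i _; case: (dg b == i); rewrite ?andbF // andbT.
  by rewrite subr_eq addrC.
by rewrite sum_pick ?gv_supp_uniq ?dg_supp.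
Qed.

Lemma end_degsP a b : dg a - dg b \in end_degs V.
Proof.
by rewrite mem_undup; apply/allpairsP; exists (dg b, dg a); rewrite !dg_supp.
Qed.

(** The entry (a, c) of an endomorphism lives in the single degree dg a - dg c, so for each c one
    pair of degrees survives in each half of the double sum. *)
Lemma ent_scomm (f h : 'End(V)) a b : ent (scomm f h) a b =
  \sum_c (ent f a c * ent h c b
           - sgn k ((dg a - dg c) * (dg c - dg b)) * (ent h a c * ent f c b)).
Proof.
rewrite /scomm ent_sum; under eq_bigr do rewrite ent_sum.
transitivity (\sum_(p <- end_degs V) \sum_(q <- end_degs V) \sum_c
   ((if dg a - dg c == p then if dg c - dg b == q then ent f a c * ent h c b else 0 else 0)
  - (if dg c - dg b == p then if dg a - dg c == q
       then sgn k ((dg a - dg c) * (dg c - dg b)) * (ent h a c * ent f c b) else 0 else 0))).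
  apply: eq_bigr => p _; apply: eq_bigr => q _.
  rewrite entD entN entZ !ent_comp mulr_sumr -sumrB; apply: eq_bigr => c _.
  rewrite !ent_end_comp; congr (_ - _); first by do 2!case: eqP => _; rewrite ?mulr0 ?mul0r.
  case: eqP => [<-|_]; case: eqP => [<-|_]; rewrite ?mul0r ?mulr0 //.
  by rewrite [(dg c - dg b) * _]mulrC.
under eq_bigr => p _ do rewrite exchange_big /=.
rewrite exchange_big /=; apply: eq_bigr => c _.
under eq_bigr => p _ do rewrite sumrB.
rewrite sumrB; congr (_ - _).
  under eq_bigr => p _.
    have -> : \sum_(q <- end_degs V) (if dg a - dg c == p then
        if dg c - dg b == q then ent f a c * ent h c b else 0 else 0)
      = if dg a - dg c == p then ent f a c * ent h c b else 0.
      case: eqP => _; last by rewrite big1.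
      by rewrite sum_pick ?undup_uniq ?end_degsP.
    over.
  by rewrite sum_pick ?undup_uniq ?end_degsP.
under eq_bigr => p _.
  have -> : \sum_(q <- end_degs V) (if dg c - dg b == p then if dg a - dg c == q then
      sgn k ((dg a - dg c) * (dg c - dg b)) * (ent h a c * ent f c b) else 0 else 0)
    = if dg c - dg b == p then
        sgn k ((dg a - dg c) * (dg c - dg b)) * (ent h a c * ent f c b) else 0.
    case: eqP => _; last by rewrite big1.
    by rewrite sum_pick ?undup_uniq ?end_degsP.
  over.
by rewrite sum_pick ?undup_uniq ?end_degsP.
Qed.

(** The trace is defined through [vbasis]; expanding in [e] and exchanging the sums is the change of
    basis. *)
Lemma lftraceE (f : 'End(V)) : lftrace f = \sum_a ent f a a.
Proof.
rewrite /lftrace; under eq_bigr => j _ do rewrite (e_expand (vbasis {:V})`_j) linear_sum linear_sum.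
rewrite exchange_big /=; apply: eq_bigr => a _.
have -> : ent f a a = coord e a (f e`_a) by [].
rewrite (coord_vbasis (memvf (f e`_a))) linear_sum /=; apply: eq_bigr => j _.
by rewrite !linearZ /= mulrC.
Qed.

Lemma strE (f : 'End(V)) : str f = \sum_a sgn k (dg a) * ent f a a.
Proof.
rewrite /str; transitivity (\sum_(i <- supp) \sum_a
    if dg a == i then sgn k i * ent f a a else 0).
  apply: eq_bigr => i _; rewrite lftraceE mulr_sumr; apply: eq_bigr => a _.
  have -> : ent (gproj V i \o f)%VF a a = if dg a == i then ent f a a else 0.
    rewrite [LHS]/ent comp_lfunE ent_e !linear_sum (bigD1 a) //= big1 => [|c ca].
      rewrite addr0 !linearZ /= gproj_e; case: eqP => _; last by rewrite linear0 mulr0.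
      by rewrite coord_free // eqxx mulr1.
    rewrite !linearZ /= gproj_e; case: eqP => _; rewrite ?linear0 ?mulr0 // coord_free //.
    by rewrite (negbTE ca) mulr0.
  by case: eqP; rewrite ?mulr0.
rewrite exchange_big /=; apply: eq_bigr => a _.
by rewrite sum_pick ?gv_supp_uniq ?dg_supp.
Qed.
End Entries.

Lemma extract_basis (k : fieldType) (W : vectType k) (s : seq W) :
  exists s', [/\ {subset s' <= s}, free s' & <<s'>>%VS = <<s>>%VS].
Proof.
elim: s => [|v s [s' [ss fs es]]]; first by exists [::]; rewrite nil_free.
have [vs|vs] := boolP (v \in <<s'>>%VS).
  exists s'; split=> // [u /ss|]; first by rewrite inE orbC => ->.
  by rewrite span_cons -es; apply/esym/addv_idPr; rewrite -memvE.
exists (v :: s'); split; last by rewrite !span_cons es.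
  by move=> u; rewrite !inE => /orP[->//|/ss ->]; rewrite orbT.
by rewrite free_cons vs.
Qed.

(** * Graded subspaces of End(V) and their duals *)

Section SubLie.
Variables (k : fieldType) (V : gvect k) (n : nat) (e : n.-tuple V) (dg : 'I_n -> int).
Hypothesis e_basis : basis_of fullv e.
Hypothesis e_deg : forall a : 'I_n, e`_a \in gv_gr V (dg a).
Local Notation ent := (ent e).

Lemma end_comp_sum (f : 'End(V)) : f = \sum_(m <- end_degs V) end_comp m f.
Proof.
apply: (entP e_basis) => a b; rewrite ent_sum.
under eq_bigr do rewrite (ent_end_comp e_basis e_deg).
by rewrite sum_pick ?undup_uniq ?(end_degsP e_basis e_deg).
Qed.

Lemma end_comp_gr m (f : 'End(V)) : end_comp m f \in end_gr V m.
Proof.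
apply/(end_grP e_basis e_deg) => a b /negbTE abm.
by rewrite (ent_end_comp e_basis e_deg) abm.
Qed.

Fact end_comp_linear m : linear (@end_comp k V m).
Proof.
move=> c f h; apply: (entP e_basis) => a b.
rewrite entD entZ !(ent_end_comp e_basis e_deg) entD entZ.
by case: ifP; rewrite ?mulr0 ?addr0.
Qed.

Lemma end_comp_id m (f : 'End(V)) : f \in end_gr V m -> end_comp m f = f.
Proof.
move=> /(end_grP e_basis e_deg) f0; apply: (entP e_basis) => a b.
by rewrite (ent_end_comp e_basis e_deg); case: ifPn => // /f0.
Qed.

Lemma end_comp_neq m j (f : 'End(V)) : f \in end_gr V j -> j != m -> end_comp m f = 0.
Proof.
move=> /(end_grP e_basis e_deg) f0 jm; apply: (entP e_basis) => a b.
rewrite (ent_end_comp e_basis e_deg) [RHS]/(ent _ _ _) lfunE linear0.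
by case: eqP => // abm; rewrite f0 // abm eq_sym.
Qed.

Lemma scomm_gr p q (f h : 'End(V)) :
  f \in end_gr V p -> h \in end_gr V q -> scomm f h \in end_gr V (p + q).
Proof.
move=> /(end_grP e_basis e_deg) f0 /(end_grP e_basis e_deg) h0.
apply/(end_grP e_basis e_deg) => a b abpq; rewrite (ent_scomm e_basis e_deg).
rewrite big1 // => c _.
have [ac|ac] := eqVneq (dg a - dg c) p.
  rewrite (h0 c b); last by apply: contra abpq => /eqP <-; rewrite -ac; apply/eqP; ring.
  rewrite mulr0 sub0r; have [cb|cb] := eqVneq (dg c - dg b) p.
    rewrite (h0 a c) ?mul0r ?mulr0 ?oppr0 //.
    by apply: contra abpq => /eqP <-; rewrite -cb; apply/eqP; ring.
  by rewrite (f0 c b) // !mulr0 oppr0.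
rewrite (f0 a c) // mul0r sub0r; have [cb|cb] := eqVneq (dg c - dg b) p.
  rewrite (h0 a c) ?mul0r ?mulr0 ?oppr0 //.
  by apply: contra abpq => /eqP <-; rewrite -cb; apply/eqP; ring.
by rewrite (f0 c b) // !mulr0 oppr0.
Qed.

Definition sg (a b : 'I_n) : k := sgn k (dg a * dg b).

(* The dual matrix units, with a sign that makes d x_ab = +-sum x_ac x_cb. *)
Definition xi (a b : 'I_n) : dual k 'End(V) :=
  linfun (fun f : 'End(V) => sg a b * ent f a b : k^o).

Lemma xiE a b f : xi a b f = sg a b * ent f a b.
Proof.
apply: (linfunE (f := fun f => _ : k^o)) => c u w.
by rewrite entD entZ /GRing.scale /=; ring.
Qed.

Lemma dual_expand (z : dual k 'End(V)) :
  z = \sum_a \sum_b (sg a b * z (munit e a b)) *: xi a b.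
Proof.
apply/lfunP => f; rewrite {1}(munit_expand e_basis f) !linear_sum sum_lfunE /=.
apply: eq_bigr => a _; rewrite linear_sum sum_lfunE; apply: eq_bigr => b _.
rewrite linearZ scale_lfunE xiE /= /GRing.scale /= mulrCA mulrA mulrA.
by rewrite [sg a b * sg a b]sgn_sgn mul1r mulrC.
Qed.

Section Subspace.
Variable U : {vspace 'End(V)}.
Local Notation L := (sub_gLie U).

Lemma gl_grE j (x : L) : (x \in gl_gr L j) = (vsval x \in end_gr V j).
Proof. by rewrite /= -memv_preim lfunE. Qed.

Lemma dual_res_endE (z : dual k 'End(V)) (x : L) : dual_res_end U z x = z (vsval x).
Proof.
apply: (linfunE (f := fun x : subvs_of U => z (vsval x) : k^o)) => c u w.
by rewrite !linearP.
Qed.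

Fact dual_res_end_linear : linear (@dual_res_end k V U).
Proof.
move=> c z z'; apply/lfunP => x; rewrite add_lfunE scale_lfunE !dual_res_endE.
by rewrite add_lfunE scale_lfunE.
Qed.

(** Dependent in general: on q_1 those outside q vanish, and the diagonal ones add up to the
    supertrace, hence to 0. They serve for computing, not as free generators. *)
Definition Uxi (a b : 'I_n) : dual k L := dual_res_end U (xi a b).

Lemma UxiE a b (x : L) : Uxi a b x = sg a b * ent (vsval x) a b.
Proof. by rewrite dual_res_endE xiE. Qed.

Lemma Uxi_deg a b : dual_deg (dg b - dg a) (Uxi a b).
Proof.
move=> j x; rewrite gl_grE => /(end_grP e_basis e_deg) x0 jm.
by rewrite UxiE x0 ?mulr0 // eq_sym; apply: contra jm => /eqP ->; rewrite opprB.
Qed.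

Hypothesis U_gr : forall m f, f \in U -> end_comp m f \in U.

(** [vsproj] is a projection onto U that need not respect degrees; cutting down to degree -m first
    makes the extension homogeneous of degree m. *)
Definition hext (m : int) (z : dual k L) : dual k 'End(V) :=
  linfun (fun f : 'End(V) => z (vsproj U (end_comp (- m) f)) : k^o).

Lemma hextE m z f : hext m z f = z (vsproj U (end_comp (- m) f)).
Proof.
apply: (linfunE (f := fun f => _ : k^o)) => c u w.
by rewrite end_comp_linear !linearP.
Qed.

Lemma vsproj_comp m (x : L) : vsval (vsproj U (end_comp m (vsval x))) = end_comp m (vsval x).
Proof. by rewrite vsprojK // U_gr // subvsP. Qed.

Lemma comp_sum (x : L) : x = \sum_(j <- end_degs V) vsproj U (end_comp j (vsval x)) :> L.
Proof.
apply: val_inj; rewrite [LHS](end_comp_sum (vsval x)).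
rewrite [RHS](linear_sum (vsval : {linear subvs_of U -> _})).
by apply: eq_bigr => j _; apply/esym/vsproj_comp.
Qed.

Lemma hext_res m z : dual_deg m z -> dual_res_end U (hext m z) = z.
Proof.
move=> mz; apply/lfunP => x; rewrite dual_res_endE hextE.
rewrite {2}(comp_sum x).
have z0 j : j != - m -> z (vsproj U (end_comp j (vsval x))) = 0.
  by move=> jm; apply: mz jm; rewrite gl_grE vsproj_comp end_comp_gr.
rewrite [RHS]linear_sum; have [mV|mV] := boolP (- m \in end_degs V).
  by rewrite (bigD1_seq (- m)) ?undup_uniq //= big1 ?addr0 // => j /z0.
rewrite [RHS]big_seq [RHS]big1 => [|j jV]; last first.
  by apply: z0; apply: contraNneq mV => <-.
have -> : end_comp (- m) (vsval x) = 0; last by rewrite !linear0.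
apply: (entP e_basis) => a b; rewrite (ent_end_comp e_basis e_deg) [RHS]/(ent _ _ _) lfunE linear0.
by case: eqP => // abm; rewrite -abm (end_degsP e_basis e_deg) in mV.
Qed.

Lemma hexpand m z : dual_deg m z -> exists c : 'I_n -> 'I_n -> k,
  (forall a b, dg b - dg a != m -> c a b = 0) /\ z = \sum_a \sum_b c a b *: Uxi a b.
Proof.
move=> mz; exists (fun a b => sg a b * hext m z (munit e a b)); split=> [a b abm|].
  rewrite hextE (@end_comp_neq _ (dg a - dg b)) ?linear0 ?mulr0 //.
    apply/(end_grP e_basis e_deg) => c d cd; rewrite (ent_munit e_basis).
    case: eqP => // ca; case: eqP => // db.
    by rewrite ca db eqxx in cd.
  by apply: contra abm => /eqP E; rewrite -[m]opprK -E opprB.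
rewrite -{1}(hext_res mz) [X in dual_res_end U X](dual_expand (hext m z)).
have [R RE] := linear_of dual_res_end_linear.
rewrite -RE linear_sum; apply: eq_bigr => a _; rewrite linear_sum; apply: eq_bigr => b _.
by rewrite [LHS]linearZ /= RE.
Qed.

(** The supertrace condition in general rules out a basis of q_1 by matrix units, so the homogeneous
    components of an arbitrary basis are thinned out to a basis. *)
Lemma graded_basis : exists N (f : N.-tuple L) (m : 'I_N -> int),
  basis_of fullv f /\ forall i : 'I_N, f`_i \in gl_gr L (m i).
Proof.
pose F := [seq vsproj U (end_comp j (vsval x)) | j <- end_degs V, x <- vbasis {:L}].
have [s [sF fs es]] := extract_basis F.
have s_hom (i : 'I_(size s)) : exists j, s`_i \in gl_gr L j.
  have /sF/allpairsP[[j x] /= [_ _ ->]] : s`_i \in s by apply: mem_nth.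
  by exists j; rewrite gl_grE vsproj_comp end_comp_gr.
pose m i := sval (constructive_indefinite_description _ (s_hom i)).
exists (size s), (in_tuple s), m; split=> [|i]; last first.
  exact: (svalP (constructive_indefinite_description _ (s_hom i))).
rewrite /basis_of es fs andbT eqEsubv subvf -(span_basis (vbasisP {:L})).
apply/span_subvP => x xb; rewrite (comp_sum x) big_seq; apply: memv_suml => j jV.
by apply: memv_span; apply/allpairsP; exists (j, x).
Qed.
End Subspace.
End SubLie.

(** The condition on generators in [CE], detached from the record so that it applies to a
    differential under construction and to the copy of the dual of l_1 inside C(q_1, k). *)
Definition ce_dif_spec (k : fieldType) (L : gLie k) (C : gcAlg k) (d : C -> C)
    (gen : dual k L -> C) : Prop :=
  forall (xi : dual k L) (r : nat) (p q : 'I_r -> int) (eta zeta : 'I_r -> dual k L),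
    (forall s, dual_deg (p s) (eta s)) -> (forall s, dual_deg (q s) (zeta s)) ->
    (forall x y, xi (gl_br x y) = \sum_s eta s x * zeta s y) ->
    d (gen xi) = - 2%:R^-1 *: \sum_s sgn k (p s * (1 + q s)) *: (gen (eta s) * gen (zeta s)).

Lemma ce_dif_spec_fin (k : fieldType) (L : gLie k) (C : gcAlg k) (d : C -> C)
    (gen : dual k L -> C) : ce_dif_spec d gen ->
  forall (I : finType) (xi : dual k L) (p q : I -> int) (eta zeta : I -> dual k L),
    (forall s, dual_deg (p s) (eta s)) -> (forall s, dual_deg (q s) (zeta s)) ->
    (forall x y, xi (gl_br x y) = \sum_s eta s x * zeta s y) ->
    d (gen xi) = - 2%:R^-1 *: \sum_s sgn k (p s * (1 + q s)) *: (gen (eta s) * gen (zeta s)).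
Proof.
move=> dP I xi p q eta zeta pE qZ xiE.
rewrite (dP xi #|I| (p \o enum_val) (q \o enum_val) (eta \o enum_val) (zeta \o enum_val)).
- by congr (_ *: _); rewrite [RHS]big_enum_val.
- by move=> s; apply: pE.
- by move=> s; apply: qZ.
by move=> x y; rewrite xiE [LHS]big_enum_val.
Qed.

Lemma ce_dif_coef_fin (k : fieldType) (L : gLie k) (A : dgcAlg k) (act : L -> A -> A)
    (Q : CE act) (I : finType) (a : A) (eta : I -> dual k L) (b : I -> A) :
  (forall x, act x a = \sum_s (eta s x : k) *: b s) ->
  dif (ce_coef Q a) = ce_coef Q (dif a) + \sum_s ce_gen Q (eta s) * ce_coef Q (b s).
Proof.
move=> aE; rewrite (ce_dif_coef Q (eta := eta \o @enum_val I predT) (b := b \o enum_val)).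
  by congr (_ + _); rewrite [RHS]big_enum_val.
by move=> x; rewrite aE [LHS]big_enum_val.
Qed.

(** * The differential on dual matrix units *)

Section DifW.
Variables (k : fieldType) (V : gvect k) (n : nat) (e : n.-tuple V) (dg : 'I_n -> int).
Hypothesis e_basis : basis_of fullv e.
Hypothesis e_deg : forall a : 'I_n, e`_a \in gv_gr V (dg a).
Hypothesis k2 : 2%:R != 0 :> k.
Local Notation ent := (ent e).
Variable U : {vspace 'End(V)}.
Hypothesis U_gr : forall m f, f \in U -> end_comp m f \in U.
Hypothesis U_br : forall f h, f \in U -> h \in U -> scomm f h \in U.
Local Notation L := (sub_gLie U).
Local Notation Uxi := (Uxi e dg U).
Local Notation sg := (sg k dg).

Lemma dual_degZ m c (z : dual k L) : dual_deg m z -> dual_deg m (c *: z).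
Proof. by move=> mz j x xj jm; rewrite scale_lfunE (mz j) ?scaler0. Qed.

Section Alg.
Variables (C : gcAlg k) (d : C -> C) (gen : {linear dual k L -> C}).
Hypothesis gen_deg : forall m z, dual_deg m z -> hdeg (m + 1) (gen z).
Hypothesis d_gen : ce_dif_spec d gen.
Local Notation w a b := (gen (Uxi a b)).

Lemma w_deg a b : hdeg (1 + dg b - dg a) (w a b).
Proof. by apply: hdeg_cast (gen_deg (Uxi_deg e_basis e_deg (U:=U) (a:=a) (b:=b))) _; ring. Qed.

(** The two halves of the super-commutator contribute equally once the generators are reordered,
    which cancels the factor 1/2; the signs in [xi] absorb everything that depends on b and c. *)
Lemma dif_w a b : d (w a b) = - sgn k (dg a) *: \sum_c w a c * w c b.
Proof.
pose kap c := sg a b * sg a c * sg c b.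
pose eta (s : 'I_n + 'I_n) : dual k L := match s with
  | inl c => kap c *: Uxi a c
  | inr c => (- kap c * sgn k ((dg a - dg c) * (dg c - dg b))) *: Uxi c b end.
pose zeta (s : 'I_n + 'I_n) : dual k L := match s with
  | inl c => Uxi c b | inr c => Uxi a c end.
pose p (s : 'I_n + 'I_n) := match s with
  | inl c => dg c - dg a | inr c => dg b - dg c end.
pose q (s : 'I_n + 'I_n) := match s with
  | inl c => dg b - dg c | inr c => dg c - dg a end.
rewrite (ce_dif_spec_fin d_gen (I := ('I_n + 'I_n)%type) (p := p) (q := q) (eta := eta) (zeta := zeta)).
- rewrite big_sumType /= -big_split scaler_sumr scaler_sumr; apply: eq_bigr => c _ /=.
  rewrite !linearZ /= -!scalerAl (gc_mulC (w_deg c b) (w_deg a c)) /kap /sg.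
  by signs; lmod_coefs k; field.
- by move=> [c|c] /=; apply: dual_degZ; apply: Uxi_deg.
- by move=> [c|c] /=; apply: Uxi_deg.
move=> x y; rewrite UxiE /= vsprojK ?U_br ?subvsP // (ent_scomm e_basis e_deg).
rewrite mulr_sumr big_sumType /= -big_split; apply: eq_bigr => c _ /=.
rewrite !scale_lfunE !UxiE /kap /sg /GRing.scale /=.
have := sgn_sgn k (dg a * dg c); have := sgn_sgn k (dg c * dg b).
by signs; move=> _ _; ring.
Qed.
End Alg.

Lemma ce_gen_expand (Q : CE_trivial L) m z : dual_deg m z -> exists c : 'I_n -> 'I_n -> k,
  (forall a b, dg b - dg a != m -> c a b = 0) /\
  ce_gen Q z = \sum_a \sum_b c a b *: ce_gen Q (Uxi a b).
Proof.
move=> /(hexpand e_basis e_deg U_gr)[c [c0 ->]]; exists c; split=> //.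
rewrite linear_sum; apply: eq_bigr => a _; rewrite linear_sum; apply: eq_bigr => b _.
by rewrite linearZ.
Qed.

Section Basis.
Variables (N : nat) (f : N.-tuple L) (m : 'I_N -> int).
Hypothesis f_basis : basis_of fullv f.
Hypothesis f_hom : forall i : 'I_N, f`_i \in gl_gr L (m i).

Definition dualb (i : 'I_N) : dual k L := linfun (fun x : L => coord f i x : k^o).

Lemma dualbE i x : dualb i x = coord f i x.
Proof. by apply: (linfunE (f := fun x : L => coord f i x : k^o)) => c u v; rewrite linearP. Qed.

Lemma dualb_f i (j : 'I_N) : dualb i f`_j = (i == j)%:R.
Proof. by rewrite dualbE coord_free ?(basis_free f_basis) // eq_sym. Qed.

Lemma dualb_expand (z : dual k L) : z = \sum_(i < N) z f`_i *: dualb i.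
Proof.
apply/lfunP => x; rewrite {1}(coord_basis f_basis (memvf x)) linear_sum sum_lfunE.
by apply: eq_bigr => i _; rewrite linearZ scale_lfunE dualbE /GRing.scale /= mulrC.
Qed.

Lemma dualb_deg i : dual_deg (- m i) (dualb i).
Proof.
move=> j x xj; rewrite opprK dualbE => ji.
pose pj (y : L) : L := vsproj U (end_comp j (vsval y)).
have pl : linear pj.
  by move=> c u v; rewrite /pj linearP (end_comp_linear e_basis e_deg) linearP.
have [P PE] := linear_of pl.
have -> : x = P x.
  rewrite PE; apply: val_inj; rewrite [RHS]vsproj_comp //.
  by rewrite (end_comp_id e_basis e_deg) // -gl_grE.
rewrite {1}(coord_basis f_basis (memvf x)) !linear_sum big1 // => l _.
rewrite !linearZ /= PE /pj; have := f_hom l; rewrite gl_grE => fl.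
have [lj|lj] := eqVneq (m l) j.
  rewrite (end_comp_id e_basis e_deg) -?lj // vsvalK coord_free ?(basis_free f_basis) //.
  by case: eqP => [li|]; rewrite ?mulr0 // -lj li eqxx in ji *.
by rewrite (end_comp_neq e_basis e_deg fl lj) !linear0 mulr0.
Qed.

Lemma dual_deg_f p z (i : 'I_N) : dual_deg p z -> z f`_i != 0 -> - m i = p.
Proof.
move=> pz zi; apply/eqP; apply: contraNT zi => mp; apply/eqP/(pz (m i)) => //.
by apply: contra mp => /eqP ->; rewrite opprK.
Qed.

(** Puts the coordinate-free universal property into coordinates, which gives access to derivations
    and brackets defined on generators. *)
Lemma ce_free_on (Q : CE_trivial L) : free_on (fun i => 1 - m i) (fun i => ce_gen Q (dualb i)).
Proof.
split=> [i|B b b_deg].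
  by apply: hdeg_cast (ce_gen_deg Q (dualb_deg (i:=i))) _; ring.
have fl : linear (fun z : dual k L => \sum_(i < N) z f`_i *: b i).
  move=> c u v; rewrite scaler_sumr -big_split; apply: eq_bigr => i _ /=.
  by rewrite add_lfunE scale_lfunE scalerDl scalerA.
have [h hE] := linear_of fl.
have h_deg p z : dual_deg p z -> hdeg (p + 1) (h z).
  move=> pz; rewrite hE; apply: hdeg_sum => i _.
  have [->|zi] := eqVneq (z f`_i) 0; first by rewrite scale0r; apply: hdeg0.
  by apply/hdegZ; apply: hdeg_cast (b_deg i) _; rewrite -(dual_deg_f pz zi) addrC.
have [F [F_gr _ Fg F_uniq]] := ce_free Q (@ground_alg_gpres k B) h_deg.
exists F; split=> // [i|F' F'_gr F'x].
  rewrite Fg hE (bigD1 i) //= big1 => [|j ji]; rewrite dualb_f ?eqxx ?scale1r ?addr0 //.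
  by rewrite eq_sym (negbTE ji) scale0r.
apply: F_uniq => // [c|z].
  have [G GE] := lrmorph_comp F' (ce_coef Q).
  by transitivity (G c); [apply/esym/GE|apply: (lrmorph_ground G)].
rewrite hE {1}(dualb_expand z) !linear_sum; apply: eq_bigr => i _.
by rewrite !linearZ /= F'x.
Qed.
End Basis.
End DifW.

(** * Chevalley-Eilenberg algebras *)

Section CEExistence.
Variables (k : fieldType) (V : gvect k) (n : nat) (e : n.-tuple V) (dg : 'I_n -> int).
Hypothesis e_basis : basis_of fullv e.
Hypothesis e_deg : forall a : 'I_n, e`_a \in gv_gr V (dg a).
Hypothesis k2 : 2%:R != 0 :> k.
Variable U : {vspace 'End(V)}.
Hypothesis U_gr : forall m f, f \in U -> end_comp m f \in U.
Hypothesis U_br : forall f h, f \in U -> h \in U -> scomm f h \in U.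
Local Notation L := (sub_gLie U).
Local Notation Uxi := (Uxi e dg U).

(** Here d^2 = 0 is associativity of the matrix product: both triple sums run over x_ap x_pc x_cb,
    with opposite signs. *)
Lemma dif_dif_w (C : gcAlg k) (d : {linear C -> C}) (gen : {linear dual k L -> C}) a b :
  (forall m z, dual_deg m z -> hdeg (m + 1) (gen z)) -> ce_dif_spec d gen -> is_der 1 d ->
  d (d (gen (Uxi a b))) = 0.
Proof.
move=> gen_deg d_gen [_ d_l].
have dw a' b' := dif_w e_basis e_deg k2 U_br gen_deg d_gen a' b'.
have wd a' b' := w_deg e_basis e_deg (U := U) gen_deg a' b'.
rewrite dw linearZ linear_sum /=.
under eq_bigr => c _ do rewrite (d_l _ _ _ (wd a c)) !dw /= -scalerAl -scalerAr
  mulr_suml mulr_sumr scalerA.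
rewrite big_split /= [X in _ *: (X + _)](_ : _ = - sgn k (dg a) *:
    \sum_c \sum_p gen (Uxi a p) * gen (Uxi p c) * gen (Uxi c b)); last first.
  by rewrite scaler_sumr.
rewrite [X in _ *: (_ + X)](_ : _ = sgn k (dg a) *:
    \sum_c \sum_p gen (Uxi a p) * gen (Uxi p c) * gen (Uxi c b)); last first.
  rewrite [in RHS]exchange_big scaler_sumr /=; apply: eq_bigr => c _.
  under [in RHS]eq_bigr do rewrite -mulrA.
  by congr (_ *: _); signs; ring.
by signs; lmod k.
Qed.

Lemma ce_exists : inhabited (CE_trivial L).
Proof.
have [N [f [m [f_basis f_hom]]]] := graded_basis e_basis e_deg U_gr.
have [C [x Cx]] := free_exists (fun i => 1 - m i) k2.
have [x_deg x_univ] := Cx.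
have X_deg i : dual_deg (- m i) (dualb f i).
  exact: (dualb_deg e_basis e_deg U_gr f_basis f_hom).
have fl : linear (fun z : dual k L => \sum_(i < N) z f`_i *: x i).
  move=> c u v; rewrite scaler_sumr -big_split; apply: eq_bigr => i _ /=.
  by rewrite add_lfunE scale_lfunE scalerDl scalerA.
have [gen genE] := linear_of fl.
have gen_deg p z : dual_deg p z -> hdeg (p + 1) (gen z).
  move=> pz; rewrite genE; apply: hdeg_sum => i _.
  have [->|zi] := eqVneq (z f`_i) 0; first by rewrite scale0r; apply: hdeg0.
  by apply/hdegZ; apply: hdeg_cast (x_deg i) _; rewrite -(dual_deg_f f_hom pz zi) addrC.
have gen_X i : gen (dualb f i) = x i.
  rewrite genE (bigD1 i) //= big1 => [|j ji]; rewrite dualb_f // ?eqxx ?scale1r ?addr0 //.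
  by rewrite eq_sym (negbTE ji) scale0r.
(* The Chevalley-Eilenberg formula for the decomposition of z([x, y]) along the basis [f]. It is
   linear in z, so it describes d on every functional once d is prescribed on the dual basis. *)
pose th (z : dual k L) := - 2%:R^-1 *: \sum_(j < N) \sum_(l < N)
  (z (gl_br f`_j f`_l) : k) *: (sgn k (- m j * (1 - m l)) *: (x j * x l)).
have th_deg i : hdeg (1 - m i + 1) (th (dualb f i)).
  apply/hdegZ/hdeg_sum => j _; apply: hdeg_sum => l _.
  have [->|zi] := eqVneq (dualb f i (gl_br f`_j f`_l)) 0.
    by rewrite scale0r; apply: hdeg0.
  do 2!apply: hdegZ; apply: hdegM_cast (x_deg j) (x_deg l) _.
  suff -> : m i = m j + m l by ring.
  apply/eqP; rewrite eq_sym; apply: contraNT zi => mi.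
  rewrite (X_deg i (m j + m l)) ?opprK // gl_grE vsprojK ?U_br ?subvsP //.
  by apply: (scomm_gr e_basis e_deg); rewrite -gl_grE.
have [d [d_der dx]] := der_exists Cx th_deg.
have thl : linear th.
  move=> c u v; rewrite /th scalerA mulrC -scalerA -scalerDr; congr (_ *: _).
  rewrite scaler_sumr -big_split; apply: eq_bigr => j _; rewrite scaler_sumr -big_split.
  apply: eq_bigr => l _ /=; rewrite add_lfunE scale_lfunE scalerDl !scalerA.
  by rewrite /GRing.scale /= mulrA.
have dgen z : d (gen z) = th z.
  have [T TE] := linear_of thl; rewrite -TE.
  rewrite (dualb_expand f_basis z) !linear_sum; apply: eq_bigr => i _.
  by rewrite !linearZ /= gen_X dx TE.
have d_spec : ce_dif_spec d gen.
  move=> z r p q eta zeta pE qZ zE; rewrite dgen; congr (_ *: _).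
  under eq_bigr => j _ do (under eq_bigr => l _ do rewrite zE scaler_suml).
  under [RHS]eq_bigr => s _ do rewrite !genE mulr_suml scaler_sumr.
  rewrite [RHS]exchange_big; apply: eq_bigr => j _ /=.
  under [RHS]eq_bigr => s _ do rewrite mulr_sumr scaler_sumr.
  rewrite [RHS]exchange_big; apply: eq_bigr => l _ /=; apply: eq_bigr => s _.
  rewrite -scalerAl -scalerAr !scalerA.
  have [->|ej] := eqVneq (eta s f`_j) 0; first by rewrite !(mul0r, mulr0).
  have [->|zl] := eqVneq (zeta s f`_l) 0; first by rewrite !(mul0r, mulr0).
  rewrite (dual_deg_f f_hom (pE s) ej) (dual_deg_f f_hom (qZ s) zl).
  by congr (_ *: _); ring.
have [d_r d_l] := d_der.
(* d is odd, so its graded commutator with itself is 2 d^2, a derivation, and vanishing on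
   generators is enough. *)
have dd y : d (d y) = 0.
  have sq_l : linear (fun y => d (d y) - sgn k (1 * 1) *: d (d y)).
    by move=> c u v; rewrite !linearP /=; lmod k.
  have [sq sqE] := linear_of sq_l.
  have sq_der : is_der (1 + 1) sq.
    have [h1 h2] := der_comm d_der d_der.
    by split=> [q u|q u v] qu; rewrite !sqE; [apply: h1|apply: h2].
  have z_der : is_der (1 + 1) (\0 : {linear C -> C}).
    by split=> [q u _|q u v _] /=; rewrite ?mul0r ?mulr0 ?scaler0 ?addr0 //; apply: hdeg0.
  have sq0 i : sq (x i) = (\0 : {linear C -> C}) (x i).
    rewrite sqE -gen_X /=; suff -> : d (d (gen (dualb f i))) = 0 by rewrite scaler0 subr0.
    have [c [_ ->]] := hexpand e_basis e_deg U_gr (X_deg i).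
    rewrite !linear_sum big1 // => a _; rewrite !linear_sum big1 // => b _.
    by rewrite !linearZ /= dif_dif_w // scaler0.
  have := der_eq Cx sq_der z_der sq0 y; rewrite sqE /= mul1r => /eqP.
  have -> : sgn k 1 = -1 by [].
  rewrite scaleN1r opprK -mulr2n -scaler_nat scaler_eq0 (negbTE k2) /=.
  by move/eqP.
have dM p y z : hdeg p y -> d (y * z) = d y * z + sgn k p *: (y * d z).
  by move=> py; rewrite (d_l _ _ _ py) mul1r.
pose D := DgcAlg d_r dd dM.
constructor; refine (@MkCE k L (ground k) (fun _ _ => 0) D (ground_alg C) gen _ _ _ _ _) => //.
- exact: ground_alg_gpres.
- move=> B a F a_gr F_deg.
  have [|G [G_gr Gx G_uniq]] := x_univ B (fun i => F (dualb f i)).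
    by move=> i; apply: hdeg_cast (F_deg _ _ (X_deg i)) _; ring.
  exists G; split=> // [c|z|G' G'_gr G'a G'F].
  - by transitivity (c%:A : B); [apply: (rmorph_alg G)|apply/esym/(lrmorph_ground a)].
  - rewrite (dualb_expand f_basis z) !linear_sum; apply: eq_bigr => i _.
    by rewrite !linearZ /= gen_X Gx.
  by apply: G_uniq => // i; rewrite -gen_X G'F.
(* The action is trivial, so the functionals [eta s] weighted by the scalars [b s] add up to 0, and
   with them the correction term. *)
move=> a r eta b aE; rewrite [LHS]linearZ /=.
have /= -> : d 1 = 0 by apply: (@leibniz1 _ C C id 1).
rewrite scaler0 scale0r add0r.
have E s : gen (eta s) * ground_alg C (b s) = gen ((b s : k) *: eta s).
  by rewrite /= -scalerAr mulr1 linearZ.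
under eq_bigr => s _ do rewrite E.
rewrite -linear_sum [X in gen X](_ : _ = 0) ?linear0 //.
apply/lfunP => y; rewrite sum_lfunE lfunE [RHS](aE y).
by apply: eq_bigr => s _; rewrite scale_lfunE /GRing.scale /= mulrC.
Qed.

End CEExistence.

(** * The standard cobracket *)

Section Cobracket.
Variables (k : fieldType) (V : gvect k) (n : nat) (e : n.-tuple V) (dg : 'I_n -> int).
Hypothesis e_basis : basis_of fullv e.
Hypothesis e_deg : forall a : 'I_n, e`_a \in gv_gr V (dg a).
Hypothesis k2 : 2%:R != 0 :> k.
Local Notation ent := (ent e).
Local Notation sg := (sg k dg).
Local Notation xi := (xi e dg).
Local Notation h := (2%:R^-1 : k).
Local Notation s a := (sgn k (dg a)).

Let hh : h + h = 1. Proof. by field. Qed.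

Lemma scommE p q (f u : 'End(V)) : f \in end_gr V p -> u \in end_gr V q ->
  scomm f u = (f \o u)%VF - sgn k (p * q) *: (u \o f)%VF.
Proof.
move=> /(end_grP e_basis e_deg) f0 /(end_grP e_basis e_deg) u0; apply: (entP e_basis) => a b.
rewrite (ent_scomm e_basis e_deg) entD entN entZ !(ent_comp e_basis) mulr_sumr -sumrB.
apply: eq_bigr => c _; congr (_ - _).
have [ac|/u0 ->] := eqVneq (dg a - dg c) q; last by rewrite mul0r !mulr0.
have [cb|/f0 ->] := eqVneq (dg c - dg b) p; last by rewrite !mulr0.
by rewrite ac cb mulrC [q * p]mulrC mulrC.
Qed.

Lemma scomm_jacobi p q r (f u v : 'End(V)) :
  f \in end_gr V p -> u \in end_gr V q -> v \in end_gr V r ->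
  scomm f (scomm u v) = scomm (scomm f u) v + sgn k (p * q) *: scomm u (scomm f v).
Proof.
move=> fp uq vr; have gr := scomm_gr e_basis e_deg.
rewrite (scommE fp (gr _ _ _ _ uq vr)) (scommE (gr _ _ _ _ fp uq) vr).
rewrite (scommE uq (gr _ _ _ _ fp vr)) (scommE uq vr) (scommE fp vr) (scommE fp uq).
rewrite !(comp_lfunDl, comp_lfunDr, comp_lfunNl, comp_lfunNr) -!(comp_lfunZl, comp_lfunZr).
rewrite !comp_lfunA.
by signs; lmod k.
Qed.

Lemma scomm_anti p q (f u : 'End(V)) : f \in end_gr V p -> u \in end_gr V q ->
  scomm f u = - sgn k (p * q) *: scomm u f.
Proof. by move=> fp uq; rewrite (scommE fp uq) (scommE uq fp); signs; lmod k. Qed.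

Lemma scommZ c c' (f u : 'End(V)) : scomm (c *: f) (c' *: u) = (c * c') *: scomm f u.
Proof.
apply: (entP e_basis) => a b; rewrite entZ !(ent_scomm e_basis e_deg) mulr_sumr.
by apply: eq_bigr => i _; rewrite !entZ; ring.
Qed.

Lemma scommPl c (f f' u : 'End(V)) : scomm (c *: f + f') u = c *: scomm f u + scomm f' u.
Proof.
apply: (entP e_basis) => a b; rewrite entD entZ !(ent_scomm e_basis e_deg) mulr_sumr -big_split.
by apply: eq_bigr => i _; rewrite !entD !entZ /=; ring.
Qed.

Lemma scommPr c (f u u' : 'End(V)) : scomm f (c *: u + u') = c *: scomm f u + scomm f u'.
Proof.
apply: (entP e_basis) => a b; rewrite entD entZ !(ent_scomm e_basis e_deg) mulr_sumr -big_split.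
by apply: eq_bigr => i _; rewrite !entD !entZ /=; ring.
Qed.

Lemma sum_delta (W : lmodType k) (i : 'I_n) (F : 'I_n -> W) :
  \sum_j (j == i)%:R *: F j = F i.
Proof.
rewrite (bigD1 i) //= eqxx scale1r big1 ?addr0 // => j /negbTE ->.
by rewrite scale0r.
Qed.

Lemma sum_deltaM (i : 'I_n) (F : 'I_n -> k) : \sum_j (j == i)%:R * F j = F i.
Proof. exact: (sum_delta i (F : 'I_n -> k^o)). Qed.

Lemma scomm_munit a b c d : scomm (munit e b a) (munit e d c)
  = (a == d)%:R *: munit e b c
    - (sgn k ((dg b - dg a) * (dg d - dg c)) * (c == b)%:R) *: munit e d a.
Proof.
apply: (entP e_basis) => p q; rewrite entD entN !entZ (ent_scomm e_basis e_deg) sumrB.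
rewrite !(ent_munit e_basis); congr (_ - _).
  rewrite -(sum_deltaM a (fun r => (r == d)%:R * ((p == b) && (q == c))%:R)).
  apply: eq_bigr => r _; rewrite !(ent_munit e_basis).
  by case: (p == b); case: (q == c); case: (r == a); case: (r == d); rewrite /= ?(mulr0, mul0r, mulr1, mul1r).
rewrite -[RHS](sum_deltaM c (fun r => (sgn k ((dg b - dg a) * (dg d - dg c)) *
  (r == b)%:R) * ((p == d) && (q == a))%:R)).
apply: eq_bigr => r _; rewrite !(ent_munit e_basis).
case: (eqVneq r c) => [->|_]; last by rewrite !andbF !(mul0r, mulr0).
case: (eqVneq c b) => [->|_]; last by rewrite /= !(mul0r, mulr0).
case: (eqVneq p d) => [->|_]; last by rewrite /= !(mul0r, mulr0).
case: (eqVneq q a) => [->|_]; last by rewrite /= !(mul0r, mulr0).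
by rewrite /= !mulr1 mul1r mulrC.
Qed.

Lemma str_comp (f u : 'End(V)) : str (f \o u)%VF = \sum_a \sum_c s a * (ent f a c * ent u c a).
Proof.
rewrite (strE e_basis e_deg); apply: eq_bigr => a _.
by rewrite (ent_comp e_basis) mulr_sumr.
Qed.

Lemma str_munit a b (u : 'End(V)) : str (munit e a b \o u)%VF = s a * ent u b a.
Proof.
rewrite str_comp -(sum_deltaM a (fun p => s p * ent u b p)); apply: eq_bigr => p _.
rewrite -(sum_deltaM b (fun q => (p == a)%:R * (s p * ent u q p))); apply: eq_bigr => q _.
rewrite (ent_munit e_basis).
by case: (p == a); case: (q == b); rewrite /= ?(mulr0, mul0r, mul1r).
Qed.

Lemma str_compPr c (f u w : 'End(V)) :
  str (f \o (c *: u + w))%VF = c * str (f \o u)%VF + str (f \o w)%VF.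
Proof.
rewrite !str_comp mulr_sumr -big_split; apply: eq_bigr => a _ /=.
rewrite mulr_sumr -big_split; apply: eq_bigr => b _ /=.
by rewrite entD entZ; ring.
Qed.

Lemma str_compPl c (f u w : 'End(V)) :
  str ((c *: u + w) \o f)%VF = c * str (u \o f)%VF + str (w \o f)%VF.
Proof.
rewrite !str_comp mulr_sumr -big_split; apply: eq_bigr => a _ /=.
rewrite mulr_sumr -big_split; apply: eq_bigr => b _ /=.
by rewrite entD entZ; ring.
Qed.

Lemma diag_pairingE (P : 'End(V) * 'End(V)) (z : 'End(V)) :
  diag_pairing P z = str (P.1 \o z)%VF - str (P.2 \o z)%VF.
Proof.
apply: (linfunE (f := fun z => _ : k^o)) => c u w.
by rewrite !str_compPr /GRing.scale /=; ring.
Qed.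

Lemma diag_pairing_munit (P : 'End(V) * 'End(V)) a b :
  diag_pairing P (munit e b a) = s a * (ent P.1 a b - ent P.2 a b).
Proof.
have E (f : 'End(V)) : str (f \o munit e b a)%VF = s a * ent f a b.
  rewrite str_comp -(sum_deltaM a (fun p => s p * ent f p b)); apply: eq_bigr => p _.
  rewrite -(sum_deltaM b (fun q => (p == a)%:R * (s p * ent f p q))); apply: eq_bigr => q _.
  rewrite (ent_munit e_basis).
  by case: (p == a); case: (q == b); rewrite /= ?(mulr0, mul0r, mul1r, mulr1).
by rewrite diag_pairingE !E mulrBr.
Qed.

Lemma diag_pairingP c (P Q : 'End(V) * 'End(V)) :
  diag_pairing (c *: P + Q) = c *: diag_pairing P + diag_pairing Q.
Proof.
apply/lfunP => z; rewrite add_lfunE scale_lfunE !diag_pairingE /= !str_compPl.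
by rewrite /GRing.scale /=; ring.
Qed.

Lemma dual_munitP (z z' : dual k 'End(V)) :
  (forall a b, z (munit e a b) = z' (munit e a b)) -> z = z'.
Proof.
move=> zz'; rewrite (dual_expand dg e_basis z) (dual_expand dg e_basis z').
by apply: eq_bigr => a _; apply: eq_bigr => b _; rewrite zz'.
Qed.

Lemma ent_diag_part (f : 'End(V)) a b :
  ent (diag_part e f) a b = (b == a)%:R * ent f a a.
Proof.
have -> : diag_part e f = \sum_(a < n) ent f a a *: munit e a a.
  apply: (linfunE (f := fun f : 'End(V) => \sum_(a < n) coord e a (f e`_a) *: munit e a a)).
  move=> c u w; rewrite scaler_sumr -big_split; apply: eq_bigr => i _ /=.
  by rewrite -/(ent _ i i) entD entZ scalerDl scalerA.
rewrite ent_sum -(sum_deltaM a (fun c => (b == a)%:R * ent f c c)); apply: eq_bigr => c _.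
rewrite entZ (ent_munit e_basis) [a == c]eq_sym.
have [->|] := eqVneq c a; last by rewrite /= !(mulr0, mul0r).
by rewrite /= mul1r mulrC.
Qed.

Lemma p_minusP P : reflect
  [/\ forall a b : 'I_n, ~~ (a <= b)%N -> ent P.1 a b = 0,
      forall a b : 'I_n, ~~ (b <= a)%N -> ent P.2 a b = 0
    & forall a, ent P.1 a a + ent P.2 a a = 0] (P \in p_minus e).
Proof.
have fstE (Q : 'End(V) * 'End(V)) : linfun (fun P : 'End(V) * 'End(V) => P.1) Q = Q.1.
  exact: (linfunE (f := fun P : 'End(V) * 'End(V) => P.1)).
have sndE (Q : 'End(V) * 'End(V)) : linfun (fun P : 'End(V) * 'End(V) => P.2) Q = Q.2.
  exact: (linfunE (f := fun P : 'End(V) * 'End(V) => P.2)).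
have dE (Q : 'End(V) * 'End(V)) : linfun (fun P : 'End(V) * 'End(V) =>
    (diag_part e P.1 + diag_part e P.2)%R) Q = diag_part e Q.1 + diag_part e Q.2.
  apply: (linfunE (f := fun P : 'End(V) * 'End(V) => (diag_part e P.1 + diag_part e P.2)%R)).
  by move=> c u w; rewrite !linearP /=; lmod k.
rewrite !memv_cap -!memv_preim memv_ker fstE sndE dE -andbA.
apply: (iffP and3P) => [[/(b_plusP e_basis) P1 /(b_minusP e_basis) P2 /eqP P0]|[P1 P2 P0]].
  split=> // a; have /(congr1 (fun f => ent f a a)) := P0.
  by rewrite entD !ent_diag_part eqxx !mul1r => ->; rewrite /(ent _ _ _) lfunE linear0.
split; [exact/(b_plusP e_basis)|exact/(b_minusP e_basis)|apply/eqP].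
apply: (entP e_basis) => a b; rewrite entD !ent_diag_part -mulrDr P0 mulr0.
by rewrite /(ent _ _ _) lfunE linear0.
Qed.

(** Off the diagonal one of the two components vanishes, so the difference determines the other; on
    the diagonal they are opposite, and the difference is twice the first. *)
Lemma diag_pairing_inj P Q : P \in p_minus e -> Q \in p_minus e ->
  diag_pairing P = diag_pairing Q -> P = Q.
Proof.
move=> /p_minusP[P1 P2 P0] /p_minusP[Q1 Q2 Q0] PQ.
have E a b : ent P.1 a b - ent P.2 a b = ent Q.1 a b - ent Q.2 a b.
  have := congr1 (fun z : dual k 'End(V) => z (munit e b a)) PQ.
  rewrite /= !diag_pairing_munit => /(congr1 (fun c => s a * c)).
  by rewrite !mulrA sgn_sgn !mul1r.
have half (c c' d d' : k) : c + d = 0 -> c' + d' = 0 -> c - d = c' - d' -> c = c'.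
  move=> cd cd' cE; have -> : c = h * ((c + d) + (c - d)) by field.
  by have -> : c' = h * ((c' + d') + (c' - d')); [field | rewrite cd cd' cE].
case: P Q P1 P2 P0 Q1 Q2 Q0 E {PQ} => [p1 p2] [q1 q2] /= P1 P2 P0 Q1 Q2 Q0 E.
congr (_, _); apply: (entP e_basis) => a b; have := E a b.
  case: (ltngtP a b) => [ab|ba|/val_inj <-].
  - by rewrite P2 ?Q2 -?ltnNge // !subr0.
  - by rewrite P1 ?Q1 -?ltnNge.
  by apply: half.
case: (ltngtP a b) => [ab|ba|/val_inj <-].
- by rewrite P2 ?Q2 -?ltnNge.
- by rewrite P1 ?Q1 -?ltnNge // !sub0r => /oppr_inj.
move=> /(congr1 -%R); rewrite !opprB; apply: half; by rewrite addrC.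
Qed.

(** The sign of the standard classical r-matrix. The weights h (1 + tau b a) and h (1 - tau b a)
    distribute the entry (a, b) over the two Borel components: 1 and 0 above the diagonal, 0 and 1
    below it, 1/2 each on it. *)
Definition tau (a b : 'I_n) : k := if (b < a)%N then 1 else if (a < b)%N then -1 else 0.

Lemma tauN a b : tau b a = - tau a b.
Proof. by rewrite /tau; case: ltngtP => _; rewrite ?opprK ?oppr0. Qed.

Definition mx_end (c : 'I_n -> 'I_n -> k) : 'End(V) := \sum_a \sum_b c a b *: munit e a b.

Lemma ent_mx_end c a b : ent (mx_end c) a b = c a b.
Proof.
rewrite ent_sum -(sum_deltaM a (fun p => c p b)); apply: eq_bigr => p _.
rewrite ent_sum -(sum_deltaM b (fun q => (p == a)%:R * c p q)); apply: eq_bigr => q _.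
rewrite entZ (ent_munit e_basis) [a == p]eq_sym [b == q]eq_sym.
by case: (p == a); case: (q == b); rewrite /= ?(mulr0, mul0r, mul1r, mulr1).
Qed.

(* The element of p_- representing z. *)
Definition pm (z : dual k 'End(V)) : 'End(V) * 'End(V) :=
  (mx_end (fun a b => s a * (h * (1 + tau b a)) * z (munit e b a)),
   mx_end (fun a b => - (s a * (h * (1 - tau b a)) * z (munit e b a)))).

Lemma pm_p_minus z : pm z \in p_minus e.
Proof.
apply/p_minusP; split=> [a b|a b|a]; rewrite !ent_mx_end /tau.
- by rewrite -ltnNge => ba; rewrite ba ltnNge (ltnW ba) /=; ring.
- by rewrite -ltnNge => ba; rewrite ba /=; ring.
by rewrite ltnn; ring.
Qed.

Lemma diag_pairing_pm z : diag_pairing (pm z) = z.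
Proof.
apply: dual_munitP => b a; rewrite diag_pairing_munit !ent_mx_end opprK -mulrDl mulrA.
rewrite -mulrDr mulrA sgn_sgn mul1r.
by rewrite -mulrDr addrACA subrr addr0 mulrDr mulr1 hh mul1r.
Qed.

(** The inverse in the definition of the cobracket is a generic one; injectivity of the pairing on
    p_- identifies it with the explicit [pm]. *)
Lemma p_minus_dual_inv z : vsval ((p_minus_dual e)^-1%VF z) = pm z.
Proof.
have pE (P : subvs_of (p_minus e)) : p_minus_dual e P = diag_pairing (vsval P).
  apply: (linfunE (f := fun P : subvs_of (p_minus e) => diag_pairing (vsval P))).
  by move=> c u w; rewrite linearP diag_pairingP.
have pz : p_minus_dual e (vsproj (p_minus e) (pm z)) = z.
  by rewrite pE vsprojK ?pm_p_minus // diag_pairing_pm.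
apply: diag_pairing_inj (subvsP _) (pm_p_minus z) _.
rewrite -pE diag_pairing_pm limg_lfunVK // -pz; exact: memv_img (memvf _).
Qed.

Lemma cobracketE z z' : cobracket_dual e z z'
  = diag_pairing (scomm (pm z).1 (pm z').1, scomm (pm z).2 (pm z').2).
Proof. by rewrite /cobracket_dual !p_minus_dual_inv. Qed.

#[local] Opaque cobracket_dual.

Lemma pmP c z z' : pm (c *: z + z') = c *: pm z + pm z'.
Proof.
congr (_, _); apply: (entP e_basis) => a b; rewrite entD entZ !ent_mx_end;
  by rewrite add_lfunE scale_lfunE /GRing.scale /=; ring.
Qed.

Lemma cobracketPl c z z' y :
  cobracket_dual e (c *: z + z') y = c *: cobracket_dual e z y + cobracket_dual e z' y.
Proof. by rewrite !cobracketE pmP /= !scommPl -diag_pairingP. Qed.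

Lemma cobracketPr c z y y' :
  cobracket_dual e z (c *: y + y') = c *: cobracket_dual e z y + cobracket_dual e z y'.
Proof. by rewrite !cobracketE pmP /= !scommPr -diag_pairingP. Qed.

Lemma scomm_p_minus P Q : P \in p_minus e -> Q \in p_minus e ->
  (scomm P.1 Q.1, scomm P.2 Q.2) \in p_minus e.
Proof.
move=> /p_minusP[P1 P2 P0] /p_minusP[Q1 Q2 Q0].
apply/p_minusP; split=> [a b ab|a b ab|a] /=; rewrite !(ent_scomm e_basis e_deg).
- rewrite -ltnNge in ab; rewrite big1 // => c _; case: (leqP a c) => [ac|ca].
    have bc := leq_trans ab ac.
    by rewrite (Q1 c b) ?(P1 c b) -?ltnNge // !mulr0 subr0.
  by rewrite (P1 a c) ?(Q1 a c) -?ltnNge // !(mul0r, mulr0) subr0.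
- rewrite -ltnNge in ab; rewrite big1 // => c _; case: (leqP c a) => [ca|ac].
    have cb := leq_ltn_trans ca ab.
    by rewrite (Q2 c b) ?(P2 c b) -?ltnNge // !mulr0 subr0.
  by rewrite (P2 a c) ?(Q2 a c) -?ltnNge // !(mul0r, mulr0) subr0.
(* A bracket of triangular matrices has zero diagonal: terms with c different from a contain a zero
   factor, and those with c = a cancel. *)
rewrite -big_split big1 // => c _ /=.
case: (ltngtP a c) => [ac|ca|/val_inj <-].
- rewrite (Q1 c a) ?(P1 c a) -?ltnNge // (P2 a c) ?(Q2 a c) -?ltnNge //.
  by rewrite !(mul0r, mulr0) !subr0 addr0.
- rewrite (Q1 a c) ?(P1 a c) -?ltnNge // (P2 c a) ?(Q2 c a) -?ltnNge //.
  by rewrite !(mul0r, mulr0) !subr0 addr0.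
by rewrite subrr mul0r /sgn expr0z; ring.
Qed.

(** Iterated brackets can thus be computed in p_-, so the Jacobi identity of the dual bracket is
    inherited from the super-commutators of the two components. *)
Lemma pm_cobracket z z' : pm (cobracket_dual e z z')
  = (scomm (pm z).1 (pm z').1, scomm (pm z).2 (pm z').2).
Proof.
apply: diag_pairing_inj; rewrite ?pm_p_minus ?scomm_p_minus ?pm_p_minus //.
by rewrite diag_pairing_pm cobracketE.
Qed.

(** Degree m for functionals on End(V), tested on matrix units. The supertrace form pairs degree m
    with degree -m, so the representing element of p_- has degree m. *)
Definition hdual (m : int) (z : dual k 'End(V)) : Prop :=
  forall a b, dg b - dg a != m -> z (munit e a b) = 0.

Lemma pm_gr m z : hdual m z -> (pm z).1 \in end_gr V m /\ (pm z).2 \in end_gr V m.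
Proof.
move=> mz; split; apply/(end_grP e_basis e_deg) => a b abm; rewrite ent_mx_end mz //.
  by rewrite mulr0.
by rewrite mulr0 oppr0.
Qed.

Lemma cobracket_hdual p q y z : hdual p y -> hdual q z -> hdual (p + q) (cobracket_dual e y z).
Proof.
move=> /pm_gr[y1 y2] /pm_gr[z1 z2] a b abpq; rewrite cobracketE diag_pairing_munit /=.
have /(end_grP e_basis e_deg) -> // := scomm_gr e_basis e_deg y1 z1.
have /(end_grP e_basis e_deg) -> // := scomm_gr e_basis e_deg y2 z2.
by rewrite subr0 mulr0.
Qed.

Lemma cobracket_anti p q y z : hdual p y -> hdual q z ->
  cobracket_dual e y z = - sgn k (p * q) *: cobracket_dual e z y.
Proof.
move=> /pm_gr[y1 y2] /pm_gr[z1 z2].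
rewrite !cobracketE (scomm_anti y1 z1) (scomm_anti y2 z2).
have := diag_pairingP (- sgn k (p * q)) (scomm (pm z).1 (pm y).1, scomm (pm z).2 (pm y).2) 0.
rewrite addr0 => E; rewrite -[LHS]/(diag_pairing (- sgn k (p * q) *:
  (scomm (pm z).1 (pm y).1, scomm (pm z).2 (pm y).2))) E.
have -> : diag_pairing (0 : 'End(V) * 'End(V)) = 0.
  by apply/lfunP => u; rewrite diag_pairingE !comp_lfun0l subrr lfunE.
by rewrite addr0.
Qed.

Lemma cobracket_jacobi p q r x y z : hdual p x -> hdual q y -> hdual r z ->
  cobracket_dual e x (cobracket_dual e y z) = cobracket_dual e (cobracket_dual e x y) z
    + sgn k (p * q) *: cobracket_dual e y (cobracket_dual e x z).
Proof.
move=> /pm_gr[x1 x2] /pm_gr[y1 y2] /pm_gr[z1 z2].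
rewrite (cobracketE x (cobracket_dual e y z)) (cobracketE (cobracket_dual e x y) z).
rewrite (cobracketE y (cobracket_dual e x z)) !pm_cobracket /=.
rewrite (scomm_jacobi x1 y1 z1) (scomm_jacobi x2 y2 z2) [in RHS]addrC -diag_pairingP.
by congr diag_pairing; congr (_, _); rewrite [LHS]addrC.
Qed.

Lemma pm_xi a b : pm (xi a b)
  = ((s b * (h * (1 + tau a b)) * sg a b) *: munit e b a,
     (- (s b * (h * (1 - tau a b)) * sg a b)) *: munit e b a).
Proof.
congr (_, _); apply: (entP e_basis) => p q;
  rewrite entZ ent_mx_end xiE !(ent_munit e_basis) [a == q]eq_sym [b == p]eq_sym;
  case: (eqVneq q a) => [->|_]; rewrite ?andbF /= ?(mulr0, mul0r, oppr0) //;
  case: (eqVneq p b) => [->|_]; rewrite /= ?(mulr0, mul0r, oppr0) //; ring.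
Qed.

(** The scalar is h^2 ((1 + t)(1 + t') - (1 - t)(1 - t')) = h (t + t'), where t and t' are the
    values of [tau] at the two arguments; the rest is the bracket of matrix units. *)
Lemma cobracket_xi a b c d : cobracket_dual e (xi a b) (xi c d)
  = (h * (tau a b + tau c d)) *:
      (((a == d)%:R * sgn k ((dg a + dg b) * (dg a + dg c))) *: xi c b
       - (c == b)%:R *: xi a d).
Proof.
rewrite cobracketE !pm_xi /= !scommZ mulrNN !scomm_munit.
apply/lfunP => z; rewrite diag_pairingE /= scale_lfunE add_lfunE opp_lfunE !scale_lfunE.
rewrite !xiE.
have strP c1 c2 (u v : 'End(V)) :
    str ((c1 *: (u - c2 *: v)) \o z)%VF = c1 * (str (u \o z)%VF - c2 * str (v \o z)%VF).
  rewrite !str_comp !mulr_sumr -sumrB mulr_sumr; apply: eq_bigr => p _.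
  rewrite !mulr_sumr -sumrB mulr_sumr; apply: eq_bigr => q _.
  by rewrite entZ entD entN entZ; ring.
have strZ c1 (u : 'End(V)) : str ((c1 *: u) \o z)%VF = c1 * str (u \o z)%VF.
  rewrite !str_comp !mulr_sumr; apply: eq_bigr => p _.
  by rewrite !mulr_sumr; apply: eq_bigr => q _; rewrite entZ; ring.
rewrite !strP !strZ !str_munit -mulrBl /GRing.scale /=.
have -> : s b * (h * (1 + tau a b)) * sg a b * (s d * (h * (1 + tau c d)) * sg c d)
    - s b * (h * (1 - tau a b)) * sg a b * (s d * (h * (1 - tau c d)) * sg c d)
    = s b * s d * sg a b * sg c d * (h * (tau a b + tau c d)) by field.
set H := h * _; rewrite /sg.
by case: (eqVneq a d) => [->|_]; case: (eqVneq c b) => [->|_] /=;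
  rewrite ?(mul0r, mulr0, subr0, sub0r); signs; ring.
Qed.
End Cobracket.

Section Subalgebras.
Variables (k : fieldType) (V : gvect k) (n : nat) (e : n.-tuple V) (dg : 'I_n -> int).
Hypothesis e_basis : basis_of fullv e.
Hypothesis e_deg : forall a : 'I_n, e`_a \in gv_gr V (dg a).
Local Notation ent := (ent e).

Section Support.
Variables (W : {vspace 'End(V)}) (P : rel int).
Hypothesis WP : forall f : 'End(V),
  reflect (forall a b, ~~ P (dg b) (dg a) -> ent f a b = 0) (f \in W).

Lemma support_gr m f : f \in W -> end_comp m f \in W.
Proof.
move=> /WP f0; apply/WP => a b /f0 ab.
by rewrite (ent_end_comp e_basis e_deg) ab if_same.
Qed.

(** A nonzero entry of a product passes through an intermediate index, and transitivity composes the
    two steps; this treats q, l and n at once. *)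
Lemma support_br f u : transitive P -> f \in W -> u \in W -> scomm f u \in W.
Proof.
move=> Ptr /WP f0 /WP u0; apply/WP => a b nP; rewrite (ent_scomm e_basis e_deg) big1 // => c _.
have [cb|/negP ncb] := boolP (P (dg b) (dg c)).
  have /f0 -> : ~~ P (dg c) (dg a) by apply: contra nP; apply: Ptr.
  rewrite (u0 a c) ?mul0r ?mulr0 ?subr0 //.
  by apply: contra nP; apply: Ptr.
by rewrite (u0 c b) ?(f0 c b) ?mulr0 ?subr0 //; apply/negP.
Qed.
End Support.

Lemma sl_subP (f : 'End(V)) : (f \in sl_sub V) = (str f == 0).
Proof.
have strl : linear (@str k V : 'End(V) -> k^o).
  move=> c u w; rewrite !(strE e_basis e_deg) scaler_sumr -big_split; apply: eq_bigr => a _ /=.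
  by rewrite entD entZ /GRing.scale /=; ring.
by rewrite memv_ker (linfunE strl).
Qed.

Lemma sl_gr m (f : 'End(V)) : f \in sl_sub V -> end_comp m f \in sl_sub V.
Proof.
rewrite !sl_subP !(strE e_basis e_deg) => /eqP f0; apply/eqP.
under eq_bigr do rewrite (ent_end_comp e_basis e_deg) subrr.
by case: eqP => // _; rewrite big1 // => a _; rewrite mulr0.
Qed.

Lemma sl_scomm (f u : 'End(V)) : scomm f u \in sl_sub V.
Proof.
rewrite sl_subP (strE e_basis e_deg); apply/eqP.
under eq_bigr do rewrite (ent_scomm e_basis e_deg) mulr_sumr.
under eq_bigr => a _ do under eq_bigr => c _ do rewrite mulrBr.
under eq_bigr do rewrite sumrB.
rewrite sumrB [X in _ - X]exchange_big /= -sumrB big1 // => a _.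
rewrite -sumrB big1 // => c _.
by signs; ring.
Qed.

Let q_P := q_subP e_basis e_deg.
Let l_P (f : 'End(V)) :
  reflect (forall a b, ~~ (dg b == dg a) -> ent f a b = 0) (f \in l_sub V).
Proof.
apply: (iffP (l_subP e_basis e_deg f)) => f0 a b ab; apply: f0; by rewrite eq_sym.
Qed.
Let n_P := n_subP e_basis e_deg.

Lemma q1_gr m (f : 'End(V)) : f \in q1_sub V -> end_comp m f \in q1_sub V.
Proof.
rewrite !memv_cap => /andP[fq fs]; rewrite sl_gr // andbT.
exact: (support_gr (P := fun i j => i <= j) q_P).
Qed.

Lemma q1_br (f u : 'End(V)) : f \in q1_sub V -> u \in q1_sub V -> scomm f u \in q1_sub V.
Proof.
rewrite !memv_cap => /andP[fq _] /andP[uq _]; rewrite sl_scomm andbT.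
by apply: (support_br (P := fun i j => i <= j) q_P) => // x y z; apply: le_trans.
Qed.

Lemma l1_gr m (f : 'End(V)) : f \in l1_sub V -> end_comp m f \in l1_sub V.
Proof.
rewrite !memv_cap => /andP[fq fs]; rewrite sl_gr // andbT.
exact: (support_gr (P := fun i j => i == j) l_P).
Qed.

Lemma l1_br (f u : 'End(V)) : f \in l1_sub V -> u \in l1_sub V -> scomm f u \in l1_sub V.
Proof.
rewrite !memv_cap => /andP[fq _] /andP[uq _]; rewrite sl_scomm andbT.
by apply: (support_br (P := fun i j => i == j) l_P) => // x y z /eqP -> /eqP ->.
Qed.

Lemma n_gr m (f : 'End(V)) : f \in n_sub V -> end_comp m f \in n_sub V.
Proof. exact: (support_gr (P := fun i j => i < j) n_P). Qed.

Lemma n_br (f u : 'End(V)) : f \in n_sub V -> u \in n_sub V -> scomm f u \in n_sub V.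
Proof. by apply: (support_br (P := fun i j => i < j) n_P) => // x y z; apply: lt_trans. Qed.

Lemma q1P (f : 'End(V)) : (f \in q1_sub V) = (f \in q_sub V) && (str f == 0).
Proof. by rewrite memv_cap sl_subP. Qed.

Lemma l1_q1 : (l1_sub V <= q1_sub V)%VS.
Proof.
apply/subvP => f; rewrite !memv_cap => /andP[/l_P f0 ->]; rewrite andbT.
apply/q_P => a b; rewrite -ltNge => ab; apply: f0.
by rewrite eq_sym lt_eqF.
Qed.

Lemma n_q1 : (n_sub V <= q1_sub V)%VS.
Proof.
apply/subvP => f /n_P f0; rewrite q1P; apply/andP; split.
  by apply/q_P => a b ab; apply: f0; apply: contra ab; apply: ltW.
rewrite (strE e_basis e_deg) big1 // => a _.
by rewrite f0 ?mulr0 // ltxx.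
Qed.
End Subalgebras.

(** * Descent of the dual bracket to the dual of q_1 *)

Section QuotientBracket.
Variables (k : fieldType) (V : gvect k) (n : nat) (e : n.-tuple V) (dg : 'I_n -> int).
Hypothesis e_basis : basis_of fullv e.
Hypothesis e_deg : forall a : 'I_n, e`_a \in gv_gr V (dg a).
Hypothesis k2 : 2%:R != 0 :> k.
Hypothesis dg_mono : forall a b : 'I_n, (a <= b)%N -> dg b <= dg a.
Local Notation ent := (ent e).
Local Notation sg := (sg k dg).
Local Notation xi := (xi e dg).
Local Notation h := (2%:R^-1 : k).
Local Notation s a := (sgn k (dg a)).
Local Notation U := (q1_sub V).
Local Notation L := (sub_gLie U).
Local Notation Uxi := (Uxi e dg U).
Local Notation tau := (tau k).
Local Notation res := (@dual_res_end k V U).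
Local Notation phi := (cobracket_dual e).

Lemma Uxi0 a b : ~~ (dg b <= dg a) -> Uxi a b = 0.
Proof.
move=> ab; apply/lfunP => x; rewrite UxiE lfunE /=.
have := subvsP x; rewrite (q1P e_basis e_deg) => /andP[/(q_subP e_basis e_deg) -> //].
by rewrite mulr0.
Qed.

Lemma xi_hdual a b : hdual e dg (dg b - dg a) (xi a b).
Proof.
move=> c d cd; rewrite xiE (ent_munit e_basis).
case: eqP => [ac|]; rewrite ?mulr0 //; case: eqP => [bd|]; rewrite ?mulr0 //.
by rewrite ac bd eqxx in cd.
Qed.

Lemma res_phi a b c d : res (phi (xi a b) (xi c d)) = (h * (tau a b + tau c d)) *:
   (((a == d)%:R * sgn k ((dg a + dg b) * (dg a + dg c))) *: Uxi c b
    - (c == b)%:R *: Uxi a d).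
Proof.
rewrite (cobracket_xi e_basis e_deg k2).
have [R RE] := linear_of (@dual_res_end_linear k V U).
by rewrite -RE linearZ linearB !linearZ /= !RE.
Qed.

(** Such an [xi a b] annihilates q. In each term of the bracket either the resulting functional
    annihilates q as well, or (c, d) is ordered oppositely to (a, b) and the two values of [tau]
    cancel. *)
Lemma res_phi_lower a b c d : dg a < dg b -> res (phi (xi a b) (xi c d)) = 0.
Proof.
move=> ab; rewrite res_phi.
have lt_ij i j : dg i < dg j -> (j < i)%N.
  by move=> ij; rewrite ltnNge; apply/negP => /dg_mono; rewrite leNgt ij.
have tab : tau a b = 1 by rewrite /tau lt_ij.
rewrite scalerBr; have [ad|_] := eqVneq a d.
  have [bc|bc] := boolP (dg b <= dg c).
    have ca := lt_ij _ _ (lt_le_trans ab bc).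
    have -> : tau c d = -1 by rewrite /tau -ad ltnNge (ltnW ca) ca.
    by rewrite tab subrr mulr0 !scale0r subr0.
  rewrite (Uxi0 bc) !scaler0 sub0r.
  have [cb|_] := eqVneq c b; last by rewrite scale0r scaler0 oppr0.
  by rewrite cb lexx in bc.
rewrite mul0r scale0r scaler0 sub0r; have [cb|_] := eqVneq c b; last first.
  by rewrite scale0r scaler0 oppr0.
have [da|da] := boolP (dg d <= dg a); last by rewrite (Uxi0 da) !scaler0 oppr0.
have bd := lt_ij _ _ (le_lt_trans da ab).
have -> : tau c d = -1 by rewrite /tau cb ltnNge (ltnW bd) bd.
by rewrite tab subrr mulr0 scale0r oppr0.
Qed.

(** The annihilator of q_1 consists of functionals supported outside q plus multiples of the
    supertrace: the combinations s_a e_aa - s_b e_bb lie in q_1 and tie the diagonal values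
    together. *)
Lemma res_ker (z : dual k 'End(V)) : res z = 0 ->
  (forall a b, a != b -> dg b <= dg a -> z (munit e a b) = 0) /\
  (forall a b, s a * z (munit e a a) = s b * z (munit e b b)).
Proof.
move=> z0; have zU f : f \in U -> z f = 0.
  move=> fU; have := congr1 (fun u : dual k L => u (vsproj U f)) z0.
  by rewrite /= dual_res_endE vsprojK // lfunE.
split=> [a b ab le_ab|a b].
  apply: zU; rewrite (q1P e_basis e_deg); apply/andP; split.
    apply/(q_subP e_basis e_deg) => c d cd; rewrite (ent_munit e_basis).
    case: eqP => [ca|] //; case: eqP => [db|] //.
    by rewrite ca db le_ab in cd.
  rewrite (strE e_basis e_deg) big1 // => c _; rewrite (ent_munit e_basis).
  case: eqP => [->|]; rewrite ?mulr0 //.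
  by rewrite (negbTE ab) mulr0.
apply/eqP; rewrite -subr_eq0 -[s a * _]/(s a *: _) -[s b * _]/(s b *: _) -!linearZ -linearB.
apply/eqP/zU; rewrite (q1P e_basis e_deg); apply/andP; split.
  apply/(q_subP e_basis e_deg) => c d cd; rewrite entD entN !entZ !(ent_munit e_basis).
  have ne i : (c == i) && (d == i) = false.
    by apply/negP => /andP[/eqP ci /eqP di]; rewrite ci di lexx in cd.
  by rewrite !ne !mulr0 subrr.
rewrite (strE e_basis e_deg); apply/eqP.
under eq_bigr => c _ do rewrite entD entN !entZ !(ent_munit e_basis) !andbb mulrBr.
rewrite sumrB.
have sumE i : \sum_c s c * (s i * (c == i)%:R) = 1.
  rewrite -[RHS](sgn_sgn k (dg i)) -[RHS](sum_deltaM i (fun c => s c * s i)).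
  by apply: eq_bigr => c _; ring.
by rewrite !sumE subrr.
Qed.

(** By [res_phi_lower] only the diagonal part counts. It is a multiple of the supertrace, whose
    bracket with [xi c d] restricts to a difference of two equal terms. The weight [t] leaves room
    for the signs of exchanging the arguments. *)
Lemma res_phi_ker (z : dual k 'End(V)) (t : 'I_n -> 'I_n -> k) c d : res z = 0 ->
  (forall a, t a a = 1) ->
  \sum_a \sum_b (t a b * (sg a b * z (munit e a b))) *: res (phi (xi a b) (xi c d)) = 0.
Proof.
move=> /res_ker[z_off z_diag] t1.
have z_d a : sg a a * z (munit e a a) = s a * z (munit e a a).
  by congr (_ * _); rewrite /sg; signs.
transitivity (\sum_a (s a * z (munit e a a)) *: res (phi (xi a a) (xi c d))).
  apply: eq_bigr => a _; rewrite (bigD1 a) //= t1 mul1r z_d big1 ?addr0 // => b ba.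
  have [ab|] := boolP (dg b <= dg a); first by rewrite z_off ?mulr0 ?scale0r // eq_sym.
  by rewrite -ltNge => /res_phi_lower ->; rewrite scaler0.
under eq_bigr => a _ do rewrite (z_diag a c) res_phi.
rewrite -scaler_sumr -[RHS](scaler0 _ (s c * z (munit e c c))); congr (_ *: _).
have tau0 a : tau a a = 0 by rewrite /tau ltnn.
transitivity ((h * tau c d) *: (\sum_a (a == d)%:R *: Uxi c a - \sum_a (a == c)%:R *: Uxi a d)).
  rewrite -sumrB scaler_sumr; apply: eq_bigr => a _; rewrite tau0 add0r [c == a]eq_sym.
  have -> : sgn k ((dg a + dg a) * (dg a + dg c)) = 1 by signs.
  by rewrite mulr1.
by rewrite !sum_delta subrr scaler0.
Qed.

Let phi_suml (F : 'I_n -> dual k 'End(V)) y : phi (\sum_a F a) y = \sum_a phi (F a) y.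
Proof.
have [R RE] := linear_of (fun c z z' => cobracketPl e_basis e_deg k2 c z z' y).
by rewrite -RE linear_sum; apply: eq_bigr => a _; rewrite RE.
Qed.

Let phi_sumr (F : 'I_n -> dual k 'End(V)) y : phi y (\sum_a F a) = \sum_a phi y (F a).
Proof.
have [R RE] := linear_of (fun c z z' => cobracketPr e_basis e_deg k2 c y z z').
by rewrite -RE linear_sum; apply: eq_bigr => a _; rewrite RE.
Qed.

Let phiZl c z y : phi (c *: z) y = c *: phi z y.
Proof.
have [R RE] := linear_of (fun c z z' => cobracketPl e_basis e_deg k2 c z z' y).
by rewrite -!RE linearZ.
Qed.

Let phiZr c z y : phi y (c *: z) = c *: phi y z.
Proof.
have [R RE] := linear_of (fun c z z' => cobracketPr e_basis e_deg k2 c y z z').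
by rewrite -!RE linearZ.
Qed.

Let res_sum (F : 'I_n -> dual k 'End(V)) : res (\sum_a F a) = \sum_a res (F a).
Proof.
have [R RE] := linear_of (@dual_res_end_linear k V U).
by rewrite -RE linear_sum; apply: eq_bigr => a _; rewrite RE.
Qed.

Let resZ c z : res (c *: z) = c *: res z.
Proof.
have [R RE] := linear_of (@dual_res_end_linear k V U).
by rewrite -!RE linearZ.
Qed.

Let res_idealE (z : dual k 'End(V)) c d : res z = 0 ->
  res (phi z (xi c d)) = 0 /\ res (phi (xi c d) z) = 0.
Proof.
move=> z0; split.
  rewrite -[RHS](res_phi_ker (t := fun _ _ => 1) c d z0) //.
  rewrite {1}(dual_expand dg e_basis z) phi_suml res_sum; apply: eq_bigr => a _.
  rewrite phi_suml res_sum; apply: eq_bigr => b _.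
  by rewrite phiZl resZ mul1r.
pose t a b := sgn k ((dg d - dg c) * (dg b - dg a)).
have t1 a : t a a = 1 by rewrite /t subrr mulr0 /sgn expr0z.
apply: oppr_inj; rewrite oppr0 -[RHS](res_phi_ker c d z0 t1).
rewrite {1}(dual_expand dg e_basis z) phi_sumr res_sum -sumrN; apply: eq_bigr => a _.
rewrite phi_sumr res_sum -sumrN; apply: eq_bigr => b _.
rewrite phiZr resZ.
rewrite (cobracket_anti e_basis e_deg k2 (@xi_hdual c d) (@xi_hdual a b)) resZ -/(t a b).
by rewrite scalerA -scaleNr; congr (_ *: _); ring.
Qed.

(* Hence phi^* descends to q_1^*, the quotient of End(V)^* by the annihilator of
   q_1. *)
Lemma res_ideal (z y : dual k 'End(V)) : res z = 0 -> res (phi z y) = 0 /\ res (phi y z) = 0.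
Proof.
move=> z0; rewrite (dual_expand dg e_basis y) phi_suml phi_sumr !res_sum.
split; apply: big1 => c _; rewrite ?phi_suml ?phi_sumr res_sum; apply: big1 => d _.
  by rewrite phiZr resZ (res_idealE c d z0).1 scaler0.
by rewrite phiZl resZ (res_idealE c d z0).2 scaler0.
Qed.
End QuotientBracket.

(** * The Gerstenhaber structure on C(q_1, k) *)

Section QuotientGerstenhaber.
Variables (k : fieldType) (V : gvect k) (n : nat) (e : n.-tuple V) (dg : 'I_n -> int).
Hypothesis e_basis : basis_of fullv e.
Hypothesis e_deg : forall a : 'I_n, e`_a \in gv_gr V (dg a).
Hypothesis k2 : 2%:R != 0 :> k.
Hypothesis dg_mono : forall a b : 'I_n, (a <= b)%N -> dg b <= dg a.
Local Notation xi := (xi e dg).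
Local Notation h := (2%:R^-1 : k).
Local Notation s a := (sgn k (dg a)).
Local Notation U := (q1_sub V).
Local Notation L := (sub_gLie U).
Local Notation Uxi := (Uxi e dg U).
Local Notation tau := (tau k).
Local Notation res := (@dual_res_end k V U).
Local Notation phi := (cobracket_dual e).
Variable Q : CE_trivial L.
Local Notation gen := (ce_gen Q).
Local Notation w a b := (gen (Uxi a b)).

Let U_gr := q1_gr e_basis e_deg.
Let U_br := q1_br e_basis e_deg.

Let wd a b : hdeg (1 + dg b - dg a) (w a b).
Proof. exact: (w_deg e_basis e_deg (@ce_gen_deg _ _ _ _ Q)). Qed.

Let dw a b : dif (w a b) = - s a *: \sum_c w a c * w c b.
Proof. exact: (dif_w e_basis e_deg k2 U_br (@ce_gen_deg _ _ _ _ Q) (@ce_dif_gen _ _ _ _ Q)). Qed.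

Section Bracket.
Variable br : Q -> Q -> Q.
Hypothesis brP : is_antibracket br.
Hypothesis br_gen : forall z y : dual k 'End(V),
  br (gen (res z)) (gen (res y)) = gen (res (phi z y)).

Lemma br_w a b c d : br (w a b) (w c d) = (h * (tau a b + tau c d)) *:
   (((a == d)%:R * sgn k ((dg a + dg b) * (dg a + dg c))) *: w c b - (c == b)%:R *: w a d).
Proof.
by rewrite br_gen (res_phi e_basis e_deg k2) linearZ linearB !linearZ.
Qed.

(** The cocycle condition of the cobracket. Both sides are sums over an inner index p that agree
    term by term, except where p meets a, b, c or d; the four exceptional terms are multiples of
    x_ad x_cb and cancel by antisymmetry of [tau]. *)
Lemma cocycle_w a b c d : dif_at br dif (1 + dg b - dg a) (w a b) (w c d).
Proof.
pose ep a b c := sgn k ((dg a + dg b) * (dg a + dg c)).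
have dZ u (v : Q) : dif (u *: v) = u *: dif v by rewrite linearZ.
rewrite /dif_at br_w dZ linearB /= !dZ !dw.
rewrite (brZl brP) (brZr brP) (br_suml brP) (br_sumr brP).
(* The exceptional terms: [A] at p = d, [B] at p = c, [E] at p = a, [F] at p = b. *)
pose A p := (- s a * (h * (tau p b + tau c d)) * ep p b c) *: (w a p * w c b).
pose B p := (s a * sgn k ((1 + dg b - dg p) * (dg d - dg c)) * (h * (tau a p + tau c d))) *:
  (w a d * w p b).
pose E p := (- sgn k (dg b - dg a) * s c * (h * (tau a b + tau c p)) * ep a b c) *: (w c b * w p d).
pose F p := (sgn k (dg b - dg a) * s c * sgn k ((dg b - dg a) * (1 + dg p - dg c))
  * (h * (tau a b + tau p d))) *: (w c p * w a d).
transitivity (\sum_p ((h * (tau a b + tau c d)) *: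
    (((a == d)%:R * ep a b c) *: (- s c *: (w c p * w p b))
     - (c == b)%:R *: (- s a *: (w a p * w p d))))).
  by rewrite !scaler_sumr -sumrB scaler_sumr.
have key p : - s a *: br (w a p * w p b) (w c d)
    + sgn k (1 + dg b - dg a + 1) *: (- s c *: br (w a b) (w c p * w p d))
  = (h * (tau a b + tau c d)) *:
    (((a == d)%:R * ep a b c) *: (- s c *: (w c p * w p b))
     - (c == b)%:R *: (- s a *: (w a p * w p d)))
    + ((p == d)%:R *: A p + (p == c)%:R *: B p + (p == a)%:R *: E p + (p == b)%:R *: F p).
  rewrite (ab_poissonl brP (wd a p) (wd p b) (wd c d)) (ab_poisson brP _ (wd a b) (wd c p)).
  rewrite !br_w -!scalerAl -!scalerAr !(mulrBl (w p b), mulrBl (w p d)).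
  rewrite !(mulrBr (w a p)) !(mulrBr (w c p)) -!scalerAl -!scalerAr.
  rewrite [c == p]eq_sym [a == p]eq_sym /A /B /E /F.
  have tpd : tau p d = - tau d p by apply: tauN.
  have tpb : tau p b = - tau b p by apply: tauN.
  rewrite tpd tpb /ep; move: (2%:R^-1 : k) => H.
  lmod_coefs k; rewrite ?(mulr0, mulr1, subr0, sub0r, oppr0, addr0, add0r).
  - by ring.
  - by case: (eqVneq c b) => [->|_]; rewrite ?(oppr0, mulr0, mul0r, addr0) //; signs; ring.
  - by case: (eqVneq a d) => [->|_]; rewrite ?(mul0r, mulr0, addr0) //; signs; ring.
  - by signs; ring.
  - by signs; ring.
  - by signs; ring.
rewrite !scaler_sumr -big_split /=.
under [RHS]eq_bigr => p _ do rewrite key.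
rewrite big_split /= -[LHS]addr0; congr (_ + _); rewrite !big_split /= !sum_delta.
rewrite /A /B /E /F (gc_mulC (wd c b) (wd a d)) /ep (tauN k d b) (tauN k a c).
by move: (2%:R^-1 : k) => H; signs; lmod k.
Qed.
Lemma gen_expand m z : dual_deg m z -> exists c : 'I_n -> 'I_n -> k,
  (forall a b, dg b - dg a != m -> c a b = 0) /\ gen z = \sum_a \sum_b c a b *: w a b.
Proof. exact: ce_gen_expand. Qed.

Section Basis.
Variables (N : nat) (f : N.-tuple L) (m : 'I_N -> int).
Hypothesis f_basis : basis_of fullv f.
Hypothesis f_hom : forall i : 'I_N, f`_i \in gl_gr L (m i).
Local Notation x i := (gen (dualb f i)).

Let X_deg i : dual_deg (- m i) (dualb f i).
Proof. exact: (dualb_deg e_basis e_deg U_gr f_basis f_hom). Qed.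

Lemma cocycle_gens i j : dif_at br dif (1 - m i) (x i) (x j).
Proof.
have [c [c0 ->]] := gen_expand (X_deg (i:=i)); have [c' [c'0 ->]] := gen_expand (X_deg (i:=j)).
have dZ u (v : Q) : dif (u *: v) = u *: dif v by rewrite linearZ.
have dsum (F : 'I_n -> Q) : dif (\sum_a F a) = \sum_a dif (F a) by rewrite linear_sum.
rewrite /dif_at (br_suml brP) !dsum !(br_suml brP) scaler_sumr -big_split.
apply: eq_bigr => a _ /=.
rewrite (br_suml brP) !dsum !(br_suml brP) scaler_sumr -big_split.
apply: eq_bigr => b _ /=.
rewrite !(br_sumr brP) dsum scaler_sumr -big_split; apply: eq_bigr => a' _ /=.
rewrite !(br_sumr brP) !dsum (br_sumr brP) scaler_sumr -big_split; apply: eq_bigr => b' _ /=.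
rewrite !dZ !(brZl brP) !(brZr brP) !dZ.
have [/c0 ->|/negPn/eqP ab] := boolP (dg b - dg a != - m i).
  by rewrite !scale0r scaler0 addr0.
have := cocycle_w a b a' b'; rewrite /dif_at => ->.
have -> : 1 + dg b - dg a + 1 = 1 - m i + 1 by rewrite -ab; ring.
by lmod k.
Qed.

Lemma gen_res_sum (z : dual k 'End(V)) :
  gen (res z) = \sum_(i < N) (res z f`_i : k) *: x i.
Proof.
rewrite {1}(dualb_expand f_basis (res z)) linear_sum.
by apply: eq_bigr => i _; rewrite linearZ.
Qed.

Lemma br_gens_lin (F : {linear Q -> Q}) i j :
  (forall l, F (x l) = 0) -> F (br (x i) (x j)) = 0.
Proof.
move=> F0; have XE l := hext_res e_basis e_deg U_gr (X_deg (i:=l)).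
rewrite -(XE i) -(XE j) br_gen gen_res_sum linear_sum big1 // => l _.
by rewrite linearZ /= F0 scaler0.
Qed.

(** B (x_ac x_cb) is a multiple of x_ab: the other term of the bracket requires a = b, where tau_ac
    + tau_ca = 0 kills everything. The eigenvalue depends on (a, b), so a free generator, being a
    combination of the x_ab, is only a sum of eigenvectors. *)
Lemma gens_eigen (B : {linear Q -> Q}) i :
  (forall l, B (x l) = 0) -> bv_leibniz br 1 B ->
  exists2 l : seq (k * Q),
    forall p, p \in l -> dif (B p.2) + B (dif p.2) = p.1 *: p.2 & x i = \sum_(p <- l) p.2.
Proof.
move=> Bx B_l; have Bw a b : B (w a b) = 0.
  rewrite gen_res_sum linear_sum big1 // => l _.
  by rewrite linearZ /= Bx scaler0.
have Dw a b : exists c, dif (B (w a b)) + B (dif (w a b)) = c *: w a b.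
  exists (\sum_p - s p * (h * (tau a p + tau p b))).
  rewrite Bw linear0 add0r dw linearZ linear_sum /= scaler_sumr scaler_suml.
  apply: eq_bigr => p _; rewrite (B_l _ _ _ (wd a p)) !Bw mul0r mulr0 scaler0 !add0r br_w.
  rewrite eqxx; have [ab|_] := eqVneq a b.
    by rewrite -ab (tauN k a p) subrr !mulr0 !scale0r !scaler0.
  by move: (2%:R^-1 : k) => H; rewrite /= mul0r scale0r sub0r; signs; lmod k.
have [c [_ ->]] := gen_expand (X_deg (i:=i)).
exists [seq (proj1_sig (constructive_indefinite_description _ (Dw a b)), c a b *: w a b) |
    a <- index_enum 'I_n, b <- index_enum 'I_n]; last first.
  by rewrite big_allpairs_dep.
move=> _ /allpairsP[[a b] /= [_ _ ->]] /=.
case: constructive_indefinite_description => l /= Dl.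
by rewrite !linearZ /= -scalerDr Dl !scalerA mulrC.
Qed.
End Basis.
End Bracket.

Lemma quotient_bv (br : Q -> Q -> Q) (brG : is_gerstenhaber br) :
  (forall z y, br (gen (res z)) (gen (res y)) = gen (res (phi z y))) ->
  exists (M : dBVAlg k) (brM : M -> M -> M) (hbr : is_gerstenhaber brM),
    is_bv_bracket brM /\ quasi_isomorphic (DGAlg brG) (DGAlg hbr).
Proof.
move=> br_gen; have brP : is_antibracket br by case: brG.
have [N [f [m [f_basis f_hom]]]] := graded_basis e_basis e_deg U_gr.
have Cx := ce_free_on e_basis e_deg U_gr f_basis f_hom Q.
have brJ p q u v y : hdeg p u -> hdeg q v -> jacobi_at br p q u v y.
  move=> pu qv; elim/gc_ind: y => [y y' IH IH'|r y ry].
    rewrite /jacobi_at !(brDr brP) -!/(br _ _) IH IH'.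
    by rewrite ?(brDr brP); lmod k.
  exact: (ger_jacobi brG pu qv ry).
have br_d p u v : hdeg p u -> dif_at br dif p u v by apply: ger_dif.
have dif_l : bv_leibniz br 0 dif.
  by move=> p y z py; rewrite mul0r scale0r addr0; apply: dif_mul.
have br_lin (F : {linear Q -> Q}) i j : (forall l, F (gen (dualb f l)) = 0) ->
    F (br (gen (dualb f i)) (gen (dualb f j))) = 0.
  by move=> F0; apply: (br_gens_lin br_gen f_basis f_hom).
have [B [B_r Bx B_l B_d BB]] := bv_exists Cx brP brJ k2 br_lin.
apply: (kernel_model brG B_r B_l BB Cx) => [|i].
  exact: (bv_anticomm (isT : par 1) (@dif_deg _ Q) dif_l (isT : par (- 1)) B_r B_l br_d B_d).
by apply: (gens_eigen br_gen f_basis f_hom).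
Qed.

(** The free generators receive the bracket of chosen lifts to the dual of End(V). The annihilator
    of q_1 is an ideal, so the choice is immaterial and the formula holds for all functionals. *)
Lemma bracket_exists : exists br : Q -> Q -> Q, is_gerstenhaber br /\
  forall z y, br (gen (res z)) (gen (res y)) = gen (res (phi z y)).
Proof.
have [N [f [m [f_basis f_hom]]]] := graded_basis e_basis e_deg U_gr.
have Cx := ce_free_on e_basis e_deg U_gr f_basis f_hom Q.
have X_deg i := dualb_deg e_basis e_deg U_gr f_basis f_hom (i := i).
(* Homogeneous lifts, so that the degrees and signs of their brackets are controlled. *)
pose ex i := hext (- m i) (dualb f i).
have res_ex i : res (ex i) = dualb f i := hext_res e_basis e_deg U_gr (X_deg i).
have ex_hdual i : hdual e dg (- m i) (ex i).
  move=> a b ab; rewrite (hextE e_basis e_deg) (end_comp_neq e_basis e_deg (j := dg a - dg b)).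
  - by rewrite !linear0.
  - apply/(end_grP e_basis e_deg) => c d cd; rewrite (ent_munit e_basis).
    by case: eqP => // ca; case: eqP => // db; rewrite ca db eqxx in cd.
  by apply: contra ab => /eqP E; rewrite -[- m i]opprK -E opprB.
have res_deg p z : hdual e dg p z -> dual_deg p (res z).
  move=> pz j x xj jp; rewrite dual_res_endE (munit_expand e_basis (vsval x)) linear_sum big1 // => a _.
  rewrite linear_sum big1 // => b _; rewrite linearZ /=.
  move: xj; rewrite gl_grE => /(end_grP e_basis e_deg) x0.
  have [abp|abp] := eqVneq (dg b - dg a) p; last by rewrite pz ?scaler0.
  by rewrite x0 ?scale0r //; apply: contra jp => /eqP <-; rewrite -abp opprB.
have resZ c z : res (c *: z) = c *: res z.
  have [R RE] := linear_of (@dual_res_end_linear k V U).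
  by rewrite -!RE linearZ.
pose b i j := gen (res (phi (ex i) (ex j))).
have [|i j|br [brP brx]] := antibracket_exists Cx (b := b).
- move=> i j; apply: hdeg_cast (ce_gen_deg Q (res_deg _ _
    (cobracket_hdual e_basis e_deg k2 (ex_hdual i) (ex_hdual j)))) _.
  by ring.
- rewrite /b (cobracket_anti e_basis e_deg k2 (ex_hdual i) (ex_hdual j)) resZ linearZ /=.
  by congr (_ *: _); congr (- sgn k _); ring.
have br_gen z y : br (gen (res z)) (gen (res y)) = gen (res (phi z y)).
  (* The combination of chosen lifts with the same restriction as z; the difference annihilates q_1
     and is discarded by [res_ideal]. *)
  pose zx := fun z : dual k 'End(V) => \sum_(i < N) (res z f`_i : k) *: ex i.
  have res_zx u : res (u - zx u) = 0.
    have [R RE] := linear_of (@dual_res_end_linear k V U).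
    rewrite -RE linearB !RE /zx; apply/eqP; rewrite subr_eq0; apply/eqP.
    rewrite [LHS](dualb_expand f_basis) -[RHS]RE [RHS]linear_sum; apply: eq_bigr => i _.
    by rewrite [RHS]linearZ /= RE res_ex.
  have [R RE] := linear_of (@dual_res_end_linear k V U).
  have phiE : res (phi z y) = res (phi (zx z) (zx y)).
    rewrite -{1}(subrK (zx z) z) -{1}(subrK (zx y) y) -[z - zx z]scale1r -[y - zx y]scale1r.
    rewrite (cobracketPl e_basis e_deg k2) (cobracketPr e_basis e_deg k2 1 (zx z)) !scale1r.
    rewrite -RE !linearD /= !RE.
    have [-> _] := res_ideal e_basis e_deg k2 dg_mono (y - zx y + zx y) (res_zx z).
    have [_ ->] := res_ideal e_basis e_deg k2 dg_mono (zx z) (res_zx y).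
    by rewrite !add0r.
  transitivity (\sum_(i < N) \sum_(j < N) (res z f`_i : k) *: ((res y f`_j : k) *: b i j)).
    rewrite !(gen_res_sum f_basis) (br_suml brP); apply: eq_bigr => i _.
    rewrite (brZl brP) (br_sumr brP) scaler_sumr; apply: eq_bigr => j _.
    by rewrite (brZr brP) brx.
  rewrite phiE; have Gl : linear (fun t => gen (res t)).
    by move=> c u v; rewrite dual_res_end_linear linearP.
  have [G GE] := linear_of Gl; rewrite -[RHS]GE.
  have [Pl PlE] := linear_of (fun c u v => cobracketPl e_basis e_deg k2 c u v (zx y)).
  rewrite -PlE /zx [Pl _]linear_sum [RHS]linear_sum; apply: eq_bigr => i _.
  rewrite [Pl _]linearZ [RHS]linearZ /= PlE -scaler_sumr; congr (_ *: _).
  have [Pr PrE] := linear_of (fun c u v => cobracketPr e_basis e_deg k2 c (ex i) u v).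
  rewrite -PrE /zx [Pr _]linear_sum [RHS]linear_sum; apply: eq_bigr => j _.
  by rewrite [Pr _]linearZ [RHS]linearZ /= PrE GE.
have x_deg i : hdeg (1 - m i) (gen (dualb f i)) by have [] := Cx.
have [R RE] := linear_of (@dual_res_end_linear k V U).
have exE i : gen (dualb f i) = gen (res (ex i)) by rewrite res_ex.
have J : forall p q u v t, hdeg p u -> hdeg q v -> jacobi_at br p q u v t.
  apply: (jacobi_gens brP Cx) => i j l; rewrite /jacobi_at !exE !br_gen.
  rewrite (cobracket_jacobi e_basis e_deg k2 (ex_hdual i) (ex_hdual j) (ex_hdual l)).
  rewrite -RE linearD linearZ /= !RE linearD linearZ /=.
  by congr (_ + sgn k _ *: _); ring.
have br_d p u v : hdeg p u -> dif_at br dif p u v.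
  have dif_l : bv_leibniz br 0 dif.
    by move=> q t t' qt; rewrite mul0r scale0r addr0; apply: dif_mul.
  apply: (dif_gens brP Cx J (isT : par 1) (@dif_deg _ Q) dif_l) => i j.
  exact: (cocycle_gens brP br_gen f_basis f_hom).
exists br; split=> //; case: brP => h1 h2 h3 h4 h5; split=> //.
by move=> p q r u v t pu qv _; apply: J.
Qed.
End QuotientGerstenhaber.

(** * The comparison map *)

Section Projections.
Variables (k : fieldType) (V : gvect k) (n : nat) (e : n.-tuple V) (dg : 'I_n -> int).
Hypothesis e_basis : basis_of fullv e.
Hypothesis e_deg : forall a : 'I_n, e`_a \in gv_gr V (dg a).
Local Notation ent := (ent e).
Local Notation sg := (sg k dg).
Local Notation s a := (sgn k (dg a)).
Local Notation Lq := (sub_gLie (q1_sub V)).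
Local Notation Ll := (sub_gLie (l1_sub V)).
Local Notation Ln := (sub_gLie (n_sub V)).
Local Notation Xq := (Uxi e dg (q1_sub V)).
Local Notation Xl := (Uxi e dg (l1_sub V)).
Local Notation Xn := (Uxi e dg (n_sub V)).

(** [pin] and [pil] are the projections of q_1 = l_1 + n, obtained by truncating the matrix;
    [vsproj] onto one summand need not vanish on the other. *)
Definition pin (f : 'End(V)) : 'End(V) :=
  mx_end e (fun a b => if dg b < dg a then ent f a b else 0).
Definition pil (f : 'End(V)) : 'End(V) :=
  mx_end e (fun a b => if dg a == dg b then ent f a b else 0).

Let entE c a b : ent (mx_end e c) a b = c a b. Proof. exact: ent_mx_end. Qed.

Fact pin_linear : linear pin.
Proof.
move=> c f u; apply: (entP e_basis) => a b; rewrite entD entZ !entE entD entZ.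
by case: ifP; rewrite ?mulr0 ?addr0.
Qed.

Fact pil_linear : linear pil.
Proof.
move=> c f u; apply: (entP e_basis) => a b; rewrite entD entZ !entE entD entZ.
by case: ifP; rewrite ?mulr0 ?addr0.
Qed.

Lemma pin_n f : pin f \in n_sub V.
Proof. by apply/(n_subP e_basis e_deg) => a b ab; rewrite entE (negbTE ab). Qed.

Lemma pil_l1 (f : 'End(V)) : f \in q1_sub V -> pil f \in l1_sub V.
Proof.
rewrite (q1P e_basis e_deg) => /andP[_ /eqP f0].
rewrite memv_cap (sl_subP e_basis e_deg); apply/andP; split.
  by apply/(l_subP e_basis e_deg) => a b ab; rewrite entE (negbTE ab).
move: f0; rewrite !(strE e_basis e_deg) => f0; apply/eqP; rewrite -[RHS]f0.
by apply: eq_bigr => a _; rewrite entE eqxx.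
Qed.

Lemma pin_pil (f : 'End(V)) : f \in q1_sub V -> f = pil f + pin f.
Proof.
rewrite (q1P e_basis e_deg) => /andP[/(q_subP e_basis e_deg) f0 _].
apply: (entP e_basis) => a b; rewrite entD !entE.
have [ab|ab|ab] := ltgtP (dg b) (dg a); rewrite ?add0r ?addr0 //.
by apply: f0; rewrite -ltNge.
Qed.

Lemma pin_id (f : 'End(V)) : f \in n_sub V -> pin f = f.
Proof.
move=> /(n_subP e_basis e_deg) f0; apply: (entP e_basis) => a b; rewrite entE.
by case: ifPn => // /f0.
Qed.

Lemma pil_n (f : 'End(V)) : f \in n_sub V -> pil f = 0.
Proof.
move=> /(n_subP e_basis e_deg) f0; apply: (entP e_basis) => a b; rewrite entE.
by case: eqP => [ab|_]; rewrite ?f0 ?ab ?ltxx // /(ent _ _ _) lfunE linear0.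
Qed.

Lemma pil_id (f : 'End(V)) : f \in l1_sub V -> pil f = f.
Proof.
rewrite memv_cap => /andP[/(l_subP e_basis e_deg) f0 _]; apply: (entP e_basis) => a b.
by rewrite entE; case: ifPn => // /f0.
Qed.

Lemma pin_l (f : 'End(V)) : f \in l1_sub V -> pin f = 0.
Proof.
rewrite memv_cap => /andP[/(l_subP e_basis e_deg) f0 _]; apply: (entP e_basis) => a b.
rewrite entE [RHS]/(ent _ _ _) lfunE linear0; case: ifP => // ab; apply: f0.
by rewrite gt_eqF.
Qed.

(** n is an ideal of q_1, so the projection to l_1 is a Lie homomorphism; the projection to n in
    general is not. *)
Lemma pil_scomm (f u : 'End(V)) : f \in q1_sub V -> u \in q1_sub V ->
  pil (scomm f u) = scomm (pil f) (pil u).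
Proof.
rewrite !(q1P e_basis e_deg) => /andP[/(q_subP e_basis e_deg) f0 _] /andP[/(q_subP e_basis e_deg) u0 _].
apply: (entP e_basis) => a b; rewrite entE !(ent_scomm e_basis e_deg).
case: eqP => [ab|ab]; last first.
  rewrite big1 // => c _; rewrite !entE.
  have [ac|_] := eqVneq (dg a) (dg c); last by rewrite !mul0r mulr0 subr0.
  have [cb|_] := eqVneq (dg c) (dg b); last by rewrite !mulr0 subr0.
  by case: ab; rewrite ac cb.
apply: eq_bigr => c _; rewrite !entE.
have [ac|ac|ac] := ltgtP (dg c) (dg a).
- have -> : (dg c == dg b) = false by rewrite -ab lt_eqF.
  rewrite /= (u0 c b) ?(f0 c b) -?ltNge -?ab //.
  by rewrite !(mul0r, mulr0).
- by rewrite /= (f0 a c) ?(u0 a c) -?ltNge // !(mul0r, mulr0).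
by rewrite ac -ab !eqxx.
Qed.

Lemma pin_gr m f : f \in end_gr V m -> pin f \in end_gr V m.
Proof.
move=> /(end_grP e_basis e_deg) f0; apply/(end_grP e_basis e_deg) => a b /f0 ab.
by rewrite entE ab if_same.
Qed.

Lemma pil_gr m f : f \in end_gr V m -> pil f \in end_gr V m.
Proof.
move=> /(end_grP e_basis e_deg) f0; apply/(end_grP e_basis e_deg) => a b /f0 ab.
by rewrite entE ab if_same.
Qed.

Definition pulln (z : dual k Ln) : dual k Lq :=
  linfun (fun x : Lq => z (vsproj (n_sub V) (pin (vsval x))) : k^o).
Definition pulll (z : dual k Ll) : dual k Lq :=
  linfun (fun x : Lq => z (vsproj (l1_sub V) (pil (vsval x))) : k^o).

Lemma pullnE z x : pulln z x = z (vsproj (n_sub V) (pin (vsval x))).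
Proof.
apply: (linfunE (f := fun x : Lq => z (vsproj (n_sub V) (pin (vsval x))) : k^o)) => c u v.
by rewrite linearP pin_linear !linearP.
Qed.
Lemma pulllE z x : pulll z x = z (vsproj (l1_sub V) (pil (vsval x))).
Proof.
apply: (linfunE (f := fun x : Lq => z (vsproj (l1_sub V) (pil (vsval x))) : k^o)) => c u v.
by rewrite linearP pil_linear !linearP.
Qed.

Fact pulln_linear : linear pulln.
Proof. by move=> c u v; apply/lfunP => x; rewrite add_lfunE scale_lfunE !pullnE add_lfunE scale_lfunE. Qed.
Fact pulll_linear : linear pulll.
Proof. by move=> c u v; apply/lfunP => x; rewrite add_lfunE scale_lfunE !pulllE add_lfunE scale_lfunE. Qed.

Lemma pulln_deg m z : dual_deg m z -> dual_deg m (pulln z).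
Proof.
move=> mz j x; rewrite gl_grE => xj jm; rewrite pullnE (mz j) //.
by rewrite gl_grE vsprojK ?pin_n // pin_gr.
Qed.
Lemma pulll_deg m z : dual_deg m z -> dual_deg m (pulll z).
Proof.
move=> mz j x; rewrite gl_grE => xj jm; rewrite pulllE (mz j) //.
by rewrite gl_grE vsprojK ?pil_l1 ?subvsP // pil_gr.
Qed.

Lemma dual_resE (A W : {vspace 'End(V)}) (z : dual k (sub_gLie W)) (x : subvs_of A) :
  dual_res A z x = z (vsproj W (vsval x)).
Proof.
apply: (linfunE (f := fun x : subvs_of A => z (vsproj W (vsval x)) : k^o)) => c u v.
by rewrite !linearP.
Qed.

Fact dual_res_linear (A W : {vspace 'End(V)}) :
  linear (@dual_res k V A W).
Proof. by move=> c u v; apply/lfunP => x; rewrite add_lfunE scale_lfunE !dual_resE add_lfunE scale_lfunE. Qed.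

Lemma dual_res_deg (A W : {vspace 'End(V)}) m (z : dual k (sub_gLie W)) : (A <= W)%VS ->
  dual_deg m z -> dual_deg m (dual_res A z).
Proof.
move=> AW mz j x; rewrite gl_grE => xj jm; rewrite dual_resE (mz j) //.
by rewrite gl_grE vsprojK // (subvP AW) ?subvsP.
Qed.

Let lq := subvP (l1_q1 e_basis e_deg).
Let nq := subvP (n_q1 e_basis e_deg).

Lemma res_n_pulln z : dual_res (n_sub V) (pulln z) = z.
Proof.
apply/lfunP => x; rewrite dual_resE pullnE vsprojK ?nq ?subvsP //.
by rewrite pin_id ?subvsP // vsvalK.
Qed.
Lemma res_l_pulln z : dual_res (l1_sub V) (pulln z) = 0.
Proof.
apply/lfunP => x; rewrite dual_resE pullnE vsprojK ?lq ?subvsP //.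
by rewrite pin_l ?subvsP // !linear0 lfunE.
Qed.
Lemma res_l_pulll z : dual_res (l1_sub V) (pulll z) = z.
Proof.
apply/lfunP => x; rewrite dual_resE pulllE vsprojK ?lq ?subvsP //.
by rewrite pil_id ?subvsP // vsvalK.
Qed.
Lemma res_n_pulll z : dual_res (n_sub V) (pulll z) = 0.
Proof.
apply/lfunP => x; rewrite dual_resE pulllE vsprojK ?nq ?subvsP //.
by rewrite pil_n ?subvsP // !linear0 lfunE.
Qed.
Lemma pull_res z : pulll (dual_res (l1_sub V) z) + pulln (dual_res (n_sub V) z) = z.
Proof.
apply/lfunP => x; rewrite add_lfunE pulllE pullnE !dual_resE.
rewrite !vsprojK ?pil_l1 ?pin_n ?subvsP //.
transitivity (z (vsproj (q1_sub V) (pil (vsval x) + pin (vsval x)))); first by rewrite !linearD.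
by rewrite -pin_pil ?subvsP // vsvalK.
Qed.

Lemma Xq_res_l a b : dual_res (l1_sub V) (Xq a b) = Xl a b.
Proof. by apply/lfunP => x; rewrite dual_resE !UxiE vsprojK // lq ?subvsP. Qed.
Lemma Xq_res_n a b : dual_res (n_sub V) (Xq a b) = Xn a b.
Proof. by apply/lfunP => x; rewrite dual_resE !UxiE vsprojK // nq ?subvsP. Qed.

Lemma Xl0 a b : dg a != dg b -> Xl a b = 0.
Proof.
move=> ab; apply/lfunP => x; rewrite UxiE lfunE /=.
have := subvsP x; rewrite memv_cap => /andP[/(l_subP e_basis e_deg) -> // _].
by rewrite mulr0.
Qed.

Lemma l1_deg0 (x : Ll) : vsval x \in end_gr V 0.
Proof.
have := subvsP x; rewrite memv_cap => /andP[/(l_subP e_basis e_deg) x0 _].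
by apply/(end_grP e_basis e_deg) => a b; rewrite subr_eq0; apply: x0.
Qed.

Lemma l1_n (x : Ll) (y : Ln) : scomm (vsval x) (vsval y) \in n_sub V.
Proof.
have := subvsP x; rewrite memv_cap => /andP[/(l_subP e_basis e_deg) x0 _].
have /(n_subP e_basis e_deg) y0 := subvsP y.
apply/(n_subP e_basis e_deg) => a b ab; rewrite (ent_scomm e_basis e_deg) big1 // => c _.
have [ac|ac] := eqVneq (dg a) (dg c).
  rewrite (y0 c b) -?ac // mulr0 sub0r; have [cb|cb] := eqVneq (dg c) (dg b).
    by rewrite (y0 a c) ?mul0r ?mulr0 ?oppr0 // -ac ltxx.
  by rewrite (x0 c b) // !mulr0 oppr0.
rewrite (x0 a c) // mul0r sub0r; have [cb|cb] := eqVneq (dg c) (dg b).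
  by rewrite (y0 a c) ?mul0r ?mulr0 ?oppr0 // cb.
by rewrite (x0 c b) // !mulr0 oppr0.
Qed.

Lemma coadE (x : Ll) z (y : Ln) : coad x z y = - z (vsproj (n_sub V) (scomm (vsval x) (vsval y))).
Proof.
apply: (linfunE (f := fun y : subvs_of (n_sub V) =>
  - z (vsproj (n_sub V) (scomm (vsval x) (vsval y))) : k^o)) => c u v.
by rewrite linearP (scommPr e_basis e_deg) !linearP.
Qed.

Fact coad_linear (x : Ll) : linear (coad x).
Proof.
move=> c u v; apply/lfunP => y; rewrite add_lfunE scale_lfunE !coadE add_lfunE scale_lfunE.
by rewrite opprD scalerN.
Qed.

Lemma coad_deg m (x : Ll) z : dual_deg m z -> dual_deg m (coad x z).
Proof.
move=> mz j y; rewrite gl_grE => yj jm; rewrite coadE (mz j) ?oppr0 //.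
rewrite gl_grE vsprojK ?l1_n // -[j]add0r.
exact: (scomm_gr e_basis e_deg (l1_deg0 x) yj).
Qed.

(* The decomposition of x |-> x . E_ab^* on which d(u_ab) in C(l_1, C(n)) is
   computed. *)
Definition coad_eta a b (i : 'I_n + 'I_n) : dual k Ll := match i with
  | inl c => (- (sg a b * sg a c * sg c b)) *: Xl a c
  | inr c => (sg a b * sg a c * sg c b) *: Xl c b end.
Definition coad_b a b (i : 'I_n + 'I_n) : dual k Ln := match i with
  | inl c => Xn c b | inr c => Xn a c end.

Lemma coad_Xn (x : Ll) a b :
  coad x (Xn a b) = \sum_i (coad_eta a b i x : k) *: coad_b a b i.
Proof.
apply/lfunP => y; rewrite coadE UxiE vsprojK ?l1_n // (ent_scomm e_basis e_deg) sum_lfunE.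
rewrite big_sumType /= -big_split mulr_sumr -sumrN; apply: eq_bigr => c _ /=.
rewrite !scale_lfunE !UxiE /GRing.scale /=.
have -> : sgn k ((dg a - dg c) * (dg c - dg b)) * (ent (vsval y) a c * ent (vsval x) c b)
    = ent (vsval y) a c * ent (vsval x) c b.
  have [cb|cb] := eqVneq (dg c) (dg b); first by rewrite cb subrr mulr0 /sgn expr0z mul1r.
  have := subvsP x; rewrite memv_cap => /andP[/(l_subP e_basis e_deg) -> // _].
  by rewrite !mulr0.
by rewrite /sg; signs; ring.
Qed.

(** v and u model the l_1 and n parts of x_ab. As v lives in blocks of equal degree, the signs
    collapse to [s a]. Both are arbitrary because the identity is applied in C(l_1, C(n, k)) and
    again inside C(q_1, k). *)
Lemma cross_terms (C : gcAlg k) (v u : 'I_n -> 'I_n -> C) a b :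
  (forall a b, hdeg (1 + dg b - dg a) (v a b)) -> (forall a b, hdeg (1 + dg b - dg a) (u a b)) ->
  (forall a b, dg a != dg b -> v a b = 0) ->
  \sum_c ((- (sg a b * sg a c * sg c b)) *: (v a c * u c b)
          + (sg a b * sg a c * sg c b) *: (v c b * u a c))
  = - s a *: \sum_c (v a c * u c b + u a c * v c b).
Proof.
move=> vd ud v0; rewrite scaler_sumr; apply: eq_bigr => c _; rewrite scalerDr; congr (_ + _).
  have [ac|ac] := eqVneq (dg a) (dg c); last by rewrite v0 // mul0r !scaler0.
  by rewrite /sg ac; signs; lmod k.
have [cb|cb] := eqVneq (dg c) (dg b); last by rewrite v0 // mul0r mulr0 !scaler0.
rewrite (gc_mulC (vd c b) (ud a c)) /sg -cb.
by signs; lmod k.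
Qed.
End Projections.

Lemma lrmorph_coef (k : fieldType) (L : gLie k) (Q : CE_trivial L) (B : gcAlg k)
    (F : {lrmorphism Q -> B}) c : F (ce_coef Q c) = c%:A.
Proof.
have [G GE] := lrmorph_comp F (ce_coef Q).
by transitivity (G c); [apply/esym/GE|apply: (lrmorph_ground G)].
Qed.

Lemma ce_trivial_eq (k : fieldType) (L : gLie k) (Q : CE_trivial L) (B : gcAlg k)
    (F G : {lrmorphism Q -> B}) : gpres F -> gpres G ->
  (forall z, F (ce_gen Q z) = G (ce_gen Q z)) -> F =1 G.
Proof.
move=> F_gr G_gr FG; have fl : linear (fun z => F (ce_gen Q z)) by move=> c u v; rewrite !linearP.
have [f fE] := linear_of fl.
have f_deg m z : dual_deg m z -> hdeg (m + 1) (f z).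
  by move=> mz; rewrite fE; apply/F_gr/ce_gen_deg.
have [H [_ _ _ H_uniq]] := ce_free Q (@ground_alg_gpres k B) f_deg.
move=> y; rewrite (H_uniq F) ?(H_uniq G) // => z; rewrite ?fE ?FG ?lrmorph_coef //.
Qed.

Lemma ce_trivial_hom (k : fieldType) (L : gLie k) (Q : CE_trivial L) (B : gcAlg k)
    (f : dual k L -> B) : linear f -> (forall m z, dual_deg m z -> hdeg (m + 1) (f z)) ->
  exists F : {lrmorphism Q -> B}, gpres F /\ forall z, F (ce_gen Q z) = f z.
Proof.
move=> fl f_deg; have [h hE] := linear_of fl.
have h_deg m z : dual_deg m z -> hdeg (m + 1) (h z) by rewrite hE; apply: f_deg.
have [F [F_gr _ Fg _]] := ce_free Q (@ground_alg_gpres k B) h_deg.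
by exists F; split=> // z; rewrite Fg hE.
Qed.

(** * C(l_1, C(n, k)) and its comparison with C(q_1, k) *)

Section Quotient.
Variables (k : fieldType) (V : gvect k) (n : nat) (e : n.-tuple V) (dg : 'I_n -> int).
Hypothesis e_basis : basis_of fullv e.
Hypothesis e_deg : forall a : 'I_n, e`_a \in gv_gr V (dg a).
Hypothesis k2 : 2%:R != 0 :> k.
Local Notation s a := (sgn k (dg a)).
Local Notation Lq := (sub_gLie (q1_sub V)).
Local Notation Ll := (sub_gLie (l1_sub V)).
Local Notation Ln := (sub_gLie (n_sub V)).
Local Notation Xq := (Uxi e dg (q1_sub V)).
Local Notation Xl := (Uxi e dg (l1_sub V)).
Local Notation Xn := (Uxi e dg (n_sub V)).

Lemma dif_eq_w (U : {vspace 'End(V)}) (Q : CE_trivial (sub_gLie U)) (B : gcAlg k)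
    (c : {lrmorphism Q -> B}) (f g : {linear Q -> B}) :
  (forall m f, f \in U -> end_comp m f \in U) ->
  leibniz c 1 f -> leibniz c 1 g ->
  (forall a b, f (ce_gen Q (Uxi e dg U a b)) = g (ce_gen Q (Uxi e dg U a b))) -> f =1 g.
Proof.
move=> U_gr f_l g_l fg.
have [N [x [m [x_basis x_hom]]]] := graded_basis e_basis e_deg U_gr.
have Cx := ce_free_on e_basis e_deg U_gr x_basis x_hom Q.
have X_deg i := dualb_deg e_basis e_deg U_gr x_basis x_hom (i := i).
apply: (leibniz_eq Cx f_l g_l) => i.
have [t [_ ->]] := ce_gen_expand e_basis e_deg U_gr Q (X_deg i).
rewrite !linear_sum; apply: eq_bigr => a _; rewrite !linear_sum; apply: eq_bigr => b _.
by rewrite !linearZ /= fg.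
Qed.

Section Action.
Variable Qn : CE_trivial Ln.

Lemma action_exists : exists act : Ll -> {linear Qn -> Qn},
  (forall x, is_der 0 (act x)) /\
  (forall x z, act x (ce_gen Qn z) = ce_gen Qn (coad x z)).
Proof.
have U_gr := n_gr e_basis e_deg.
have [N [f [m [f_basis f_hom]]]] := graded_basis e_basis e_deg U_gr.
have Cx := ce_free_on e_basis e_deg U_gr f_basis f_hom Qn.
have X_deg i := dualb_deg e_basis e_deg U_gr f_basis f_hom (i := i).
have act_ex (x : Ll) : exists a : {linear Qn -> Qn},
    is_der 0 a /\ forall z, a (ce_gen Qn z) = ce_gen Qn (coad x z).
  have [|a [a_der ax]] := der_exists Cx (r := 0) (b := fun i => ce_gen Qn (coad x (dualb f i))).
    move=> i; apply: hdeg_cast (ce_gen_deg Qn (coad_deg e_basis e_deg x (X_deg i))) _.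
    by ring.
  exists a; split=> // z; have [T TE] := linear_of (coad_linear e_basis e_deg x).
  rewrite -TE {1 2}(dualb_expand f_basis z) !linear_sum; apply: eq_bigr => i _.
  by rewrite !linearZ /= TE ax.
exists (fun x => sval (constructive_indefinite_description _ (act_ex x))).
by split=> x; have [h1 h2] := svalP (constructive_indefinite_description _ (act_ex x)).
Qed.

Variable act : Ll -> {linear Qn -> Qn}.
Hypothesis act_mul : forall x a b, act x (a * b) = act x a * b + a * act x b.
Hypothesis act_gen : forall x z, act x (ce_gen Qn z) = ce_gen Qn (coad x z).

Lemma act_Xn x a b : act x (ce_gen Qn (Xn a b))
  = \sum_i (coad_eta e dg a b i x : k) *: ce_gen Qn (coad_b e dg a b i).
Proof.
rewrite act_gen (coad_Xn e_basis e_deg) linear_sum.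
by apply: eq_bigr => i _; rewrite linearZ.
Qed.

Section Coefficients.
Variable P : CE (fun x a => act x a).
Local Notation v a b := (ce_gen P (Xl a b)).
Local Notation u a b := (ce_coef P (ce_gen Qn (Xn a b))).

Let vd a b : hdeg (1 + dg b - dg a) (v a b).
Proof. exact: (w_deg e_basis e_deg (@ce_gen_deg _ _ _ _ P)). Qed.
Let ud a b : hdeg (1 + dg b - dg a) (u a b).
Proof. apply: ce_coef_deg; exact: (w_deg e_basis e_deg (@ce_gen_deg _ _ _ _ Qn)). Qed.

(** The products v v come from l_1, u u from n, and the mixed ones from the action; together v + u
    satisfies the structure equation of x_ab in C(q_1, k). *)
Lemma dif_vu a b : dif (v a b + u a b) = - s a *: \sum_c (v a c + u a c) * (v c b + u c b).
Proof.
rewrite linearD /= (dif_w e_basis e_deg k2 (l1_br e_basis e_deg) (@ce_gen_deg _ _ _ _ P)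
  (@ce_dif_gen _ _ _ _ P)).
rewrite (ce_dif_coef_fin P (fun x => act_Xn x a b)).
rewrite (dif_w e_basis e_deg k2 (n_br e_basis e_deg) (@ce_gen_deg _ _ _ _ Qn)
  (@ce_dif_gen _ _ _ _ Qn)) linearZ linear_sum /=.
rewrite big_sumType /= -big_split /=.
under [X in _ + (_ + X)]eq_bigr => c _ do rewrite !linearZ /= -!scalerAl.
rewrite (cross_terms (v := fun a b => v a b) (u := fun a b => u a b) a b vd ud) => [|a' b' ab].
  rewrite -scaler_sumr rmorph_sum -!scalerDr -!big_split; congr (_ *: _); apply: eq_bigr => c _ /=.
  by rewrite rmorphM mulrDl !mulrDr; lmod k.
by rewrite (Xl0 e_basis e_deg) // linear0.
Qed.
End Coefficients.

Variable Qq : CE_trivial Lq.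

(** A morphism of graded algebras only: its failure to commute with d is the action term in
    [coef_dif]. *)
Let Cn_ex : exists F : {lrmorphism Qn -> Qq},
  gpres F /\ forall z, F (ce_gen Qn z) = ce_gen Qq (pulln e dg z).
Proof.
apply: (@ce_trivial_hom k Ln Qn Qq (fun z => ce_gen Qq (pulln e dg z))) => [c u v|m z mz].
  by rewrite (pulln_linear _ e_basis) linearP.
exact/ce_gen_deg/(pulln_deg e_basis e_deg).
Qed.
Let Cn : {lrmorphism Qn -> Qq} := sval (constructive_indefinite_description _ Cn_ex).
Let Cn_gr : gpres Cn. Proof. exact: (svalP (constructive_indefinite_description _ Cn_ex)).1. Qed.
Let Cn_gen z : Cn (ce_gen Qn z) = ce_gen Qq (pulln e dg z).
Proof. exact: (svalP (constructive_indefinite_description _ Cn_ex)).2. Qed.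

Let genl_linear : linear (fun z => ce_gen Qq (pulll e dg z)).
Proof. by move=> c u v; rewrite (pulll_linear _ e_basis) linearP. Qed.
Let genl : {linear dual k Ll -> Qq} := sval (linear_of genl_linear).
Let genlE z : genl z = ce_gen Qq (pulll e dg z). Proof. exact: (svalP (linear_of genl_linear)). Qed.

Let genl_deg m z : dual_deg m z -> hdeg (m + 1) (genl z).
Proof. by move=> mz; rewrite genlE; apply/ce_gen_deg/(pulll_deg e_basis e_deg). Qed.

Let l1_dual_deg (z : dual k Ll) : dual_deg 0 z.
Proof.
move=> j x; rewrite gl_grE oppr0 => xj j0.
suff -> : x = 0 by rewrite linear0.
apply: val_inj; rewrite /= -(end_comp_id e_basis e_deg (l1_deg0 e_basis e_deg x)).
exact: (end_comp_neq e_basis e_deg xj j0).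
Qed.

Let genl_dif : ce_dif_spec (@dif _ Qq) genl.
Proof.
move=> z r p q eta zeta eta_p zeta_q zE; rewrite genlE.
rewrite (ce_dif_gen Qq (p := p) (q := q) (eta := fun i => pulll e dg (eta i))
  (zeta := fun i => pulll e dg (zeta i))) => [|i|i|x y].
- by congr (_ *: _); apply: eq_bigr => i _; rewrite !genlE.
- exact: (pulll_deg e_basis e_deg).
- exact: (pulll_deg e_basis e_deg).
rewrite (pulllE _ e_basis) /= vsprojK ?(q1_br e_basis e_deg) ?subvsP //.
rewrite (pil_scomm e_basis e_deg) ?subvsP //.
rewrite -{1}(vsprojK (pil_l1 e_basis e_deg (subvsP x))) -{1}(vsprojK (pil_l1 e_basis e_deg (subvsP y))).
by rewrite zE; apply: eq_bigr => i _; rewrite !(pulllE _ e_basis).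
Qed.

(** [ce_dif_coef] ranges over all decompositions of the action. The correction term does not depend
    on the decomposition, and its dual-basis form makes sense for every a and is linear in a. *)
Let genl_expand N (f : N.-tuple Ll) (I : finType) (a : Qn) (eta : I -> dual k Ll) (b : I -> Qn) :
  basis_of fullv f -> (forall x, act x a = \sum_s (eta s x : k) *: b s) ->
  \sum_s genl (eta s) * Cn (b s) = \sum_i genl (dualb f i) * Cn (act f`_i a).
Proof.
move=> f_basis aE.
under [RHS]eq_bigr => i _ do rewrite aE linear_sum mulr_sumr.
rewrite exchange_big; apply: eq_bigr => s _ /=.
rewrite {1}(dualb_expand f_basis (eta s)) linear_sum mulr_suml; apply: eq_bigr => i _.
by rewrite !linearZ /= -scalerAl -scalerAr.
Qed.

(** In the dual-basis form both sides are derivations along [Cn] in a, so it suffices to let a be a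
    dual matrix unit. *)
Let coef_dif (I : finType) (a : Qn) (eta : I -> dual k Ll) (b : I -> Qn) :
  (forall x, act x a = \sum_s (eta s x : k) *: b s) ->
  dif (Cn a) = Cn (dif a) + \sum_s genl (eta s) * Cn (b s).
Proof.
have [N [f [m [f_basis f_hom]]]] := graded_basis e_basis e_deg (l1_gr e_basis e_deg).
move=> aE; rewrite (genl_expand f_basis aE) {aE}.
have El : linear (fun a => Cn (dif a) + \sum_i genl (dualb f i) * Cn (act f`_i a)).
  move=> c x y; rewrite !linearP /= scalerDr addrACA scaler_sumr -big_split.
  by congr (_ + _); apply: eq_bigr => i _; rewrite !linearP /= mulrDr scalerAr.
have Dl : linear (fun a => dif (Cn a)) by move=> c x y; rewrite !linearP.
have [E EE] := linear_of El; have [D DE] := linear_of Dl.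
rewrite -EE -DE; move: a {eta b I}; apply: (dif_eq_w (c := Cn) (n_gr e_basis e_deg)).
- by move=> j x y xj; rewrite !DE rmorphM (dif_mul _ (Cn_gr xj)) mul1r.
- move=> j x y xj; rewrite !EE (dif_mul _ xj) linearD linearZ /= !rmorphM mul1r.
  have -> : \sum_i genl (dualb f i) * Cn (act f`_i (x * y))
      = (\sum_i genl (dualb f i) * Cn (act f`_i x)) * Cn y
        + sgn k j *: (Cn x * \sum_i genl (dualb f i) * Cn (act f`_i y)).
    rewrite mulr_suml mulr_sumr scaler_sumr -big_split; apply: eq_bigr => i _ /=.
    rewrite act_mul rmorphD !rmorphM mulrDr !mulrA; congr (_ + _).
    rewrite (gc_mulC (genl_deg (l1_dual_deg (dualb f i))) (Cn_gr xj)) -scalerAl.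
    by rewrite add0r mul1r.
  by rewrite mulrDl mulrDr; lmod k.
move=> a b; rewrite DE EE -(genl_expand f_basis (fun x => act_Xn x a b)).
set v := fun a b => genl (Xl a b); set u := fun a b => Cn (ce_gen Qn (Xn a b)).
have vuE a' b' : ce_gen Qq (Xq a' b') = v a' b' + u a' b'.
  rewrite /v /u genlE Cn_gen -linearD -(Xq_res_l e_basis e_deg) -(Xq_res_n e_basis e_deg) /=.
  by rewrite (pull_res e_basis e_deg).
have vd a' b' : hdeg (1 + dg b' - dg a') (v a' b') by exact: (w_deg e_basis e_deg genl_deg).
have ud a' b' : hdeg (1 + dg b' - dg a') (u a' b').
  by apply: Cn_gr; exact: (w_deg e_basis e_deg (@ce_gen_deg _ _ _ _ Qn)).
have v0 a' b' : dg a' != dg b' -> v a' b' = 0.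
  by move=> ab; rewrite /v (Xl0 e_basis e_deg) // linear0.
rewrite big_sumType /= -big_split /=.
under eq_bigr => c _ do rewrite !linearZ /= -!scalerAl.
have := cross_terms a b vd ud v0; rewrite /v /u => -> /=.
rewrite (dif_w e_basis e_deg k2 (n_br e_basis e_deg) (@ce_gen_deg _ _ _ _ Qn)
  (@ce_dif_gen _ _ _ _ Qn)) linearZ rmorph_sum /=.
(* The value of d on the n part is obtained as d x_ab minus d of the l_1 part. *)
have := dif_w e_basis e_deg k2 (q1_br e_basis e_deg) (@ce_gen_deg _ _ _ _ Qq)
  (@ce_dif_gen _ _ _ _ Qq) a b.
rewrite vuE linearD /= (dif_w e_basis e_deg k2 (l1_br e_basis e_deg) genl_deg genl_dif).
move/(canRL (addKr _)) => ->; rewrite -scalerDr -scalerN -scalerDr -sumrN -!big_split.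
congr (_ *: _); apply: eq_bigr => c _ /=.
by rewrite !vuE rmorphM mulrDl !mulrDr /v /u; lmod k.
Qed.

(** No tensor product is built: C(q_1, k) with the maps [Cn] and [genl] already has the universal
    property and the differential of C(l_1, C(n, k)). *)
Lemma coefficients_exist : inhabited (CE (fun x a => act x a)).
Proof.
have lq := l1_q1 e_basis e_deg; have nq := n_q1 e_basis e_deg.
suff free (B : gcAlg k) (a : {lrmorphism Qn -> B}) (f : {linear dual k Ll -> B}) :
    gpres a -> (forall m z, dual_deg m z -> hdeg (m + 1) (f z)) ->
    exists F : {lrmorphism Qq -> B}, [/\ gpres F, forall x, F (Cn x) = a x,
      forall z, F (genl z) = f z
      & forall F' : {lrmorphism Qq -> B}, gpres F' -> (forall x, F' (Cn x) = a x) ->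
          (forall z, F' (genl z) = f z) -> F' =1 F].
  constructor; apply: (@MkCE k Ll Qn (fun x a => act x a) Qq Cn genl Cn_gr genl_deg free genl_dif).
  by move=> a r eta b; apply: coef_dif.
move=> a_gr f_deg.
have [||F [F_gr Fg]] := @ce_trivial_hom k Lq Qq B (fun z =>
    f (dual_res (l1_sub V) z) + a (ce_gen Qn (dual_res (n_sub V) z))).
- by move=> c u v; rewrite !dual_res_linear !linearP /=; lmod k.
- move=> m z mz; apply: hdegD; first by apply/f_deg/(dual_res_deg lq).
  by apply/a_gr/ce_gen_deg/(dual_res_deg nq).
have FC x : F (Cn x) = a x.
  have [H HE] := lrmorph_comp F Cn.
  rewrite -[LHS]HE; apply: ce_trivial_eq => // [m z mz|z].
    by rewrite HE; apply/F_gr/Cn_gr.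
  by rewrite HE /= Cn_gen Fg (res_l_pulln e_basis e_deg) (res_n_pulln e_basis e_deg) linear0 add0r.
have Fl z : F (genl z) = f z.
  by rewrite genlE Fg (res_l_pulll e_basis e_deg) (res_n_pulll e_basis e_deg) linear0 rmorph0 addr0.
exists F; split=> // F' F'_gr F'C F'l; apply: ce_trivial_eq => // z.
by rewrite -(pull_res e_basis e_deg z) !linearD /= -genlE -Cn_gen F'C F'l FC Fl.
Qed.

Lemma comparison (P : CE (fun x a => act x a)) :
  exists F : {lrmorphism Qq -> P}, is_dg_iso F /\
    forall z, F (ce_gen Qq z) = ce_gen P (dual_res (l1_sub V) z)
      + ce_coef P (ce_gen Qn (dual_res (n_sub V) z)).
Proof.
have lq := l1_q1 e_basis e_deg; have nq := n_q1 e_basis e_deg.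
have [||F [F_gr Fg]] := @ce_trivial_hom k Lq Qq P (fun z =>
    ce_gen P (dual_res (l1_sub V) z) + ce_coef P (ce_gen Qn (dual_res (n_sub V) z))).
- by move=> c u v; rewrite !dual_res_linear !linearP /=; lmod k.
- move=> m z mz; apply: hdegD; first by apply/ce_gen_deg/(dual_res_deg lq).
  by apply/ce_coef_deg/ce_gen_deg/(dual_res_deg nq).
exists F; split=> //.
have [G [G_gr Gc Gg _]] := ce_free P Cn_gr genl_deg.
have GF : cancel F G.
  have [H HE] := lrmorph_comp G F.
  move=> y; rewrite -[LHS]HE -[RHS]/((idfun : {lrmorphism Qq -> Qq}) y).
  apply: ce_trivial_eq => // [m z mz|z]; first by rewrite HE; apply/G_gr/F_gr.
  rewrite HE /= Fg linearD /= Gg Gc genlE Cn_gen -linearD /=.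
  by rewrite (pull_res e_basis e_deg).
have FC x : F (Cn x) = ce_coef P x.
  have [H HE] := lrmorph_comp F Cn.
  rewrite -[LHS]HE; apply: ce_trivial_eq => [m z mz|m z mz|z].
  - by rewrite HE; apply/F_gr/Cn_gr.
  - exact: ce_coef_deg.
  by rewrite HE /= Cn_gen Fg (res_l_pulln e_basis e_deg) (res_n_pulln e_basis e_deg) linear0 add0r.
have FG : cancel G F.
  have [H HE] := lrmorph_comp F G.
  have [H0 [_ _ _ H_uniq]] := ce_free P (@ce_coef_deg _ _ _ _ P) (@ce_gen_deg _ _ _ _ P).
  move=> y; rewrite -[LHS]HE -[RHS]/((idfun : {lrmorphism P -> P}) y).
  rewrite (H_uniq H) ?(H_uniq idfun) // => [m z mz|z|z].
  - by rewrite HE; apply/F_gr/G_gr.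
  - by rewrite HE /= Gc FC.
  rewrite HE /= Gg genlE Fg (res_l_pulll e_basis e_deg) (res_n_pulll e_basis e_deg).
  by rewrite linear0 rmorph0 addr0.
split=> //; first by exists G.
have Fdl : linear (fun y => F (dif y)) by move=> c y z; rewrite !linearP.
have dFl : linear (fun y => dif (F y)) by move=> c y z; rewrite !linearP.
have [Fd FdE] := linear_of Fdl; have [dF dFE] := linear_of dFl.
move=> y; rewrite -FdE -dFE; apply: (dif_eq_w (c := F) (q1_gr e_basis e_deg)).
- move=> m z t mz; rewrite !FdE (dif_mul _ mz) linearD linearZ /= !rmorphM.
  by rewrite mul1r.
- by move=> m z t mz; rewrite !dFE rmorphM (dif_mul _ (F_gr _ _ mz)) mul1r.
move=> a b; rewrite FdE dFE (dif_w e_basis e_deg k2 (q1_br e_basis e_deg)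
  (@ce_gen_deg _ _ _ _ Qq) (@ce_dif_gen _ _ _ _ Qq)).
have Fw a' b' : F (ce_gen Qq (Xq a' b'))
    = ce_gen P (Xl a' b') + ce_coef P (ce_gen Qn (Xn a' b')).
  by rewrite Fg (Xq_res_l e_basis e_deg) (Xq_res_n e_basis e_deg).
rewrite Fw dif_vu linearZ linear_sum; congr (_ *: _); apply: eq_bigr => c _.
by rewrite /= rmorphM /= !Fw.
Qed.
End Action.
End Quotient.

Theorem theorem3p12 (k : fieldType) (hk : [pchar k] =i pred0)
    (V : gvect k) (n : nat) (e : n.-tuple V)
    (he : basis_of fullv e)
    (he_hom : forall a : 'I_n, exists i : int, e`_a \in gv_gr V i)
    (he_borel : (b_plus e <= q_sub V)%VS) :
  inhabited (RCom_quotient e) /\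
  forall Q : RCom_quotient e,
    (exists F : {lrmorphism rc_q Q -> rc_ln Q}, is_dg_iso F /\ is_canonical F)
    /\
    exists (M : dBVAlg k) (br : M -> M -> M) (hbr : is_gerstenhaber br),
      is_bv_bracket br /\ quasi_isomorphic (DGAlg (rc_brP Q)) (DGAlg hbr).
Proof.
have k2 : 2%:R != 0 :> k by have := hk 2; rewrite !inE /= => ->.
pose dg (a : 'I_n) := sval (constructive_indefinite_description _ (he_hom a)).
have e_deg (a : 'I_n) : e`_a \in gv_gr V (dg a)
  by exact: svalP (constructive_indefinite_description _ (he_hom a)).
(* For a <= b the unit e_ab lies in the Borel subalgebra, hence in q, so it cannot lower degrees; it
   maps degree dg b to degree dg a. *)
have dg_mono (a b : 'I_n) : (a <= b)%N -> dg b <= dg a.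
  move=> ab; apply: contraT => ba.
  have /(subvP he_borel)/(q_subP he e_deg)/(_ _ _ ba) : munit e a b \in b_plus e.
    apply/(b_plusP he) => c d; rewrite (ent_munit he) -ltnNge.
    by case: eqP => [->|//]; case: eqP => [->|//]; rewrite ltnNge ab.
  by move/eqP; rewrite (ent_munit he) !eqxx oner_eq0.
split=> [|Q].
  have [Qn] := ce_exists he e_deg k2 (n_gr he e_deg) (n_br he e_deg).
  have [Qq] := ce_exists he e_deg k2 (q1_gr he e_deg) (q1_br he e_deg).
  have [act [act_der act_gen]] := action_exists he e_deg Qn.
  have act_mul x a b : act x (a * b) = act x a * b + a * act x b.
    have [_ act_l] := act_der x; elim/gc_ind: a => [u v IHu IHv|m u um].
      by rewrite mulrDl !linearD /= IHu IHv !mulrDl addrACA.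
    by rewrite (act_l _ _ _ um) mul0r /sgn expr0z scale1r.
  have [P] := coefficients_exist he e_deg k2 act_mul act_gen Qq.
  have [br [brP br_gen]] := bracket_exists he e_deg k2 dg_mono Qq.
  by constructor; apply: (MkRComQuotient act_mul act_gen P brP br_gen).
split; last exact: (quotient_bv he e_deg k2 (rc_brP Q) (@rc_br_gen _ _ _ _ Q)).
exact: (comparison he e_deg k2 (@rc_act_gen _ _ _ _ Q)).
Qed.
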